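(* Let $\Omega$ be a hyperbolic subdomain of $\hat{\mathbb C}$ and let $\lambda(z)\,|dz|$ be a conformal pseudometric on $\Omega$ with curvature $\kappa_\lambda\le -4$. Suppose that $\{z_n\}$ is a sequence of points in $\Omega$ tending to a boundary point $p\in\partial\Omega$. If $$\frac{\lambda(z_n)}{\lambda_\Omega(z_n)}=1+o\left(e^{-4\,\mathrm d_\Omega(z_n,q)}\right)\qquad(n\to\infty)$$ for one (and hence for any) $q\in\Omega$, then $\lambda=\lambda_\Omega$ on $\Omega$.
   Context: $\hat{\mathbb C}=\mathbb C\cup\{\infty\}$ is the Riemann sphere. A hyperbolic subdomain $\Omega$ of $\hat{\mathbb C}$ is a non-empty, open, connected subset such that $\hat{\mathbb C}\setminus\Omega$ contains at least three distinct points; boundaries are taken in $\hat{\mathbb C}$. A conformal pseudometric $\lambda(z)\,|dz|$ on a domain $G\subseteq\mathbb C$ is a continuous function $\lambda:G\to[0,\infty)$; it is assumed throughout to be of class $C^2$ on the open set $G_\lambda=\{z\in G:\lambda(z)>0\}$. Its Gauss curvature is $\kappa_\lambda(z)=-\Delta(\log\lambda)(z)/\lambda(z)^2$ for $z\in G_\lambda$, and ''$\kappa_\lambda\le-4$'' means $\kappa_\lambda(z)\le-4$ for all $z\in G_\lambda$. On subdomains of $\hat{\mathbb C}$ these notions are defined via local coordinates, with the transformation rule $(f^*\lambda)(z)\,|dz|=\lambda(f(z))\,|f'(z)|\,|dz|$ (curvature is conformally invariant, and the ratio of two pseudometrics with non-zero denominator is a well-defined function). The hyperbolic metric of the unit disk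 $\mathbb D$ is $\lambda_{\mathbb D}(z)\,|dz|=|dz|/(1-|z|^2)$ (curvature $-4$). The hyperbolic metric $\lambda_\Omega(z)\,|dz|$ of $\Omega$ is defined by $\lambda_\Omega(\pi(z))|\pi'(z)|=\lambda_{\mathbb D}(z)$ for a holomorphic universal covering $\pi:\mathbb D\to\Omega$. The hyperbolic distance is $\mathrm d_\Omega(z,w)=\inf_\gamma\int_\gamma\lambda_\Omega(\zeta)\,|d\zeta|$, the infimum being over all piecewise smooth curves $\gamma$ in $\Omega$ joining $z$ and $w$. *)

(* Defs.v *)
From HB Require Import structures.
From mathcomp Require Import all_boot all_order all_algebra.
From mathcomp Require Import all_classical all_reals all_analysis.
From mathcomp Require Import complex.

Set Implicit Arguments.
Unset Strict Implicit.
Unset Printing Implicit Defensive.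

Import Order.TTheory GRing.Theory Num.Theory.
Import numFieldNormedType.Exports.

Local Open Scope classical_set_scope.
Local Open Scope ring_scope.
Local Open Scope complex_scope.

(* [R[i]^o] is R[i] with its usual topology, as a normed space over itself. *)
Notation Cplx R := (R[i]^o).
(* [Some z] is the finite point z, [None] is the point at infinity. *)
Notation Sphere R := (one_point_compactification (Cplx R)).

Section RiemannSphere.
Context {R : realType}.
Local Notation C := (Cplx R).
Local Notation S := (Sphere R).
Local Notation Re := (@complex.Re R).
Local Notation Im := (@complex.Im R).
Local Notation normc := (@ComplexField.Normc.normc R).

(* The atlas {z, 1/z}: [from_chart c w] is the point with coordinate [w] in the
   chart [c]; [to_chart c p] is the coordinate of [p], with the junk value 0 at
   the one point which [c] misses (recall that 0^-1 = 0). *)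
Variant chart := Affine | AtInfinity.

Definition from_chart (c : chart) (w : C) : S :=
  match c with
  | Affine => Some w
  | AtInfinity => if w == 0 then None else Some w^-1
  end.

Definition to_chart (c : chart) (p : S) : C :=
  match c, p with
  | Affine, Some z => z
  | AtInfinity, Some z => z^-1
  | _, None => 0
  end.

Definition chart_at (p : S) : chart := if p is Some _ then Affine else AtInfinity.

Definition hyperbolic_domain (Omega : set S) : Prop :=
  [/\ Omega !=set0, open Omega, connected Omega &
      exists a b c : S,
        [/\ a <> b, a <> c & b <> c] /\ [/\ ~ Omega a, ~ Omega b & ~ Omega c]].

Definition boundary (A : set S) : set S := closure A `\` interior A.

Definition dx (u : C -> R) (z : C) : R :=
  derive1 (fun x : R => u (x +i* Im z)) (Re z).

Definition dy (u : C -> R) (z : C) : R :=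
  derive1 (fun y : R => u (Re z +i* y)) (Im z).

Definition C1_on (U : set C) (u : C -> R) : Prop :=
  forall z, U z ->
    [/\ derivable (fun x : R => u (x +i* Im z)) (Re z) 1,
        derivable (fun y : R => u (Re z +i* y)) (Im z) 1,
        {for z, continuous (dx u)} & {for z, continuous (dy u)}].

Definition C2_on (U : set C) (u : C -> R) : Prop :=
  [/\ C1_on U u, C1_on U (dx u) & C1_on U (dy u)].

Definition laplacian (u : C -> R) (z : C) : R := dx (dx u) z + dy (dy u) z.

Definition gauss_curvature (f : C -> R) (z : C) : R :=
  - laplacian (fun w => ln (f w)) z / f z ^+ 2.

(* A metric lambda |dz| on a part of the sphere is encoded by one function
   [lam] on the sphere: [lam (Some z)] is its density with respect to the
   coordinate z, and [lam None] its density at infinity with respect to the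
   coordinate w = 1/z.  The density in the whole chart w = 1/z is then forced by
   the transformation rule, since |d(1/w)| = |dw| / |w|^2. *)
Definition density (lam : S -> R) (c : chart) (w : C) : R :=
  match c with
  | Affine => lam (Some w)
  | AtInfinity =>
      if w == 0 then lam None else lam (Some w^-1) / normc w ^+ 2
  end.

Definition conformal_pseudometric (Omega : set S) (lam : S -> R) : Prop :=
  forall c : chart,
    let U := from_chart c @^-1` Omega in
    let f := density lam c in
    [/\ forall w, U w -> 0 <= f w,
        forall w, U w -> {for w, continuous f} &
        C2_on (U `&` [set w | 0 < f w]) f].

Definition curvature_le (Omega : set S) (lam : S -> R) (k : R) : Prop :=
  forall (c : chart) (w : C),
    Omega (from_chart c w) -> 0 < density lam c w ->
    gauss_curvature (density lam c) w <= k.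

(* The expression of [f] in the chart adapted to [f z]; it is the genuine local
   expression of [f] near z as soon as [f] is continuous at z. *)
Definition local_expr {T : Type} (f : T -> S) (z : T) : T -> C :=
  fun w => to_chart (chart_at (f z)) (f w).

Definition holomorphic_on (U : set C) (f : C -> S) : Prop :=
  forall z, U z ->
    {for z, continuous f} /\ derivable (local_expr f z : C -> C) z 1.

(* (f^* lam)(z) = lam(f(z)) |f'(z)|. *)
Definition pullback (f : C -> S) (lam : S -> R) (z : C) : R :=
  lam (f z) * normc ('D_1 (local_expr f z : C -> C) z : R[i]).

Definition unit_disk : set C := [set z | normc z < 1].

Definition hyperbolic_density_disk (z : C) : R := 1 / (1 - normc z ^+ 2).

(* Evenly covered neighbourhoods: [sheets] is the family of the sheets over V,
   each mapped homeomorphically onto V by [f]. *)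
Definition covering_map (D : set C) (Omega : set S) (f : C -> S) : Prop :=
  [/\ f @` D = Omega, {within D, continuous f} &
      forall p, Omega p ->
        exists (V : set S) (sheets : set (set C)),
          [/\ open V /\ V p, V `<=` Omega,
              \bigcup_(U in sheets) U = D `&` f @^-1` V,
              trivIset sheets id &
              forall U, sheets U -> open U /\
                exists g : S -> C,
                  [/\ {within V, continuous g},
                      forall q, V q -> U (g q) /\ f (g q) = q &
                      forall z, U z -> g (f z) = z]]].

(* The covering is universal because the disk is simply connected. *)
Definition holomorphic_universal_covering (Omega : set S) (f : C -> S) : Prop :=
  holomorphic_on unit_disk f /\ covering_map unit_disk Omega f.

(* This determines [lamO] on [Omega]; its values off [Omega] are irrelevant. *)
Definition hyperbolic_metric (Omega : set S) (lamO : S -> R) : Prop :=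
  exists2 f : C -> S, holomorphic_universal_covering Omega f &
    forall z, unit_disk z -> pullback f lamO z = hyperbolic_density_disk z.

Definition velocity (g : R -> C) (t : R) : C :=
  derive1 (fun s => Re (g s)) t +i* derive1 (fun s => Im (g s)) t.

Definition C1_arc (a b : R) (g : R -> C) : Prop :=
  (forall t, a <= t <= b ->
     derivable (fun s => Re (g s)) t 1 /\ derivable (fun s => Im (g s)) t 1) /\
  {within `[a, b], continuous (velocity g)}.

(* Each piece is C^1 up to its end points and, after a refinement of the
   partition, is contained in a single chart; [g] is there an extension of the
   piece beyond [a, b].  Consecutive pieces agree at the common end point, so
   that gamma is continuous on [0, 1]. *)
Definition piecewise_smooth (gamma : R -> S) : Prop :=
  exists2 s : seq R, itv_partition 0 1 s &
    forall i, (i < size s)%N ->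
      let a := nth 1 (0 :: s) i in
      let b := nth 1 s i in
      exists (c : chart) (g : R -> C),
        C1_arc a b g /\ forall t, a <= t <= b -> gamma t = from_chart c (g t).

Definition joining_curve (Omega : set S) (z w : S) (gamma : R -> S) : Prop :=
  [/\ piecewise_smooth gamma, gamma 0 = z, gamma 1 = w &
      forall t, 0 <= t <= 1 -> Omega (gamma t)].

(* The integrand is only meaningful off the finitely many break points. *)
Definition curve_length (lam : S -> R) (gamma : R -> S) : \bar R :=
  (\int[lebesgue_measure]_(t in `[0%R, 1%R])
     (lam (gamma t) * normc (velocity (local_expr gamma t) t : R[i]))%:E)%E.

(* With [lam] the hyperbolic metric of [Omega]: the hyperbolic distance. *)
Definition hyperbolic_dist (Omega : set S) (lam : S -> R) (z w : S) : \bar R :=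
  ereal_inf [set curve_length lam gamma | gamma in joining_curve Omega z w].

(* lam(z_n) / lamO(z_n) = 1 + o(exp(-4 d(z_n, q))).  Both metrics are evaluated
   in the same coordinate, so the quotient is coordinate-free. *)
Definition boundary_contact (Omega : set S) (lam lamO : S -> R) (z : nat -> S)
    (q : S) : Prop :=
  (fun n => lam (z n) / lamO (z n)) =
    (fun=> 1) +o_ \oo
      (fun n => fine (expeR (- 4%:E * hyperbolic_dist Omega lamO (z n) q)%E)).

End RiemannSphere.

(* Main.v *)
Require Import Defs.
From mathcomp Require Import all_boot all_order all_algebra.
From mathcomp Require Import all_classical all_reals all_analysis.
From mathcomp Require Import complex.
From mathcomp Require Import measurable_realfun.
From mathcomp Require Import ring lra.
Import Order.TTheory GRing.Theory Num.Theory.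
Import numFieldNormedType.Exports.
Local Open Scope classical_set_scope.
Local Open Scope ring_scope.

Set Implicit Arguments.
Unset Strict Implicit.
Unset Printing Implicit Defensive.

Local Open Scope complex_scope.

(** Let f be the covering of Omega by the unit disk, and l the pullback of the
    metric lambda under f.  At f(w) the quotient of lambda by the hyperbolic
    metric equals v(w) = l(w) (1 - |w|^2), so everything is about the function v
    on the disk.  Ahlfors' lemma says v <= 1.  The theorem rests on a sharpening
    at the boundary, in the spirit of Hopf's lemma ([hopf], [boundary_schwarz]):
    if v < 1 at a single point, then 1 - v(w) >= k (1 - |w|^2)^2 on the whole
    disk, for some k > 0.  On the other hand a curve from z_n to q of length L
    lifts to a curve which ends at a fixed point over q, so z_n has a preimage
    whose hyperbolic distance from 0 is at most L plus a constant
    ([curve_lift]); and exp(-4 d) = ((1 - |w|) / (1 + |w|))^2 <= (1 - |w|^2)^2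
    for a point w at distance d from 0.  Together, 1 - v(z_n) is at least a
    constant times exp(-4 d(z_n, q)), which contradicts the assumed contact.
    Hence v is 1 everywhere; and then the contact with any other base point
    holds because the quotient is constantly 1.

    Ahlfors' lemma and the boundary version come from a maximum principle.  If l
    had a positive local maximum after division by exp(phi), then the Laplacian
    of phi would be at least 4 l^2, because that of log l is
    ([local_max_bound]).  With phi = - log(t - |w|^2) this gives Ahlfors' lemma,
    with phi = - log(1 - |w|^2) - c psi(|w|^2) and psi(s) = 1/s - 2 + s the
    boundary version on an annulus, the exponent 2 in it being the order of the
    zero of psi at s = 1; the constant c is so small that the comparison holds
    on the inner circle.

    The Laplacian of log l is never computed, as this would need third
    derivatives of f.  Instead the curvature condition is used in the weak form
    of [conformal_subsolution]: whenever l is bounded above near z by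
    l(z) exp(Re(b h + c h^2) + d |h|^2), with equality at h = 0, then
    l(z)^2 <= d.  This form is inherited by pullbacks
    ([curvature_comparison], [pullback_curvature]).  Write l = (m o f) |f'| in a
    chart; by Taylor's formula log m is at least
    Re(B k + Q k^2) + (m^2 - e) |k|^2 up to its value at the centre, so a bound
    with d < l^2 would make |exp(polynomial) f'| strictly smaller on small
    circles than in their centre.

    So all that is needed from complex analysis is the maximum principle for a
    product H f' with H holomorphic ([max_principle_derivative]).  Bisection
    gives Goursat's lemma for a rectangle in the coordinates log |z|, arg z
    ([goursat]); the two sides arg z = 0 and arg z = 2 pi cancel, so circular
    means do not depend on the radius, which is the maximum principle for the
    centre of a circle ([central_max]).  Cauchy's estimate follows from it
    through difference quotients, and makes f' locally Lipschitz; finally f' is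
    replaced by a difference quotient of f with an error which is uniformly
    small. *)

(** * Bisection of rectangles *)
Section Cousin.
Context {R : realType}.
Implicit Types (P : R -> R -> R -> R -> Prop).

(** One of the four quarters of the rectangle, on which [P] fails if possible; the
    last one needs no test, since [P] fails on the rectangle itself. *)
Definition quarter P (x : R * R * R * R) : R * R * R * R :=
  let: (a, b, c, d) := x in
  let m := (a + b) / 2 in let n := (c + d) / 2 in
  if ~~ `[< P a m c n >] then (a, m, c, n)
  else if ~~ `[< P a m n d >] then (a, m, n, d)
  else if ~~ `[< P m b c n >] then (m, b, c, n)
  else (m, b, n, d).

(** The compactness of a rectangle as an induction principle: a property which
    passes from the quarters of a rectangle to the rectangle, and holds for all
    small rectangles around each point, holds for every rectangle.  Otherwise
    repeated quartering leads to a nested sequence of bad rectangles, which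
    shrinks to a point around which small rectangles are good. *)
Lemma rectangle_induction P (a b c d : R) : a <= b -> c <= d ->
  (forall a b c d, a <= b -> c <= d ->
     P a ((a + b) / 2) c ((c + d) / 2) -> P a ((a + b) / 2) ((c + d) / 2) d ->
     P ((a + b) / 2) b c ((c + d) / 2) -> P ((a + b) / 2) b ((c + d) / 2) d ->
     P a b c d) ->
  (forall x y, a <= x <= b -> c <= y <= d -> exists2 e, 0 < e &
     forall a' b' c' d', a <= a' -> a' <= x -> x <= b' -> b' <= b ->
       c <= c' -> c' <= y -> y <= d' -> d' <= d ->
       b' - a' < e -> d' - c' < e -> P a' b' c' d') ->
  P a b c d.
Proof.
move=> ab cd Psplit Ploc; apply: contrapT => nP.
pose s n := iter n (quarter P) (a, b, c, d).
pose A n := (s n).1.1.1; pose B n := (s n).1.1.2.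
pose C n := (s n).1.2; pose D n := (s n).2.
have inv n : [/\ ~ P (A n) (B n) (C n) (D n), a <= A n /\ B n <= b,
    c <= C n /\ D n <= d, A n <= B n /\ B n - A n = (b - a) / 2 ^+ n &
    C n <= D n /\ D n - C n = (d - c) / 2 ^+ n].
  elim: n => [|n [nPn [aA Bb] [cC Dd] [AB BA] [CD DC]]].
    by rewrite /A /B /C /D /= !expr0 !divr1.
  rewrite /A /B /C /D /s iterS -/(s n).
  move: nPn aA Bb cC Dd AB BA CD DC; rewrite /A /B /C /D.
  case: (s n) => [[[a' b'] c'] d'] /= nPn aA Bb cC Dd AB BA CD DC.
  have half1 (u v k : R) : v - u = k / 2 ^+ n -> (u + v) / 2 - u = k / 2 ^+ n.+1.
    rewrite exprS invfM [2^-1 * _]mulrC mulrA => <-; lra.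
  have half2 (u v k : R) : v - u = k / 2 ^+ n -> v - (u + v) / 2 = k / 2 ^+ n.+1.
    rewrite exprS invfM [2^-1 * _]mulrC mulrA => <-; lra.
  have [h1 h2] := (half1 _ _ _ BA, half2 _ _ _ BA).
  have [h3 h4] := (half1 _ _ _ DC, half2 _ _ _ DC).
  case: asboolP => /= p1; last first.
    by split=> //; split=> //; clear -aA Bb cC Dd AB CD h1 h2 h3 h4; lra.
  case: asboolP => /= p2; last first.
    by split=> //; split=> //; clear -aA Bb cC Dd AB CD h1 h2 h3 h4; lra.
  case: asboolP => /= p3; last first.
    by split=> //; split=> //; clear -aA Bb cC Dd AB CD h1 h2 h3 h4; lra.
  case: (pselect (P ((a' + b') / 2) b' ((c' + d') / 2) d')) => p4.
    by case: nPn; exact: Psplit AB CD p1 p2 p3 p4.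
  by split=> //; split=> //; clear -aA Bb cC Dd AB CD h1 h2 h3 h4; lra.
have mono n : [/\ A n <= A n.+1, B n.+1 <= B n, C n <= C n.+1 & D n.+1 <= D n].
  have [_ _ _ [+ _] [+ _]] := inv n; rewrite /A /B /C /D /s iterS -/(s n).
  case: (s n) => [[[a' b'] c'] d'] /= AB CD.
  by do 3?[case: asboolP => _ /=]; split; clear -AB CD; lra.
have nest (u v : nat -> R) : (forall n, u n <= u n.+1) ->
    (forall n, v n.+1 <= v n) -> (forall n, u n <= v n) ->
    exists x, forall n, u n <= x <= v n.
  move=> mu mv uv; have um := homo_leq (fun x => lexx x) le_trans mu.
  have vm : forall i j, (i <= j)%N -> v j <= v i.
    by apply: (@homo_leq _ v (fun x y => y <= x)) => // y x z h1 h2; apply: le_trans h2 h1.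
  have uvij i j : u i <= v j.
    case: (leqP i j) => ij; first exact: le_trans (um _ _ ij) (uv j).
    exact: le_trans (uv i) (vm _ _ (ltnW ij)).
  have hs : has_sup (range u).
    split; first by exists (u 0%N); exists 0%N.
    by exists (v 0%N) => _ [i _ <-].
  exists (sup (range u)) => n; apply/andP; split.
    by apply: ub_le_sup; [exact: hs.2 | exists n].
  by apply: ge_sup; [exact: hs.1 | move=> _ [i _ <-]].
have [x xP] : exists x, forall n, A n <= x <= B n.
  by apply: nest => n; [case: (mono n)|case: (mono n)|case: (inv n) => _ _ _ []].
have [y yP] : exists x, forall n, C n <= x <= D n.
  by apply: nest => n; [case: (mono n)|case: (mono n)|case: (inv n) => _ _ _ _ []].
have [e e0 eP] := Ploc x y (xP 0%N) (yP 0%N).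
have [k kP] : exists k, (b - a) / 2 ^+ k < e /\ (d - c) / 2 ^+ k < e.
  pose M := (b - a) + (d - c).
  have : ((fun k => M * (2^-1) ^+ k) @ \oo --> M * 0).
    apply: cvgMl_tmp; apply: cvg_expr.
    by rewrite ger0_norm ?invr_ge0// invf_lt1 ?ltr1n.
  rewrite mulr0 => /cvgrPdist_lt /(_ _ e0) [k _ /(_ k (leqnn k))] /=.
  rewrite sub0r normrN exprVn => h; exists k.
  have := le_lt_trans (ler_norm _) h; rewrite /M mulrDl => h'.
  have t1 : 0 <= (b - a) / 2 ^+ k by rewrite mulr_ge0// subr_ge0.
  have t2 : 0 <= (d - c) / 2 ^+ k by rewrite mulr_ge0// subr_ge0.
  split; lra.
have [nPk [aA Bb] [cC Dd] [_ BA] [_ DC]] := inv k.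
have /andP[Ax xB] := xP k; have /andP[Cy yD] := yP k.
by apply: nPk; apply: eP => //; rewrite ?BA ?DC; [exact: kP.1|exact: kP.2].
Qed.
End Cousin.

(** * Goursat's lemma *)
Section Goursat.
Context {R : realType}.

Definition total_derivative (U : R -> R -> R) (s t a b : R) : Prop :=
  forall e, 0 < e -> exists2 d, 0 < d & forall h k, `|h| < d -> `|k| < d ->
    `|U (s + h) (t + k) - U s t - a * h - b * k| <= e * (`|h| + `|k|).

Lemma MVT_increment (F f : R -> R) (a b : R) : a <= b ->
  (forall x, a <= x <= b -> is_derive x 1 F (f x)) ->
  exists2 c, a <= c <= b & F b - F a = f c * (b - a).
Proof.
move=> ab dF.
have [| |c] := @MVT_segment _ F f a b ab.
- by move=> x /[!in_itv]/= /andP[ax xb]; apply: dF; rewrite !ltW.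
- apply: derivable_within_continuous => x /[!in_itv]/= xab.
  exact: (@ex_derive _ _ _ _ _ _ _ (dF x xab)).
- by rewrite in_itv/= => cab ->; exists c.
Qed.

Lemma dist_itv (u w z x : R) : u <= z <= w -> u <= x <= w -> `|z - x| <= w - u.
Proof.
move=> /andP[? ?] /andP[? ?]; rewrite ler_norml; apply/andP; split; lra.
Qed.

(** The imaginary part of the integral of (U + i V) (ds + i dt) along the boundary
    of a rectangle vanishes if the derivative of U in s equals that of V in t; it is
    written through antiderivatives PU of U in t and PV of V in s.  The defect J is
    additive under quartering.  On a small rectangle with sides S and T around a
    point where the common derivative is p, the linear approximations contribute
    (p S) T from U and (p T) S from V, which cancel, so that J is
    o((S + T)^2). *)
Lemma goursat (U V PU PV : R -> R -> R) (a b c d : R) :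
  a <= b -> c <= d ->
  (forall s t, a <= s <= b -> c <= t <= d -> exists p q r : R,
      total_derivative U s t p q /\ total_derivative V s t r p) ->
  (forall s t, a <= s <= b -> c <= t <= d -> is_derive t 1 (PU s) (U s t)) ->
  (forall s t, a <= s <= b -> c <= t <= d -> is_derive s 1 (PV t) (V s t)) ->
  (PU b d - PU b c) - (PU a d - PU a c) =
  (PV d b - PV d a) - (PV c b - PV c a).
Proof.
move=> ab cd dUV dPU dPV.
pose J a b c d := (PU b d - PU b c) - (PU a d - PU a c)
  - ((PV d b - PV d a) - (PV c b - PV c a)).
suff JE e : 0 < e -> `|J a b c d| <= e * ((b - a) + (d - c)) ^+ 2.
  have : `|J a b c d| <= 0.
    apply/ler_addgt0Pl => e e0; rewrite addr0.
    pose L := ((b - a) + (d - c)) ^+ 2.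
    have L0 : 0 <= L by rewrite sqr_ge0.
    have := JE (e / (L + 1)).
    have L1 : 0 < L + 1 by lra.
    rewrite divr_gt0// => /(_ isT) /le_trans; apply.
    rewrite -/L -mulrA ler_piMr ?(ltW e0)// mulrC ler_pdivrMr//; lra.
  by rewrite normr_le0 subr_eq0 => /eqP.
move=> e0.
apply: (@rectangle_induction R (fun a b c d =>
  `|J a b c d| <= e * (b - a + (d - c)) ^+ 2)) => //; last first.
- move=> x y xab ycd.
  have [p [q [r [dU dV]]]] := dUV x y xab ycd.
  have e4 : 0 < e / 4 by lra.
  have [d1 d10 h1] := dU _ e4; have [d2 d20 h2] := dV _ e4.
  exists (Num.min d1 d2); first by rewrite lt_min d10.
  move=> a' b' c' d' aa ax xb bb cc cy yd dd; rewrite !lt_min.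
  move=> /andP[ba1 ba2] /andP[dc1 dc2].
  have ab' := le_trans ax xb; have cd' := le_trans cy yd.
  (* The mean value theorem turns the differences of antiderivatives into values
     of U and V, so that J becomes a combination of increments of U and V. *)
  have [tau /andP[t1 t2] Et] : exists2 t, c' <= t <= d' & (PU b' d' - PU a' d') - (PU b' c' - PU a' c')
      = (U b' t - U a' t) * (d' - c').
    apply: (@MVT_increment (fun t => PU b' t - PU a' t) (fun t => U b' t - U a' t)) => // t /andP[ct td].
    by apply: is_deriveB; apply: dPU; clear -ab' cd' aa bb cc dd ct td; lra.
  have [sg /andP[s1 s2] Es] : exists2 s, a' <= s <= b' & (PV d' b' - PV c' b') - (PV d' a' - PV c' a')
      = (V s d' - V s c') * (b' - a').
    apply: (@MVT_increment (fun t => PV d' t - PV c' t) (fun t => V t d' - V t c')) => // t /andP[ct td].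
    by apply: is_deriveB; apply: dPV; clear -ab' cd' aa bb cc dd ct td; lra.
  have -> : J a' b' c' d' = (U b' tau - U a' tau) * (d' - c') - (V sg d' - V sg c') * (b' - a').
    by rewrite -Et -Es /J; ring.
  set S := b' - a'; set T := d' - c'.
  have S0 : 0 <= S by rewrite /S subr_ge0.
  have T0 : 0 <= T by rewrite /T subr_ge0.
  have est W d0 g1 g2 u v : (forall h k : R, `|h| < d0 -> `|k| < d0 ->
     `|W (x + h) (y + k) - W x y - g1 * h - g2 * k| <= e / 4 * (`|h| + `|k|)) ->
      S < d0 -> T < d0 ->
      a' <= u <= b' -> c' <= v <= d' ->
      `|W u v - W x y - g1 * (u - x) - g2 * (v - y)| <= e / 4 * (S + T).
    move=> H SD TD ua vc.
    have nu : `|u - x| <= S by apply: dist_itv; rewrite ?ax.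
    have nv : `|v - y| <= T by apply: dist_itv; rewrite ?cy.
    have := H (u - x) (v - y) (le_lt_trans nu SD) (le_lt_trans nv TD).
    rewrite !subrKC => /le_trans; apply.
    by rewrite ler_wpM2l ?(ltW e4)// lerD.
  have ib : a' <= b' <= b' by rewrite ab' /=.
  have ia : a' <= a' <= b' by rewrite ab' lexx.
  have id : c' <= d' <= d' by rewrite cd' /=.
  have ic : c' <= c' <= d' by rewrite cd' lexx.
  have is_ : a' <= sg <= b' by rewrite s1.
  have it : c' <= tau <= d' by rewrite t1.
  move: (est _ _ _ _ b' tau h1 ba1 dc1 ib it) (est _ _ _ _ a' tau h1 ba1 dc1 ia it).
  move: (est _ _ _ _ sg d' h2 ba2 dc2 is_ id) (est _ _ _ _ sg c' h2 ba2 dc2 is_ ic).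
  set e1 := (V sg c' - _ - _ - _); set e2 := (V sg d' - _ - _ - _).
  set e3 := (U a' tau - _ - _ - _); set e4' := (U b' tau - _ - _ - _).
  move=> A4 A3 A2 A1.
  have -> : (U b' tau - U a' tau) * T - (V sg d' - V sg c') * S =
     (e4' - e3) * T - (e2 - e1) * S.
    rewrite /e1 /e2 /e3 /e4' /S /T; clear; ring.
  have B1 : `|e4' - e3| <= e / 2 * (S + T) by rewrite (le_trans (ler_normB _ _))//; clear -A1 A2 A3 A4; lra.
  have B2 : `|e2 - e1| <= e / 2 * (S + T) by rewrite (le_trans (ler_normB _ _))//; clear -A1 A2 A3 A4; lra.
  have C1 := ler_wpM2r T0 B1. have C2 := ler_wpM2r S0 B2.
  rewrite (le_trans (ler_normB _ _))// !normrM (ger0_norm S0) (ger0_norm T0).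
  have : 0 <= e * (S + T) ^+ 2 by rewrite mulr_ge0 ?sqr_ge0// ltW.
  clear -C1 C2; lra.
move=> a' b' c' d' ab' cd'.
set m := (a' + b') / 2; set n := (c' + d') / 2.
have -> : m - a' = (b' - a') / 2 by rewrite /m; lra.
have -> : n - c' = (d' - c') / 2 by rewrite /n; lra.
have -> : b' - m = (b' - a') / 2 by rewrite /m; lra.
have -> : d' - n = (d' - c') / 2 by rewrite /n; lra.
have -> : J a' b' c' d' = J a' m c' n + J a' m n d' + J m b' c' n + J m b' n d'.
  by rewrite /J; ring.
move=> J1 J2 J3 J4.
set Q := _ ^+ 2 in J1 J2 J3 J4.
have -> : (b' - a' + (d' - c')) ^+ 2 = 4 * Q by rewrite /Q; field.
move: (ler_normD (J a' m c' n) (J a' m n d')) (ler_normD (J a' m c' n + J a' m n d') (J m b' c' n)) (ler_normD (J a' m c' n + J a' m n d' + J m b' c' n) (J m b' n d')).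
clear -J1 J2 J3 J4; lra.
Qed.
End Goursat.

Local Notation N := ComplexField.Normc.normc.

(** * Modulus and derivatives of complex functions *)
Section Modulus.
Context {R : realType}.
Local Notation C := (R[i]).
Local Notation Re := (@complex.Re R).
Local Notation Im := (@complex.Im R).
Implicit Types (x y z w h : C).

Lemma N_ge0 z : 0 <= N z.
Proof. by case: z => a b; exact: sqrtr_ge0. Qed.

Lemma N0 : N (0 : C) = 0. Proof. exact: ComplexField.Normc.normc0. Qed.
Lemma N1 : N (1 : C) = 1. Proof. exact: ComplexField.Normc.normc1. Qed.

Lemma N_eq0 z : (N z == 0) = (z == 0).
Proof.
apply/eqP/eqP => [|->]; last exact: N0.
exact: ComplexField.Normc.eq0_normc.
Qed.

Lemma N_gt0 z : (0 < N z) = (z != 0).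
Proof. by rewrite lt_neqAle N_ge0 eq_sym N_eq0 andbT. Qed.

Lemma NM z w : N (z * w) = N z * N w.
Proof. exact: ComplexField.Normc.normcM. Qed.

Lemma NV z : N z^-1 = (N z)^-1.
Proof. exact: ComplexField.Normc.normcV. Qed.

Lemma NX z n : N (z ^+ n) = N z ^+ n.
Proof. by elim: n => [|n IH]; rewrite ?expr0 ?N1// !exprS NM IH. Qed.

Lemma NN z : N (- z) = N z. Proof. exact: normcN. Qed.

Lemma ND z w : N (z + w) <= N z + N w. Proof. exact: le_normcD. Qed.

Lemma NB z w : N (z - w) <= N z + N w.
Proof. by rewrite -(NN w) ND. Qed.

Lemma NBC z w : N (z - w) = N (w - z).
Proof. by rewrite -NN opprB. Qed.

Lemma NB_ge z w : N z - N w <= N (z - w).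
Proof. by rewrite lerBlDr -{1}(subrK w z) ND. Qed.

Lemma N_dist z w : `|N z - N w| <= N (z - w).
Proof.
rewrite ler_norml NB_ge andbT; have := NB_ge w z; rewrite NBC; lra.
Qed.

Lemma NReal (a : R) : N (a%:C) = `|a|.
Proof. by rewrite /= expr0n /= addr0 sqrtr_sqr. Qed.

Lemma N_sqr z : N z ^+ 2 = Re z ^+ 2 + Im z ^+ 2.
Proof. by case: z => a b /=; rewrite sqr_sqrtr// addr_ge0 ?sqr_ge0. Qed.

Lemma Re_le_N z : `|Re z| <= N z.
Proof.
rewrite -(@ler_pXn2r R 2) ?nnegrE ?N_ge0// N_sqr real_normK ?num_real//.
by rewrite lerDl sqr_ge0.
Qed.

Lemma Im_le_N z : `|Im z| <= N z.
Proof.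
rewrite -(@ler_pXn2r R 2) ?nnegrE ?N_ge0// N_sqr real_normK ?num_real//.
by rewrite lerDr sqr_ge0.
Qed.

Lemma N_le_ReIm z : N z <= `|Re z| + `|Im z|.
Proof.
rewrite -(@ler_pXn2r R 2) ?nnegrE ?N_ge0 ?addr_ge0// N_sqr.
rewrite -(real_normK (num_real (Re z))) -(real_normK (num_real (Im z))).
have := mulr_ge0 (normr_ge0 (Re z)) (normr_ge0 (Im z)); nra.
Qed.

Lemma ReCD z w : Re (z + w) = Re z + Re w. Proof. by case: z w => [a b] [c d]. Qed.
Lemma ImCD z w : Im (z + w) = Im z + Im w. Proof. by case: z w => [a b] [c d]. Qed.
Lemma ReCN z : Re (- z) = - Re z. Proof. by case: z. Qed.
Lemma ImCN z : Im (- z) = - Im z. Proof. by case: z. Qed.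
Lemma ReCB z w : Re (z - w) = Re z - Re w. Proof. by rewrite ReCD ReCN. Qed.
Lemma ImCB z w : Im (z - w) = Im z - Im w. Proof. by rewrite ImCD ImCN. Qed.
Lemma ReCM z w : Re (z * w) = Re z * Re w - Im z * Im w.
Proof. by case: z w => [a b] [c d]. Qed.
Lemma ImCM z w : Im (z * w) = Re z * Im w + Im z * Re w.
Proof. by case: z w => [a b] [c d]. Qed.

Lemma complex_ext z w : Re z = Re w -> Im z = Im w -> z = w.
Proof. by case: z w => [a b] [c d] /= -> ->. Qed.

(** Multiplication by a phase reduces estimates of moduli to real parts. *)
Lemma exists_phase z : exists2 u : C, N u = 1 & u * z = (N z)%:C.
Proof.
have [->|z0] := eqVneq z 0; first by exists 1; rewrite ?N1// N0 mulr0.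
exists ((N z)%:C / z); last by rewrite mulfVK.
by rewrite NM NV NReal ger0_norm ?N_ge0// divff ?N_eq0.
Qed.

Lemma nbhs_N (z : Cplx R) (P : set (Cplx R)) :
  nbhs z P <-> exists2 e : R, 0 < e & forall w, N (w - z) < e -> P w.
Proof.
split.
  move=> /nbhs_normP [e /= e0 eP].
  have eR : e = (Re e)%:C.
    by move: e0; rewrite ltcE /= => /andP[/eqP ie _]; case: e ie {eP} => a b /= ->.
  exists (Re e); first by move: e0; rewrite {1}eR ltcR.
  move=> w zw; apply: eP; rewrite /= eR.
  by rewrite -normrN opprB -/(N (w - z)) ; rewrite ltcR.
move=> [e e0 eP]; apply/(@nbhs_normP _ (Cplx R)); exists e%:C; first by rewrite /= ltcR.
move=> w /=; rewrite -normrN opprB ltcR; exact: eP.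
Qed.

Lemma continuous_N (T : topologicalType) (f : T -> Cplx R) (x : T) :
  {for x, continuous f} <-> forall e : R, 0 < e -> \forall y \near x, N (f y - f x) < e.
Proof.
split=> [cf e e0|H].
  have : nbhs (f x) [set w | N (w - f x) < e] by apply/nbhs_N; exists e.
  by move=> /cf.
move=> P /nbhs_N [e e0 eP]; have := H e e0; apply: filterS => y; exact: eP.
Qed.

Lemma continuousC_R (f : Cplx R -> R) (z : Cplx R) :
  {for z, continuous f} <-> forall e : R, 0 < e -> exists2 d : R, 0 < d &
     forall w, N (w - z) < d -> `|f w - f z| < e.
Proof.
split=> [cf e e0|H].
  have : nbhs (f z) [set w | `|w - f z| < e].
    by apply/nbhs_ballP; exists e => // w /=; rewrite /ball/= distrC.
  by move=> /cf /nbhs_N.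
move=> P /nbhs_ballP [e e0 eP]; have [d d0 dP] := H e e0.
by apply/nbhs_N; exists d => // w /dP ?; apply: eP; rewrite /ball/= distrC.
Qed.

End Modulus.

Section ComplexDerivative.
Context {R : realType}.
Local Notation C := (R[i]).
Local Notation Re := (@complex.Re R).
Local Notation Im := (@complex.Im R).
Implicit Types (f g : C -> C) (z w h a b : C).

(** The derivative with its remainder estimate in terms of the real valued
    modulus, which is what all estimates below use. *)
Definition cderiv f z a : Prop :=
  forall e : R, 0 < e -> exists2 d : R, 0 < d & forall h, N h < d ->
    N (f (z + h) - f z - a * h) <= e * N h.

Lemma cderiv_is_derive f z a : cderiv f z a <-> is_derive (z : Cplx R) 1 (f : Cplx R -> Cplx R) a.
Proof.
pose K : numFieldType := R[i].
have alg (h : C) : h != 0 -> N (a - h^-1 * (f (h * 1 + z) - f z)) = N (f (z + h) - f z - a * h) / N h.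
  move=> h0; rewrite -NV -NM NBC mulr1 [h + z]addrC; congr N; field.
  by rewrite h0.
split.
  move=> D; suff H : (fun h : K => h^-1 *: (((f : Cplx R -> Cplx R) \o shift (z : Cplx R)) (h *: (1 : Cplx R)) - f z)) @ 0^' --> (a : Cplx R).
    apply: DeriveDef; first by apply/cvg_ex; exists a.
    exact: (cvg_lim (@norm_hausdorff _ _) H).
  apply/cvgrPdist_lt => e e0.
  have eR : e = (Re e)%:C.
    by move: e0; rewrite ltcE /= => /andP[/eqP ie _]; case: e ie => u v /= ->.
  have e0' : 0 < Re e by move: e0; rewrite {1}eR ltcR.
  have [d d0 dP] := D (Re e / 2) (divr_gt0 e0' (ltr0Sn _ 1)).
  rewrite /dnbhs /within /=.
  have : nbhs (0 : Cplx R) [set w | N (w - 0) < d] by apply/nbhs_N; exists d.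
  apply: filterS => h /= hd h0; rewrite subr0 in hd.
  rewrite eR ltcR -[X in _ - X]/(h^-1 * (f (h * 1 + z) - f z)).
  rewrite (alg h h0) ltr_pdivrMr ?N_gt0//.
  apply: le_lt_trans (dP _ hd) _; rewrite ltr_pM2r ?N_gt0//.
  by rewrite ltr_pdivrMr// ltr_pMr// ltr1n.
move=> [ex <-] e e0; set l := ('D_(1 : Cplx R) (f : Cplx R -> Cplx R) z).
have : (fun h : K => h^-1 *: (((f : Cplx R -> Cplx R) \o shift (z : Cplx R)) (h *: (1 : Cplx R)) - f z)) @ 0^' --> (l : Cplx R) by exact: ex.
move=> /cvgrPdist_lt /(_ e%:C); rewrite ltcR => /(_ e0).
rewrite /dnbhs /within /= => /(@nbhs_N R 0) [d d0 dP]; exists d => // h hd.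
have [->|h0] := eqVneq h 0; first by rewrite N0 !mulr0 addr0 !subrr N0.
have /= := dP h; rewrite subr0 => /(_ hd h0); rewrite ltcR.
rewrite -[X in _ - X]/(h^-1 * (f (h * 1 + z) - f z)).
rewrite (_ : N _ = N (f (z + h) - f z - l * h) / N h); last first.
  rewrite -NV -NM NBC mulr1 [h + z]addrC; congr N; field; exact: h0.
by rewrite ltr_pdivrMr ?N_gt0// => /ltW.
Qed.

End ComplexDerivative.

Section RealDerivative.
Context {R : realType}.

Lemma is_derive_eps (f : R -> R) (x a : R) :
  is_derive x 1 f a <-> forall e, 0 < e -> exists2 d, 0 < d & forall h, `|h| < d ->
    `|f (x + h) - f x - a * h| <= e * `|h|.
Proof.
have alg b (h : R) : h != 0 -> `|b - h^-1 * (f (h * 1 + x) - f x)| = `|f (x + h) - f x - b * h| / `|h|.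
  move=> h0; rewrite -normfV -normrM distrC mulr1 [h + x]addrC; congr `|_|; field.
  by rewrite h0.
split.
  move=> [ex <-] e e0; set l := ('D_1 f x).
  have : (fun h : R => h^-1 *: ((f \o shift x) (h *: (1 : R)) - f x)) @ 0^' --> l by exact: ex.
  move=> /cvgrPdist_lt /(_ e e0).
  rewrite /dnbhs /within /= => /nbhs_ballP [d d0 dP]; exists d => // h hd.
  have [->|h0] := eqVneq h 0; first by rewrite normr0 !mulr0 addr0 !subrr normr0.
  have /= := dP h; rewrite /ball/= sub0r normrN => /(_ hd h0).
  rewrite -[X in _ - X]/(h^-1 * (f (h * 1 + x) - f x)) alg//.
  by rewrite ltr_pdivrMr ?normr_gt0// => /ltW.
move=> D; suff H : (fun h : R => h^-1 *: ((f \o shift x) (h *: (1 : R)) - f x)) @ 0^' --> a.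
  apply: DeriveDef; first by apply/cvg_ex; exists a.
  exact: (cvg_lim (@Rhausdorff _) H).
apply/cvgrPdist_lt => e e0.
have [d d0 dP] := D (e / 2) (divr_gt0 e0 (ltr0Sn _ 1)).
rewrite /dnbhs /within /=; apply/nbhs_ballP; exists d => //= h; rewrite /ball/= sub0r normrN => hd h0.
rewrite -[X in _ - X]/(h^-1 * (f (h * 1 + x) - f x)) alg//.
rewrite ltr_pdivrMr ?normr_gt0//; apply: le_lt_trans (dP _ hd) _.
by rewrite ltr_pM2r ?normr_gt0// ltr_pdivrMr// ltr_pMr// ltr1n.
Qed.

Lemma continuousR_eps (f : R -> R) (x : R) :
  {for x, continuous f} <-> forall e : R, 0 < e -> exists2 d : R, 0 < d &
     forall y, `|y - x| < d -> `|f y - f x| < e.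
Proof.
split=> [cf e e0|H].
  have : nbhs (f x) [set w | `|w - f x| < e].
    by apply/nbhs_ballP; exists e => // w /=; rewrite /ball/= distrC.
  move=> /cf /nbhs_ballP [d d0 dP]; exists d => // y yd; apply: dP.
  by rewrite /ball/= distrC.
move=> P /nbhs_ballP [e e0 eP]; have [d d0 dP] := H e e0.
apply/nbhs_ballP; exists d => // w; rewrite /ball/= distrC => /dP ?; apply: eP; rewrite /ball/= distrC//.
Qed.

(** The fundamental theorem of calculus at interior points of an interval on which
    the integrand is continuous. *)
Lemma parameterized_integral_is_derive (f : R -> R) (a b x : R) :
  (forall y, a <= y <= b -> {for y, continuous f}) -> a < x < b ->
  is_derive x 1 (fun x => parameterized_integral lebesgue_measure a x f) (f x).
Proof.
move=> cf /andP[ax xb].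
have fi : (@lebesgue_measure R).-integrable `[a, b] (EFin \o f).
  apply: continuous_compact_integrable; first exact: segment_compact.
  apply: continuous_in_subspaceT => y; rewrite inE/= in_itv/= => yab.
  exact: cf.
have cx : {for x, continuous f} by apply: cf; rewrite !ltW.
have [h1 h2] := continuous_FTC1_closed xb fi ax cx.
by apply: DeriveDef; [exact: h1|rewrite -derive1E; exact: h2].
Qed.

End RealDerivative.

Section ComplexCalculus.
Context {R : realType}.
Local Notation C := (R[i]).
Local Notation Re := (@complex.Re R).
Local Notation Im := (@complex.Im R).
Implicit Types (f g : C -> C) (z w h a b : C).

Lemma cderiv_ext f g z a :
  (exists2 d : R, 0 < d & forall h, N h < d -> f (z + h) = g (z + h)) ->
  cderiv f z a -> cderiv g z a.
Proof.
move=> [d d0 dP] D e e0; have [d' d'0 d'P] := D e e0.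
exists (Num.min d d'); first by rewrite lt_min d0.
move=> h; rewrite lt_min => /andP[hd hd'].
have f0 : f z = g z by have := dP 0; rewrite N0 addr0; apply.
by rewrite -dP// -f0 d'P.
Qed.

Lemma cderiv_near f z a : cderiv f z a -> exists2 d : R, 0 < d &
  forall h, N h < d -> N (f (z + h) - f z) <= (N a + 1) * N h.
Proof.
move=> D; have [d d0 dP] := D 1 ltr01; exists d => // h hd.
rewrite -[f (z + h) - f z](subrK (a * h)) (le_trans (ND _ _))// NM.
by have := dP h hd; rewrite mul1r mulrDl mul1r; lra.
Qed.

Lemma cderiv_continuous f z a : cderiv f z a ->
  forall e : R, 0 < e -> exists2 d : R, 0 < d & forall h, N h < d -> N (f (z + h) - f z) < e.
Proof.
move=> /cderiv_near [d d0 dP] e e0.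
have a0 : 0 < N a + 1 by have := N_ge0 a; lra.
exists (Num.min d (e / (N a + 1))); first by rewrite lt_min d0 divr_gt0.
move=> h; rewrite lt_min => /andP[hd]; rewrite ltr_pdivlMr// => he.
by apply: le_lt_trans (dP _ hd) _; rewrite mulrC.
Qed.

Lemma cderiv_cst c z : cderiv (fun=> c) z 0.
Proof. by apply/cderiv_is_derive; exact: is_derive_cst. Qed.

Lemma cderiv_id z : cderiv (fun w => w) z 1.
Proof. by apply/cderiv_is_derive; exact: (@is_derive_id _ (Cplx R)). Qed.

Lemma cderivD f g z a b : cderiv f z a -> cderiv g z b ->
  cderiv (fun w => f w + g w) z (a + b).
Proof.
move=> /cderiv_is_derive F /cderiv_is_derive G; apply: (cderiv_is_derive _ _ _).2.
Qed.

Lemma cderivB f g z a b : cderiv f z a -> cderiv g z b ->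
  cderiv (fun w => f w - g w) z (a - b).
Proof.
move=> /cderiv_is_derive F /cderiv_is_derive G; apply: (cderiv_is_derive _ _ _).2.
Qed.

Lemma cderivM f g z a b : cderiv f z a -> cderiv g z b ->
  cderiv (fun w => f w * g w) z (a * g z + f z * b).
Proof.
move=> F G e e0.
pose K := N (g z) + N (f z) + (N a + 1).
have K0 : 0 < K by rewrite /K; have := N_ge0 a; have := N_ge0 (f z); have := N_ge0 (g z); lra.
have e1 : 0 < e / K by rewrite divr_gt0.
have [d1 d10 P1] := cderiv_near F.
have [d2 d20 P2] := F _ e1; have [d3 d30 P3] := G _ e1.
have [d4 d40 P4] := cderiv_continuous G e1.
exists (Num.min (Num.min d1 d2) (Num.min d3 d4)); first by rewrite !lt_min d10 d20 d30.
move=> h; rewrite !lt_min => /andP[/andP[/P1 h1 /P2 h2] /andP[/P3 h3 /P4 h4]].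
have -> : f (z + h) * g (z + h) - f z * g z - (a * g z + f z * b) * h =
  (f (z + h) - f z - a * h) * g z + f z * (g (z + h) - g z - b * h)
   + (f (z + h) - f z) * (g (z + h) - g z) by ring.
apply: le_trans (ND _ _) _; apply: le_trans (lerD (ND _ _) (lexx _)) _; rewrite !NM.
have -> : e * N h = e / K * N h * K by rewrite mulrAC divfK ?gt_eqF.
have -> : e / K * N h * K = e / K * N h * N (g z) + e / K * N h * N (f z)
  + e / K * N h * (N a + 1) by rewrite -!mulrDr.
apply: lerD; first apply: lerD.
- by rewrite ler_wpM2r ?N_ge0.
- by rewrite mulrC ler_wpM2r ?N_ge0.
- have -> : e / K * N h * (N a + 1) = (N a + 1) * N h * (e / K) by ring.
  by apply: ler_pM; rewrite ?N_ge0// ltW.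
Qed.

Lemma cderiv_comp f g z a b : cderiv g z b -> cderiv f (g z) a ->
  cderiv (fun w => f (g w)) z (a * b).
Proof.
move=> G F e e0.
have [d1 d10 P1] := cderiv_near G.
pose K := N b + 1; have K0 : 0 < K by rewrite /K; have := N_ge0 b; lra.
have [d2 d20 P2] := F (e / 2 / K) (divr_gt0 (divr_gt0 e0 (ltr0Sn _ 1)) K0).
have A0 : 0 < N a + 1 by have := N_ge0 a; lra.
have [d3 d30 P3] := G (e / 2 / (N a + 1)) (divr_gt0 (divr_gt0 e0 (ltr0Sn _ 1)) A0).
exists (Num.min (Num.min d1 d3) (d2 / K)); first by rewrite !lt_min d10 d30 divr_gt0.
move=> h; rewrite !lt_min ltr_pdivlMr// => /andP[/andP[h1 h3] h2].
have B1 := P1 h h1.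
have k2 : N (g (z + h) - g z) < d2 by apply: le_lt_trans B1 _; rewrite mulrC.
have := P2 _ k2; rewrite subrKC => B2.
have -> : f (g (z + h)) - f (g z) - a * b * h =
  (f (g (z + h)) - f (g z) - a * (g (z + h) - g z)) + a * (g (z + h) - g z - b * h) by ring.
apply: le_trans (ND _ _) _; rewrite NM.
have B3 := P3 h h3.
have C2 : e / 2 / K * N (g (z + h) - g z) <= e / 2 * N h.
  by rewrite -mulrA ler_wpM2l ?divr_ge0 ?(ltW e0)// mulrC ler_pdivrMr// mulrC.
have C3 : N a * N (g (z + h) - g z - b * h) <= e / 2 * N h.
  apply: le_trans (ler_wpM2l (N_ge0 a) B3) _.
  rewrite mulrA ler_wpM2r ?N_ge0// mulrA ler_pdivrMr// mulrC ler_wpM2l ?divr_ge0 ?(ltW e0)//.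
  by rewrite lerDl.
rewrite [e]splitr mulrDl; exact: lerD (le_trans B2 C2) C3.
Qed.

Lemma cderivV z : z != 0 -> cderiv (fun w => w^-1) z (- z^-1 ^+ 2).
Proof.
move=> z0 e e0; have Nz : 0 < N z by rewrite N_gt0.
have N3 : 0 < N z ^+ 3 / 2 by rewrite divr_gt0// exprn_gt0.
exists (Num.min (N z / 2) (e * (N z ^+ 3 / 2))); first by rewrite lt_min divr_gt0// mulr_gt0.
move=> h; rewrite lt_min => /andP[h1 h2].
have Nzh : N z / 2 <= N (z + h) by have := NB_ge z (- h); rewrite NN opprK; lra.
have zh : z + h != 0 by rewrite -N_gt0; lra.
have -> : (z + h)^-1 - z^-1 - - z^-1 ^+ 2 * h = h / (z ^+ 2 * (z + h)) * h.
  by field; rewrite z0 zh.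
rewrite NM ler_wpM2r ?N_ge0// NM NV NM NX ler_pdivrMr; last first.
  by rewrite mulr_gt0 ?exprn_gt0// N_gt0.
apply: le_trans (ltW h2) _; rewrite ler_wpM2l ?(ltW e0)// exprSr -mulrA ler_wpM2l ?sqr_ge0//.
Qed.

Definition cexp z : C := (expR (Re z))%:C * (cos (Im z) +i* sin (Im z)).

Lemma Re_cexp z : Re (cexp z) = expR (Re z) * cos (Im z).
Proof. by rewrite /cexp /= mul0r subr0. Qed.

Lemma Im_cexp z : Im (cexp z) = expR (Re z) * sin (Im z).
Proof. by rewrite /cexp /= mul0r addr0. Qed.

Lemma cexpD z w : cexp (z + w) = cexp z * cexp w.
Proof.
apply: complex_ext.
  by rewrite Re_cexp ReCM !Re_cexp !Im_cexp ReCD ImCD expRD cosD; ring.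
by rewrite Im_cexp ImCM !Re_cexp !Im_cexp ReCD ImCD expRD sinD; ring.
Qed.

Lemma N_cexp z : N (cexp z) = expR (Re z).
Proof.
rewrite NM NReal ger0_norm ?expR_ge0//= cos2Dsin2 sqrtr1 mulr1//.
Qed.

Lemma cexp0 : cexp 0 = 1.
Proof. by rewrite /cexp /= expR0 cos0 sin0 mul1r. Qed.

(** By the functional equation it suffices to differentiate at 0, where the
    derivatives of the real exponential, cosine and sine are combined. *)
Lemma cderiv_cexp z : cderiv cexp z (cexp z).
Proof.
suff H : cderiv cexp 0 1.
  move=> e e0; have E0 : 0 < N (cexp z) by rewrite N_cexp expR_gt0.
  have [d d0 dP] := H (e / N (cexp z)) (divr_gt0 e0 E0); exists d => // h hd.
  have -> : cexp (z + h) - cexp z - cexp z * h = cexp z * (cexp (0 + h) - cexp 0 - 1 * h).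
    by rewrite cexpD add0r cexp0; ring.
  rewrite NM; apply: le_trans (ler_wpM2l (ltW E0) (dP _ hd)) _.
  by rewrite mulrA [_ / _]mulrC mulVKf ?gt_eqF.
move=> e e0.
have [d1 d10 P1] := (@is_derive_eps R expR 0 (expR 0)).1 (is_derive_expR 0) (e / 8) ltac:(lra).
have [d2 d20 P2] := (@is_derive_eps R cos 0 _).1 (is_derive_cos 0) (Num.min (e / 8) 1) ltac:(rewrite lt_min; lra).
have [d3 d30 P3] := (@is_derive_eps R sin 0 _).1 (is_derive_sin 0) (e / 8) ltac:(lra).
have [d4 d40 P4] := (@continuousR_eps R expR 0).1 (@continuous_expR _ 0) (Num.min 1 (e / 8)) ltac:(rewrite lt_min; lra).
exists (Num.min (Num.min d1 d2) (Num.min d3 d4)).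
  by rewrite !lt_min d10 d20 d30.
move=> h; rewrite !lt_min => /andP[/andP[h1 h2] /andP[h3 h4]].
have hR := Re_le_N h; have hI := Im_le_N h.
have {P1} := P1 (Re h) (le_lt_trans hR h1).
have {P2} := P2 (Im h) (le_lt_trans hI h2).
have {P3} := P3 (Im h) (le_lt_trans hI h3).
have {P4} := P4 (Re h); rewrite subr0 => /(_ (le_lt_trans hR h4)).
rewrite !add0r expR0 cos0 sin0 oppr0 mul0r !subr0 ?addr0 !mul1r !lt_min.
set es := expR _; set ct := cos _; set st := sin _.
move=> /andP[Q4 Q4'] Q3 Q2 Q1.
have {Q2} Q2 : `|ct - 1| <= e / 8 * `|Im h|.
  by apply: le_trans Q2 _; rewrite ler_wpM2r// ge_min lexx.
have es2 : `|es| <= 2 by rewrite -[es](subrK 1) (le_trans (ler_normD _ _))// normr1; lra.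
apply: le_trans (N_le_ReIm _) _.
have -> : Re (cexp h - cexp 0 - h) = (es - 1 - Re h) + es * (ct - 1).
  by rewrite cexp0 !ReCB Re_cexp -/es -/ct /=; ring.
have -> : Im (cexp h - cexp 0 - h) = es * (st - Im h) + (es - 1) * Im h.
  by rewrite cexp0 !ImCB Im_cexp -/es -/st /=; ring.
have T1 := ler_normD (es - 1 - Re h) (es * (ct - 1)).
have T2 := ler_normD (es * (st - Im h)) ((es - 1) * Im h).
rewrite !normrM in T1 T2.
have U1 : `|es| * `|ct - 1| <= 2 * (e / 8 * `|Im h|) by rewrite ler_pM.
have U2 : `|es| * `|st - Im h| <= 2 * (e / 8 * `|Im h|) by rewrite ler_pM.
have U3 : `|es - 1| * `|Im h| <= e / 8 * `|Im h| by rewrite ler_wpM2r// ltW.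
have V1 : e / 8 * `|Im h| <= e / 8 * N h by rewrite ler_wpM2l//; clear -e0; lra.
have V2 : e / 8 * `|Re h| <= e / 8 * N h by rewrite ler_wpM2l//; clear -e0; lra.
have V0 : 0 <= e / 8 * N h by rewrite mulr_ge0 ?N_ge0//; clear -e0; lra.
clear -T1 T2 U1 U2 U3 V1 V2 V0 Q1; lra.
Qed.

End ComplexCalculus.

(** * The maximum principle and Cauchy's estimate *)
Section MaximumPrinciple.
Context {R : realType}.
Local Notation C := (R[i]).
Local Notation Re := (@complex.Re R).
Local Notation Im := (@complex.Im R).
Implicit Types (f g : C -> C) (z w h a b c : C).

(** The Cauchy-Riemann equations. *)
Lemma cderiv_total f (s t : R) a : cderiv f (s +i* t) a ->
  total_derivative (fun s t => Re (f (s +i* t))) s t (Re a) (- Im a) /\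
  total_derivative (fun s t => Im (f (s +i* t))) s t (Im a) (Re a).
Proof.
move=> D; split=> e e0; have [d d0 dP] := D e e0;
  (exists (d / 2); first by rewrite divr_gt0); move=> h k hd kd.
- have kh := N_le_ReIm (h +i* k); rewrite /= in kh.
  have nd : N (h +i* k) < d by rewrite [d]splitr (le_lt_trans kh)// ltrD.
  apply: le_trans (le_trans (dP _ nd) _); last by rewrite ler_wpM2l// ltW.
  apply: le_trans (Re_le_N _).
  rewrite !ReCB ReCM /= -[(s +i* t) + (h +i* k)]/((s + h) +i* (t + k)).
  by rewrite le_eqVlt; apply/orP; left; apply/eqP; congr `|_|; ring.
- have kh := N_le_ReIm (h +i* k); rewrite /= in kh.
  have nd : N (h +i* k) < d by rewrite [d]splitr (le_lt_trans kh)// ltrD.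
  apply: le_trans (le_trans (dP _ nd) _); last by rewrite ler_wpM2l// ltW.
  apply: le_trans (Im_le_N _).
  rewrite !ImCB ImCM /= -[(s +i* t) + (h +i* k)]/((s + h) +i* (t + k)).
  by rewrite le_eqVlt; apply/orP; left; apply/eqP; congr `|_|; ring.
Qed.

Lemma total_derivative_continuous (U : R -> R -> R) (s t a b : R) :
  total_derivative U s t a b ->
  {for t, continuous (U s)} /\ {for s, continuous (U^~ t)}.
Proof.
move=> D; have [d d0 dP] := D 1 ltr01.
pose K := 1 + `|a| + `|b|.
have K1 : 0 < K by rewrite /K -addrA ltr_wpDr// addr_ge0.
split; apply/continuousR_eps => e e0;
  (exists (Num.min d (e / K)); first by rewrite lt_min d0 divr_gt0);
  move=> y; rewrite lt_min ltr_pdivlMr// => /andP[yd ye].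
- have := dP 0 (y - t); rewrite normr0 addr0 subrKC mulr0 subr0 add0r mul1r => /(_ d0 yd) H.
  apply: le_lt_trans ye; rewrite -[U s y - U s t](subrK (b * (y - t))).
  apply: le_trans (ler_normD _ _) _; apply: le_trans (lerD H (lexx _)) _.
  rewrite normrM /K; have := mulr_ge0 (normr_ge0 a) (normr_ge0 (y - t)).
  by clear; nra.
- have := dP (y - s) 0; rewrite normr0 addr0 subrKC mulr0 subr0 addr0 mul1r => /(_ yd d0) H.
  apply: le_lt_trans ye; rewrite -[U y t - U s t](subrK (a * (y - s))).
  apply: le_trans (ler_normD _ _) _; apply: le_trans (lerD H (lexx _)) _.
  rewrite normrM /K; have := mulr_ge0 (normr_ge0 b) (normr_ge0 (y - s)).
  by clear; nra.
Qed.

(** In the coordinate s + i t = log h the circles around 0 become vertical segments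
    of length 2 pi, and Goursat's lemma between two of them shows that the circular
    means of Re (u G) agree, the horizontal sides cancelling by periodicity.
    By the mean value theorem Re (u G) then takes a common value on the circle of
    radius r and on an arbitrarily small one.  If u G(0) = |G(0)| > M, that value
    would be at most M on the first and close to |G(0)| on the second.  The
    function need not be differentiable at 0 itself, which admits difference
    quotients. *)
Lemma central_max (G : C -> C) (r R0 M : R) : 0 < r -> r < R0 ->
  (forall e : R, 0 < e -> exists2 d : R, 0 < d & forall h, N h < d -> N (G h - G 0) < e) ->
  (forall h, 0 < N h -> N h < R0 -> exists a, cderiv G h a) ->
  (forall h, N h = r -> N (G h) <= M) -> N (G 0) <= M.
Proof.
move=> r0 rR cG dG GM; rewrite leNgt; apply/negP => MG.
have R00 : 0 < R0 by apply: lt_trans rR.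
have [u u1 uE] := exists_phase (G 0).
pose H z := u * G (cexp z).
pose U s t := Re (H (s +i* t)); pose V s t := Im (H (s +i* t)).
pose s2 := ln r; pose S := (ln r + ln R0) / 2.
have lnrR : ln r < ln R0 by rewrite ltr_ln.
have s2S : s2 < S by rewrite /S /s2; lra.
have SR : S < ln R0 by rewrite /S; lra.
have dH s t : s < ln R0 -> exists a, cderiv H (s +i* t) a.
  move=> sR; have [|| a da] := dG (cexp (s +i* t)).
  - by rewrite N_cexp expR_gt0.
  - by rewrite N_cexp /= -[R0]lnK ?posrE// ltr_expR.
  have D := cderivM (cderiv_cst u (cexp (s +i* t))) da.
  by eexists; exact: (cderiv_comp (cderiv_cexp (s +i* t)) D).
have e0 : 0 < (N (G 0) - M) / 2 by lra.
have [d d0 dP] := cG _ e0.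
(* The circle of radius exp(s1) is so small that G is close to G(0) on it. *)
pose s1 := Num.min (s2 - 1) (ln (d / 2)).
have s12 : s1 <= s2.
  by rewrite /s1; apply: (@le_trans _ _ (s2 - 1)); rewrite ?ge_min ?lexx// gerBl.
have es1 : expR s1 < d.
  apply: (@le_lt_trans _ _ (d / 2)); last by lra.
  rewrite -[leRHS]lnK ?posrE ?divr_gt0// ler_expR /s1 ge_min lexx orbT//.
have [T pi2 [cosT sinT]] : exists2 T : R, 0 < T & cos T = 1 /\ sin T = 0.
  by exists (pi *+ 2); [rewrite mulrn_wgt0// pi_gt0 | rewrite cos2pi sin2pi].
have contU s t : s < ln R0 -> {for t, continuous (U s)}.
  move=> /(dH s t)[a] /cderiv_total [D _].
  exact: (total_derivative_continuous D).1.
have contV s t : s < ln R0 -> {for s, continuous (V^~ t)}.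
  move=> /(dH s t)[a] /cderiv_total [_ D].
  exact: (total_derivative_continuous D).2.
have [PU dPU] : exists PU : R -> R -> R, forall s t : R, s <= s2 -> 0 <= t <= T ->
    is_derive t 1 (PU s) (U s t).
  (* The integrals start to the left of the rectangle, so that its sides are
     interior points for the fundamental theorem of calculus. *)
  exists (fun s t => parameterized_integral lebesgue_measure (-1) t (U s)) => s t ss /andP[t0 t1].
  apply: (@parameterized_integral_is_derive _ _ _ (T + 1)).
    move=> y _; apply: contU; apply: le_lt_trans ss _; exact: lt_trans SR.
  by apply/andP; split; [apply: lt_le_trans t0; rewrite oppr_lt0|apply: le_lt_trans t1 _; rewrite ltrDl].
have [PV dPV perPV] : exists2 PV : R -> R -> R, (forall s t : R, s1 <= s <= s2 ->
    is_derive s 1 (PV t) (V s t)) & PV T = PV 0.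
  exists (fun t s => parameterized_integral lebesgue_measure (s1 - 1) s (V^~ t)).
    move=> s t /andP[h1 h2]; apply: (@parameterized_integral_is_derive _ (V^~ t) _ S).
      move=> y /andP[_ yS]; apply: contV; exact: le_lt_trans yS SR.
    by apply/andP; split; [apply: lt_le_trans h1; rewrite gtrBl|exact: le_lt_trans h2 s2S].
  suff -> : V^~ T = V^~ 0 by [].
  apply/funext => s; rewrite /V /H; congr (Im (u * G _)).
  by rewrite /cexp /= cosT sinT cos0 sin0.
have dUV (s t : R) : s1 <= s <= s2 -> 0 <= t <= T -> exists p q r : R,
      total_derivative U s t p q /\ total_derivative V s t r p.
  move=> /andP[h1 h2] _.
  have [a /cderiv_total [D1 D2]] := dH s t (le_lt_trans h2 (lt_trans s2S SR)).
  by exists (Re a), (- Im a), (Im a).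
have := @goursat R U V PU PV s1 s2 0 T s12 (ltW pi2) dUV
  (fun s t hs ht => dPU s t (andP hs).2 ht) (fun s t hs _ => dPV s t hs).
rewrite perPV subrr.
move=> /eqP; rewrite subr_eq0 => /eqP E.
have [t2 ht2 E2] := MVT_increment (ltW pi2) (fun t => dPU s2 t (lexx _)).
have [t1 ht1 E1] := MVT_increment (ltW pi2) (fun t => dPU s1 t s12).
have {E1 E2 E} E : U s2 t2 = U s1 t1.
  move: E; rewrite E1 E2 subr0; apply: mulIf; by rewrite gt_eqF.
have B2 : U s2 t2 <= M.
  apply: le_trans (ler_norm _) _; apply: le_trans (Re_le_N _) _.
  by rewrite /H NM u1 mul1r; apply: GM; rewrite N_cexp /= lnK.
have B1 : N (G 0) - (N (G 0) - M) / 2 < U s1 t1.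
  rewrite ltrBlDr -ltrBlDl.
  have -> : N (G 0) - U s1 t1 = Re (u * (G 0 - G (cexp (s1 +i* t1)))).
    by rewrite mulrBr uE ReCB.
  apply: le_lt_trans (ler_norm _) _; apply: le_lt_trans (Re_le_N _) _.
  by rewrite NM u1 mul1r NBC; apply: dP; rewrite N_cexp.
clear -B1 B2 E MG; rewrite E in B2; lra.
Qed.

(** The maximum principle applied to the difference quotient of f at z, whose value
    at the centre is the derivative. *)
Lemma cauchy_estimate f (f' : C -> C) z (r R0 M : R) : 0 < r -> r < R0 ->
  (forall w, N (w - z) < R0 -> cderiv f w (f' w)) ->
  (forall h, N h = r -> N (f (z + h) - f z) <= M) -> N (f' z) <= M / r.
Proof.
move=> r0 rR df fM.
have R00 : 0 < R0 by apply: lt_trans rR.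
pose G h := if h == 0 then f' z else (f (z + h) - f z) / h.
have -> : f' z = G 0 by rewrite /G eqxx.
have dz : cderiv f z (f' z) by apply: df; rewrite subrr N0.
apply: (central_max r0 rR).
- move=> e e0; have [d d0 dP] := dz (e / 2) (divr_gt0 e0 (ltr0Sn _ 1)).
  exists d => // h hd; rewrite /G eqxx; case: ifPn => [_|h0]; first by rewrite subrr N0.
  have -> : (f (z + h) - f z) / h - f' z = (f (z + h) - f z - f' z * h) / h by field.
  rewrite NM NV ltr_pdivrMr ?N_gt0//; apply: le_lt_trans (dP _ hd) _.
  by rewrite ltr_pM2r ?N_gt0// ltr_pdivrMr// ltr_pMr// ltr1n.
- move=> h h0 hR; have h0' : h != 0 by rewrite -N_gt0.
  have D1 : cderiv (fun w => f (z + w)) h (f' (z + h) * (0 + 1)).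
    apply: (@cderiv_comp _ f (fun w => z + w)).
      exact: cderivD (cderiv_cst _ _) (cderiv_id _).
    by apply: df; rewrite addrC addKr.
  have D := cderivM (cderivB D1 (cderiv_cst (f z) h)) (cderivV h0').
  eexists; apply: cderiv_ext D; exists (N h) => // k kh.
  rewrite /G ifF//; apply/negbTE; rewrite -N_gt0.
  by have := NB_ge h (- k); rewrite NN opprK; lra.
- move=> h hr; have h0 : h != 0 by rewrite -N_gt0 hr.
  rewrite /G ifF; last exact/negbTE.
  by rewrite NM NV hr ler_wpM2r ?fM// invr_ge0 ltW.
Qed.

Lemma cderiv_segment f z v (t : R) a : cderiv f (z + t%:C * v) a ->
  is_derive t 1 (fun t : R => Re (f (z + t%:C * v))) (Re (a * v)).
Proof.
move=> D; apply/is_derive_eps => e e0.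
pose K := N v + 1; have K0 : 0 < K by rewrite /K; have := N_ge0 v; lra.
have [d d0 dP] := D (e / K) (divr_gt0 e0 K0).
exists (d / K); first by rewrite divr_gt0.
move=> h; rewrite ltr_pdivlMr// => hd.
have Nh : N (h%:C * v) <= `|h| * K.
  by rewrite NM NReal ler_wpM2l// lerDl.
have := dP _ (le_lt_trans Nh hd).
have -> : z + t%:C * v + h%:C * v = z + (t + h)%:C * v by rewrite rmorphD /=; ring.
move=> H.
apply: (@le_trans _ _ (e / K * N (h%:C * v))).
  apply: le_trans (le_trans (Re_le_N _) H).
  by rewrite le_eqVlt; apply/orP; left; apply/eqP; congr `|_|; rewrite !ReCB !ReCM ?ImCM /=; ring.
apply: le_trans (ler_wpM2l (ltW (divr_gt0 e0 K0)) Nh) _.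
by rewrite mulrCA divfK ?gt_eqF// mulrC.
Qed.

(** The real mean value theorem along the segment, after multiplication by a
    phase. *)
Lemma mean_value_inequality f (f' : C -> C) w w' (K : R) :
  (forall t : R, 0 <= t <= 1 ->
     cderiv f (w + t%:C * (w' - w)) (f' (w + t%:C * (w' - w))) /\
     N (f' (w + t%:C * (w' - w))) <= K) ->
  N (f w' - f w) <= K * N (w' - w).
Proof.
move=> df; have [u u1 uE] := exists_phase (f w' - f w).
pose g x := u * f x.
have dg (t : R) : 0 <= t <= 1 -> is_derive t 1 (fun t : R => Re (g (w + t%:C * (w' - w))))
    (Re (u * f' (w + t%:C * (w' - w)) * (w' - w))).
  move=> /df [D _]; apply: cderiv_segment.
  by have := cderivM (cderiv_cst u _) D; rewrite mul0r add0r.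
have [c c01 E] := MVT_increment ler01 dg.
move: E; rewrite mul1r mul0r addr0 subrKC subr0 mulr1 -ReCB /g -mulrBr uE /= => ->.
apply: le_trans (ler_norm _) _; apply: le_trans (Re_le_N _) _.
rewrite 2!NM u1 mul1r ler_wpM2r ?N_ge0//; exact: (df c c01).2.
Qed.

Lemma segment_in_ball z w w' (t rho : R) : 0 <= t <= 1 ->
  N (w - z) < rho -> N (w' - z) < rho -> N (w + t%:C * (w' - w) - z) < rho.
Proof.
move=> /andP[t0 t1] h1 h2.
have -> : w + t%:C * (w' - w) - z = (1 - t)%:C * (w - z) + t%:C * (w' - z).
  by rewrite rmorphB rmorph1; ring.
apply: le_lt_trans (ND _ _) _; rewrite !NM !NReal ger0_norm ?subr_ge0// ger0_norm//.
set a := N _ in h1 *; set b := N _ in h2 *.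
have [->|tn] := eqVneq t 0; first by rewrite subr0 mul1r mul0r addr0.
have tp : 0 < t by rewrite lt_neqAle eq_sym tn.
have A : (1 - t) * a <= (1 - t) * rho by rewrite ler_wpM2l ?subr_ge0// ltW.
have B : t * b < t * rho by rewrite ltr_pM2l.
clear -A B; lra.
Qed.

(** Cauchy's estimate is used twice.  Applied to f it bounds f', hence f is
    Lipschitz; applied to x |-> f x - f (x + c), which is therefore of size |c|, it
    bounds f' w - f' (w + c) by a multiple of |c|.  Integration of the Lipschitz
    bound gives the quadratic remainder. *)
Lemma derivative_locally_Lipschitz f (f' : C -> C) z (R0 : R) : 0 < R0 ->
  (forall w, N (w - z) < R0 -> cderiv f w (f' w)) ->
  exists rho K : R, [/\ 0 < rho, rho <= R0, 0 <= K,
    (forall w w', N (w - z) < rho -> N (w' - z) < rho ->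
        N (f' w' - f' w) <= K * N (w' - w)) &
    (forall w w', N (w - z) < rho -> N (w' - z) < rho ->
        N (f w' - f w - f' w * (w' - w)) <= K * N (w' - w) ^+ 2)].
Proof.
move=> R00 df.
have [d1 d10 c1] := cderiv_continuous (df z ltac:(rewrite subrr N0//)) ltr01.
pose d := Num.min d1 R0.
have d0 : 0 < d by rewrite lt_min d10.
have dR : d <= R0 by rewrite ge_min lexx orbT.
have fd w : N (w - z) < d -> N (f w - f z) < 1.
  move=> wd; rewrite -[w](subrKC z); apply: c1; apply: lt_le_trans wd _.
  by rewrite ge_min lexx.
pose K1 := 2 / (d / 2).
have K10 : 0 <= K1 by rewrite /K1 divr_ge0// divr_ge0// ltW.
have f'1 w : N (w - z) < d / 4 -> N (f' w) <= K1.
  move=> wd; apply: (@cauchy_estimate f f' w (d / 2) (d / 2 + d / 8)); rewrite ?divr_gt0//.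
  - by lra.
  - move=> x xw; apply: df; apply: lt_le_trans dR.
    by rewrite -(subrK w x) -addrA (le_lt_trans (ND _ _))//; lra.
  - move=> h hd; rewrite -(subrK (f z) (f (w + h))) -addrA.
    have w1 : N (w - z) < d by clear -wd d0; lra.
    have w2 : N (w + h - z) < d by rewrite addrAC (le_lt_trans (ND _ _))//; clear -wd d0 hd; lra.
    have := fd _ w1; have := fd _ w2; have := ND (f (w + h) - f z) (f z - f w).
    by rewrite [N (f z - f w)]NBC; clear; lra.
have lipf w w' : N (w - z) < d / 4 -> N (w' - z) < d / 4 -> N (f w' - f w) <= K1 * N (w' - w).
  move=> h1 h2; apply: (@mean_value_inequality f f') => t t01.
  have := segment_in_ball t01 h1 h2 => h3; split; last exact: f'1.
  by apply: df; clear -h3 d0 dR; lra.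
pose K := 2 * K1 / (d / 16).
have K0 : 0 <= K by apply: divr_ge0; [exact: mulr_ge0|apply: divr_ge0; rewrite ?(ltW d0)].
have lipf' w w' : N (w - z) < d / 16 -> N (w' - z) < d / 16 -> N (f' w' - f' w) <= K * N (w' - w).
  move=> h1 h2; set c := w' - w.
  rewrite NBC (_ : K * N c = 2 * K1 * N c / (d / 16)); last by rewrite /K mulrAC.
  have Nc : N c < d / 8.
    have -> : c = (w' - z) - (w - z) by rewrite /c; ring.
    by have := NB (w' - z) (w - z); lra.
  rewrite (_ : w' = w + c); last by rewrite /c subrKC.
  have inb x : N (x - w) <= d / 16 -> N (x - z) < d / 4 /\ N (x + c - z) < d / 4.
    move=> xw; have := ND (x - w) (w - z); rewrite subrKA => X; split; first by clear -X xw h1 d0; lra.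
    have := ND (x - w) (w' - z).
    have -> : x - w + (w' - z) = x + c - z by rewrite /c; ring.
    by clear -xw h2 d0; lra.
  apply: (@cauchy_estimate (fun x => f x - f (x + c)) (fun x => f' x - f' (x + c)) w (d / 16) (d / 8)); rewrite ?divr_gt0//.
  - by clear -d0; lra.
  - move=> x xw; apply: cderivB.
      apply: df; apply: lt_le_trans dR; have := ND (x - w) (w - z); rewrite subrKA => X.
      by clear -X xw h1 d0; lra.
    rewrite (_ : f' (x + c) = f' (x + c) * (1 + 0)); last by rewrite addr0 mulr1.
    apply: (@cderiv_comp _ f (fun x => x + c)).
      exact: cderivD (cderiv_id _) (cderiv_cst _ _).
    apply: df; apply: lt_le_trans dR; have := ND (x - w) (w' - z).
    have -> : x - w + (w' - z) = x + c - z by rewrite /c; ring.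
    by clear -xw h2 d0; lra.
  - move=> h hd.
    have [w1 w2] := inb (w + h) ltac:(rewrite addrC addKr hd//).
    have [w3 w4] := inb w ltac:(rewrite subrr N0; lra).
    have := lipf _ _ w2 w1; have := lipf _ _ w4 w3.
    have sub x : x - (x + c) = - c by ring.
    rewrite !sub !NN.
    have := NB (f (w + h) - f (w + h + c)) (f w - f (w + c)).
    by clear; lra.
exists (d / 16), K; split=> //.
- by rewrite divr_gt0.
- by clear -d0 dR; lra.
- move=> w w' h1 h2.
  pose g x := f x - f' w * x.
  have -> : f w' - f w - f' w * (w' - w) = g w' - g w by rewrite /g; ring.
  rewrite expr2 mulrA.
  apply: (@mean_value_inequality g (fun x => f' x - f' w)) => t t01.
  have h3 := segment_in_ball t01 h1 h2.
  split.
    have := cderivB (df _ ltac:(clear -h3 d0 dR; lra) : cderiv f (w + t%:C * (w' - w)) _) (cderivM (cderiv_cst (f' w) _) (cderiv_id _)).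
    by rewrite mul0r add0r mulr1.
  apply: le_trans (lipf' _ _ h1 h3) _; rewrite ler_wpM2l// addrC addKr NM NReal.
  by have /andP[t0 t1] := t01; rewrite ger0_norm// ler_piMl ?N_ge0.
Qed.

(** The derivative f' is not known to be differentiable itself.  It is the uniform
    limit of difference quotients of f, which are, and to which the maximum
    principle applies. *)
Lemma max_principle_derivative (H f f' : C -> C) (R0 : R) : 0 < R0 ->
  (forall w, N w < R0 -> cderiv f w (f' w)) ->
  (forall w, N w < R0 -> exists a, cderiv H w a) ->
  exists2 rho : R, 0 < rho & forall r M : R, 0 < r -> r < rho ->
    (forall h, N h = r -> N (H h * f' h) <= M) -> N (H 0 * f' 0) <= M.
Proof.
move=> R00 df dH.
have df0 w : N (w - 0) < R0 -> cderiv f w (f' w) by rewrite subr0; exact: df.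
have [rho0 [K [rho00 rhoR K0 _ quad]]] := derivative_locally_Lipschitz R00 df0.
have [a dH0] := dH 0 ltac:(rewrite N0//).
have [rho1 rho10 cH] := cderiv_continuous dH0 ltr01.
pose B := N (H 0) + 1.
have B0 : 0 < B by rewrite /B; have := N_ge0 (H 0); lra.
have HB h : N h < rho1 -> N (H h) <= B.
  move=> /cH; rewrite add0r => X; rewrite -[H h](subrK (H 0)).
  by have := ND (H h - H 0) (H 0); rewrite /B; clear -X; lra.
exists (Num.min rho0 rho1); first by rewrite lt_min rho00.
move=> r M r0; rewrite lt_min => /andP[r1 r2] HM.
apply/ler_addgt0Pr => e e0.
pose L := 2 * (B * K) + 1.
have L0 : 0 < L by rewrite /L ltr_wpDl// mulr_ge0// mulr_ge0// ltW.
pose y := Num.min ((rho0 - r) / 2) (e / L).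
have y0 : 0 < y by rewrite lt_min !divr_gt0// subr_gt0.
have yr : y <= (rho0 - r) / 2 by rewrite ge_min lexx.
have ye : y * L <= e by rewrite -ler_pdivlMr// ge_min lexx orbT.
pose eta : C := y%:C.
have Neta : N eta = y by rewrite NReal gtr0_norm.
have eta0 : eta != 0 by rewrite -N_gt0 Neta.
pose D h := (f (h + eta) - f h) / eta.
have DE h : N h <= r -> N (D h - f' h) <= K * y.
  move=> hr; have := quad h (h + eta); rewrite !subr0 => Q.
  have {Q} : N (f (h + eta) - f h - f' h * (h + eta - h)) <= K * N (h + eta - h) ^+ 2.
    apply: Q; first by clear -hr r1; lra.
    by have := ND h eta; rewrite Neta; clear -hr r1 yr; lra.
  have -> : h + eta - h = eta by rewrite addrC addKr.
  rewrite Neta => Q.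
  have -> : D h - f' h = (f (h + eta) - f h - f' h * eta) / eta by rewrite /D; field.
  by rewrite NM NV Neta ler_pdivrMr// -mulrA.
have HDM h : N h = r -> N (H h * D h) <= M + B * (K * y).
  move=> hr; have -> : H h * D h = H h * f' h + H h * (D h - f' h) by ring.
  apply: le_trans (ND _ _) _; apply: lerD; first exact: HM.
  by rewrite NM ler_pM ?N_ge0// ?HB ?DE ?hr.
pose R1 := (rho0 + r) / 2.
have HD0 : N (H 0 * D 0) <= M + B * (K * y).
  have dHD h : N h < R1 -> exists b, cderiv (fun h => H h * D h) h b.
    move=> hR; have [b Hb] := dH h ltac:(clear -hR r1 rhoR; rewrite /R1 in hR; lra).
    have D1 : cderiv f h (f' h) by apply: df; clear -hR r1 rhoR; rewrite /R1 in hR; lra.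
    have D2 : cderiv (fun h => f (h + eta)) h (f' (h + eta) * (1 + 0)).
      apply: (@cderiv_comp _ f (fun x => x + eta)).
        exact: cderivD (cderiv_id _) (cderiv_cst _ _).
      apply: df; have := ND h eta; rewrite Neta; rewrite /R1 in hR; clear -hR yr rhoR; lra.
    by eexists; apply: cderivM Hb (cderivM (cderivB D2 D1) (cderiv_cst eta^-1 h)).
  apply: (@central_max (fun h => H h * D h) r R1) => //.
  - by rewrite /R1; clear -r1; lra.
  - move=> e' e'0; have [b Hb] := dHD 0 ltac:(rewrite N0 /R1; clear -r0 rho00; lra).
    have [d d0 dP] := cderiv_continuous Hb e'0; exists d => // h hd.
    by have := dP h hd; rewrite add0r.
  - by move=> h _; exact: dHD.
have -> : H 0 * f' 0 = H 0 * D 0 - H 0 * (D 0 - f' 0) by ring.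
apply: le_trans (NB _ _) _.
have T : N (H 0 * (D 0 - f' 0)) <= B * (K * y).
  by rewrite NM ler_pM ?N_ge0 ?HB ?DE// ?N0// ltW.
have : M + B * (K * y) + B * (K * y) <= M + e.
  rewrite -addrA lerD2l; apply: le_trans ye; rewrite /L mulrDr mulr1.
  have -> : B * (K * y) + B * (K * y) = y * (2 * (B * K)) by ring.
  by rewrite lerDl ltW.
by move: HD0 T; clear; lra.
Qed.

End MaximumPrinciple.

(** * Second order Taylor expansions *)
Section Taylor.
Context {R : realType}.

Lemma mean_value_bound (F f : R -> R) (x0 s M : R) :
  (forall t, `|t| <= `|s| -> is_derive (x0 + t) 1 F (f (x0 + t))) ->
  (forall t, `|t| <= `|s| -> `|f (x0 + t)| <= M) ->
  `|F (x0 + s) - F x0| <= M * `|s|.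
Proof.
move=> dF fM.
have main (a b : R) : a <= b -> (forall x, a <= x <= b -> `|x - x0| <= `|s|) ->
    `|F b - F a| <= M * (b - a).
  move=> ab H; have [|c cab ->] := MVT_increment ab (F := F) (f := f).
    by move=> x /H xs; rewrite -[x](subrKC x0); exact: dF.
  rewrite normrM [`|b - a|]ger0_norm ?subr_ge0// ler_wpM2r ?subr_ge0//.
  by rewrite -[c](subrKC x0); apply: fM; exact: H.
have [s0|s0] := leP 0 s.
  rewrite [X in _ <= _ * X](_ : `|s| = x0 + s - x0); last by rewrite ger0_norm// addrAC subrr add0r.
  apply: main; first by rewrite lerDl.
  by move=> x /andP[h1 h2]; rewrite ger0_norm ?subr_ge0// ger0_norm//; lra.
rewrite [X in _ <= _ * X](_ : `|s| = x0 - (x0 + s)); last by rewrite ltr0_norm//; lra.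
rewrite distrC; apply: main; first by lra.
by move=> x /andP[h1 h2]; rewrite (ltr0_norm s0) ler0_norm; lra.
Qed.

Lemma is_derive_linear (c a x : R) : is_derive x 1 (fun t => c * (t - a)) c.
Proof.
apply/is_derive_eps => e e0; exists 1 => // h _.
rewrite (_ : _ - _ - _ = 0); last by ring.
by rewrite normr0 mulr_ge0// ltW.
Qed.

Lemma is_derive_subl (c x : R) : is_derive x 1 (fun t => c - t) (-1).
Proof. by have := is_derive_linear (-1) c x; under eq_fun do rewrite mulN1r opprB. Qed.

(** The mean value bound for F minus its candidate quadratic Taylor polynomial. *)
Lemma integrate_linear_bound (F f : R -> R) (x0 s c e : R) :
  (forall t, `|t| <= `|s| -> is_derive (x0 + t) 1 F (f (x0 + t))) ->
  (forall t, `|t| <= `|s| -> `|f (x0 + t) - f x0 - c * t| <= e * `|s|) ->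
  `|F (x0 + s) - F x0 - s * f x0 - c / 2 * s ^+ 2| <= e * s ^+ 2.
Proof.
move=> dF fe.
pose G x := F x - ((x - x0) * f x0 + c / 2 * (x - x0) ^+ 2).
pose g x := f x - (f x0 + c * (x - x0)).
have -> : F (x0 + s) - F x0 - s * f x0 - c / 2 * s ^+ 2 = G (x0 + s) - G x0.
  by rewrite /G; ring.
rewrite -real_normK ?num_real// expr2 mulrA.
apply: (@mean_value_bound G g) => t ts; last first.
  have -> : g (x0 + t) = f (x0 + t) - f x0 - c * t by rewrite /g; ring.
  exact: fe.
apply/is_derive_eps => d d0.
have c2 : 0 < `|c / 2| + 1 by rewrite ltr_wpDl.
have [d1 d10 dP] := (is_derive_eps _ _ _).1 (dF t ts) (d / 2) (divr_gt0 d0 (ltr0Sn _ 1)).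
exists (Num.min d1 (d / 2 / (`|c / 2| + 1))); first by rewrite lt_min d10 !divr_gt0.
move=> h; rewrite lt_min ltr_pdivlMr// => /andP[/dP h1 h2].
have -> : G (x0 + t + h) - G (x0 + t) - g (x0 + t) * h =
   (F (x0 + t + h) - F (x0 + t) - f (x0 + t) * h) - (c / 2 * h) * h.
  by rewrite /G /g; field.
apply: le_trans (ler_normB _ _) _; rewrite [d]splitr mulrDl; apply: lerD => //.
rewrite normrM ler_wpM2r// normrM; apply: le_trans (ltW h2).
by rewrite mulrC ler_wpM2l// lerDl.
Qed.

Lemma second_order_bound (F f g : R -> R) (x0 s c e : R) :
  (forall t, `|t| <= `|s| -> is_derive (x0 + t) 1 F (f (x0 + t))) ->
  (forall t, `|t| <= `|s| -> is_derive (x0 + t) 1 f (g (x0 + t))) ->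
  (forall t, `|t| <= `|s| -> `|g (x0 + t) - c| <= e) ->
  `|F (x0 + s) - F x0 - s * f x0 - c / 2 * s ^+ 2| <= e * s ^+ 2.
Proof.
move=> dF df ge; apply: integrate_linear_bound => // t ts.
have e0 : 0 <= e by apply: le_trans (ge 0 _); rewrite ?normr0.
apply: (@le_trans _ _ (e * `|t|)); last by rewrite ler_wpM2l.
pose g1 x := f x - c * (x - x0).
have -> : f (x0 + t) - f x0 - c * t = g1 (x0 + t) - g1 x0 by rewrite /g1; ring.
apply: (@mean_value_bound g1 (fun x => g x - c)) => u ut.
  exact: is_deriveB (df u (le_trans ut ts)) (is_derive_linear c x0 (x0 + u)).
by apply: ge; exact: le_trans ts.
Qed.

End Taylor.

Section RealContinuity.
Context {R : realType} {T : topologicalType}.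
Implicit Types (f g : T -> R) (z : T).

Lemma continuous_mul f g z : {for z, continuous f} -> {for z, continuous g} ->
  {for z, continuous (fun w => f w * g w)}.
Proof. by move=> cf cg; exact: (cvgM cf cg). Qed.

Lemma continuous_const (a : R) z : {for z, continuous (fun _ : T => a)}.
Proof. exact: cvg_cst. Qed.

Lemma continuous_add f g z : {for z, continuous f} -> {for z, continuous g} ->
  {for z, continuous (fun w => f w + g w)}.
Proof. by move=> cf cg; exact: (cvgD cf cg). Qed.

Lemma continuous_sub f g z : {for z, continuous f} -> {for z, continuous g} ->
  {for z, continuous (fun w => f w - g w)}.
Proof. by move=> cf cg; exact: (cvgB cf cg). Qed.

Lemma continuous_inv f z : f z != 0 -> {for z, continuous f} ->
  {for z, continuous (fun w => (f w)^-1)}.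
Proof. by move=> f0 cf; exact: (cvgV f0 cf). Qed.

End RealContinuity.
Arguments continuous_const {R T} a z _ _.

Section PlaneTaylor.
Context {R : realType}.
Local Notation C := (Cplx R).
Local Notation Re := (@complex.Re R).
Local Notation Im := (@complex.Im R).
Implicit Types (u f g : C -> R) (W : set C) (z : C).

Lemma ReImK z : Re z +i* Im z = z. Proof. by case: z. Qed.

Lemma C1_on_is_derive W u z : C1_on W u -> W z ->
  is_derive (Re z) 1 (fun x : R => u (x +i* Im z)) (dx u z) /\
  is_derive (Im z) 1 (fun y : R => u (Re z +i* y)) (dy u z).
Proof.
move=> Wu /Wu [h1 h2 _ _].
split; first by apply: (DeriveDef h1); rewrite /dx derive1E.
by apply: (DeriveDef h2); rewrite /dy derive1E.
Qed.

Lemma dx_is_derive u z (a : R) : is_derive (Re z) 1 (fun x : R => u (x +i* Im z)) a -> dx u z = a.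
Proof. by move=> D; rewrite /dx derive1E derive_val. Qed.

Lemma dy_is_derive u z (a : R) : is_derive (Im z) 1 (fun x : R => u (Re z +i* x)) a -> dy u z = a.
Proof. by move=> D; rewrite /dy derive1E derive_val. Qed.

Lemma is_derive_near (F G : R -> R) (x a : R) :
  (exists2 d, 0 < d & forall h, `|h| < d -> F (x + h) = G (x + h)) ->
  is_derive x 1 F a -> is_derive x 1 G a.
Proof.
move=> [d d0 FG] /is_derive_eps D; apply/is_derive_eps => e e0.
have [d1 d10 dP] := D e e0; exists (Num.min d d1); first by rewrite lt_min d0.
move=> h; rewrite lt_min => /andP[h1 h2].
rewrite -FG// -[X in `|_ - G X - _|]addr0 -FG ?normr0// addr0; exact: dP.
Qed.

Lemma continuous_near (u v : C -> R) z : (exists2 d : R, 0 < d & forall w, N (w - z) < d -> u w = v w) ->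
  {for z, continuous u} -> {for z, continuous v}.
Proof.
move=> [d d0 uv] /continuousC_R cu; apply/continuousC_R => e e0.
have [d1 d10 dP] := cu e e0; exists (Num.min d d1); first by rewrite lt_min d0.
move=> w; rewrite lt_min => /andP[h1 h2]; rewrite -!uv ?subrr ?N0//; exact: dP.
Qed.

Lemma open_ball W z : open W -> W z -> exists2 d : R, 0 < d & forall w, N (w - z) < d -> W w.
Proof. by move=> oW Wz; apply/nbhs_N; exact: open_nbhs_nbhs. Qed.

Lemma near_line W z : open W -> W z -> exists2 d : R, 0 < d &
  forall h : R, `|h| < d -> W ((Re z + h) +i* Im z) /\ W (Re z +i* (Im z + h)).
Proof.
move=> oW Wz; have [d d0 dP] := open_ball oW Wz; exists d => // h hd.
split; apply: dP; apply: le_lt_trans hd.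
  by apply: le_trans (N_le_ReIm _) _; rewrite ReCB ImCB /= subrr normr0 addr0 addrC addKr.
by apply: le_trans (N_le_ReIm _) _; rewrite ReCB ImCB /= subrr normr0 add0r addrC addKr.
Qed.

(** On an open set the partial derivatives only depend on the values there, so a
    function may be replaced by an explicit formula for it. *)
Lemma C1_on_near W f g : open W -> (forall z, W z -> f z = g z) -> C1_on W f ->
  C1_on W g /\ forall z, W z -> dx g z = dx f z /\ dy g z = dy f z.
Proof.
move=> oW fg C1.
have D z : W z -> dx g z = dx f z /\ dy g z = dy f z /\
   is_derive (Re z) 1 (fun x : R => g (x +i* Im z)) (dx f z) /\
   is_derive (Im z) 1 (fun x : R => g (Re z +i* x)) (dy f z).
  move=> Wz; have [Dx Dy] := C1_on_is_derive C1 Wz.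
  have [d d0 dP] := near_line oW Wz.
  have Dx' : is_derive (Re z) 1 (fun x : R => g (x +i* Im z)) (dx f z).
    by apply: is_derive_near Dx; exists d => // h /dP [/fg].
  have Dy' : is_derive (Im z) 1 (fun x : R => g (Re z +i* x)) (dy f z).
    by apply: is_derive_near Dy; exists d => // h /dP [_ /fg].
  by split; [exact: dx_is_derive|split; [exact: dy_is_derive|]].
split=> z Wz; last by have [-> [-> _]] := D z Wz.
have [_ [_ [Dx Dy]]] := D z Wz; have [_ _ cx cy] := C1 z Wz.
have [d d0 dP] := open_ball oW Wz.
split.
- exact: (@ex_derive _ _ _ _ _ _ _ Dx).
- exact: (@ex_derive _ _ _ _ _ _ _ Dy).
- by apply: continuous_near cx; exists d => // w /dP /D [-> _].
- by apply: continuous_near cy; exists d => // w /dP /D [_ [-> _]].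
Qed.

Lemma is_derive_ln (F : R -> R) (x a : R) : 0 < F x -> is_derive x 1 F a ->
  is_derive x 1 (fun t => ln (F t)) (a / F x).
Proof.
move=> F0 DF; apply: is_derive_eq (is_derive1_comp (f := @ln R) (is_derive1_ln F0) DF) _.
by rewrite /GRing.scale/= mulrC.
Qed.

Lemma is_derive_quot (F G : R -> R) (x a b : R) : F x != 0 -> is_derive x 1 F a -> is_derive x 1 G b ->
  is_derive x 1 (fun t => G t / F t) (b / F x - G x * a / F x ^+ 2).
Proof.
move=> F0 DF DG.
have DV : is_derive x 1 (fun t => (F t)^-1) (- (F x) ^- 2 * a).
  apply: DeriveDef; first by apply: derivableV => //; exact: ex_derive.
  by rewrite deriveV// derive_val.
apply: is_derive_eq (is_deriveM DG DV) _.
by rewrite /GRing.scale/=; field.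
Qed.

Lemma C1_on_ln W f : open W -> (forall z, W z -> 0 < f z) ->
  (forall z, W z -> {for z, continuous f}) -> C1_on W f ->
  C1_on W (fun z => ln (f z)) /\
  forall z, W z -> dx (fun z => ln (f z)) z = dx f z / f z /\ dy (fun z => ln (f z)) z = dy f z / f z.
Proof.
move=> oW f0 cf C1.
have D z : W z -> is_derive (Re z) 1 (fun x : R => ln (f (x +i* Im z))) (dx f z / f z) /\
   is_derive (Im z) 1 (fun x : R => ln (f (Re z +i* x))) (dy f z / f z).
  move=> Wz; have [Dx Dy] := C1_on_is_derive C1 Wz; split.
    have := @is_derive_ln (fun x => f (x +i* Im z)) (Re z) _ _ Dx.
    by rewrite !ReImK; apply; exact: f0.
  have := @is_derive_ln (fun x => f (Re z +i* x)) (Im z) _ _ Dy.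
  by rewrite !ReImK; apply; exact: f0.
have E z : W z -> dx (fun z => ln (f z)) z = dx f z / f z /\ dy (fun z => ln (f z)) z = dy f z / f z.
  by move=> /D [Dx Dy]; split; [exact: dx_is_derive|exact: dy_is_derive].
split=> // z Wz; have [Dx Dy] := D z Wz; have [_ _ cx cy] := C1 z Wz.
have [d d0 dP] := open_ball oW Wz.
have fz : f z != 0 by rewrite gt_eqF// f0.
split.
- exact: (@ex_derive _ _ _ _ _ _ _ Dx).
- exact: (@ex_derive _ _ _ _ _ _ _ Dy).
- apply: (@continuous_near (fun w => dx f w / f w)).
    by exists d => // w /dP /E [-> _].
  by apply: continuous_mul cx _; apply: continuous_inv fz _; exact: cf.
- apply: (@continuous_near (fun w => dy f w / f w)).
    by exists d => // w /dP /E [_ ->].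
  by apply: continuous_mul cy _; apply: continuous_inv fz _; exact: cf.
Qed.

Lemma C1_on_quot W f g : open W -> (forall z, W z -> f z != 0) ->
  (forall z, W z -> {for z, continuous f}) -> (forall z, W z -> {for z, continuous g}) ->
  C1_on W f -> C1_on W g -> C1_on W (fun z => g z / f z).
Proof.
move=> oW f0 cf cg C1 C1g.
have D z : W z -> is_derive (Re z) 1 (fun x : R => g (x +i* Im z) / (f (x +i* Im z))) (dx g z / f z - g z * dx f z / f z ^+ 2) /\
   is_derive (Im z) 1 (fun x : R => g (Re z +i* x) / (f (Re z +i* x))) (dy g z / f z - g z * dy f z / f z ^+ 2).
  move=> Wz; have [Dx Dy] := C1_on_is_derive C1 Wz; have [Dxg Dyg] := C1_on_is_derive C1g Wz; split.
    have := @is_derive_quot (fun x => f (x +i* Im z)) (fun x => g (x +i* Im z)) (Re z) _ _ _ Dx Dxg.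
    by rewrite !ReImK; apply; exact: f0.
  have := @is_derive_quot (fun x => f (Re z +i* x)) (fun x => g (Re z +i* x)) (Im z) _ _ _ Dy Dyg.
  by rewrite !ReImK; apply; exact: f0.
have E z : W z -> dx (fun z => g z / f z) z = dx g z / f z - g z * dx f z / f z ^+ 2 /\ dy (fun z => g z / f z) z = dy g z / f z - g z * dy f z / f z ^+ 2.
  by move=> /D [Dx Dy]; split; [exact: dx_is_derive|exact: dy_is_derive].
move=> z Wz; have [Dx Dy] := D z Wz; have [_ _ cx cy] := C1 z Wz; have [_ _ cgx cgy] := C1g z Wz.
have [d d0 dP] := open_ball oW Wz.
have fz := f0 z Wz; have cfz := cf z Wz; have cgz := cg z Wz.
have cV := continuous_inv fz cfz.
have f2 : f z ^+ 2 != 0 by rewrite expf_neq0.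
have cV2 := continuous_inv (f := fun w => f w ^+ 2) f2 (continuous_mul cfz cfz).
split.
- exact: (@ex_derive _ _ _ _ _ _ _ Dx).
- exact: (@ex_derive _ _ _ _ _ _ _ Dy).
- apply: (@continuous_near (fun w => dx g w / f w - g w * dx f w / f w ^+ 2)).
    by exists d => // w /dP /E [-> _].
  exact: continuous_sub (continuous_mul cgx cV) (continuous_mul (continuous_mul cgz cx) cV2).
- apply: (@continuous_near (fun w => dy g w / f w - g w * dy f w / f w ^+ 2)).
    by exists d => // w /dP /E [_ ->].
  exact: continuous_sub (continuous_mul cgy cV) (continuous_mul (continuous_mul cgz cy) cV2).
Qed.

Lemma C2_on_ln W f : open W -> (forall z, W z -> 0 < f z) ->
  (forall z, W z -> {for z, continuous f}) -> C2_on W f -> C2_on W (fun z => ln (f z)).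
Proof.
move=> oW f0 cf [C1 C1x C1y].
have [C1l E] := C1_on_ln oW f0 cf C1.
have f0' z : W z -> f z != 0 by move=> /f0 ?; rewrite gt_eqF.
split; first exact: C1l.
- have Q : C1_on W (fun z => dx f z / f z).
    apply: (C1_on_quot oW f0' cf _ C1 C1x) => z Wz; have [_ _ c _] := C1 z Wz; exact: c.
  have Eq z : W z -> dx f z / f z = dx (fun z => ln (f z)) z by move=> /E [-> _].
  exact: (C1_on_near oW Eq Q).1.
- have Q : C1_on W (fun z => dy f z / f z).
    apply: (C1_on_quot oW f0' cf _ C1 C1y) => z Wz; have [_ _ _ c] := C1 z Wz; exact: c.
  have Eq z : W z -> dy f z / f z = dy (fun z => ln (f z)) z by move=> /E [_ ->].
  exact: (C1_on_near oW Eq Q).1.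
Qed.

(** The first order part and the trace free part of the Hessian are real parts of
    complex polynomials in k; the trace is the Laplacian.  The increment is split
    into a vertical step from z and a horizontal step, each expanded in one
    variable, together with the change of the horizontal derivative along the
    vertical step. *)
Lemma C2_on_Taylor W u z : open W -> W z -> C2_on W u ->
  exists B D : R[i], forall e : R, 0 < e -> exists2 d : R, 0 < d & forall k : R[i], N k < d ->
    `|u (z + k) - u z - Re (B * k + D * k ^+ 2) - laplacian u z / 4 * N k ^+ 2| <= e * N k ^+ 2.
Proof.
move=> oW Wz [C1 C1x C1y].
pose uxx := dx (dx u) z; pose uxy := dy (dx u) z; pose uyy := dy (dy u) z.
exists (dx u z +i* - dy u z), (((uxx - uyy) / 4) +i* (- uxy / 2)) => e e0.
have [d0 d00 W0] := open_ball oW Wz.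
have [_ _ cxx cxy] := C1x z Wz; have [_ _ _ cyy] := C1y z Wz.
have e4 : 0 < e / 4 by rewrite divr_gt0.
have [d1 d10 X1] := (continuousC_R _ _).1 cxx _ e4.
have [d2 d20 X2] := (continuousC_R _ _).1 cxy _ e4.
have [d3 d30 X3] := (continuousC_R _ _).1 cyy _ e4.
pose d := Num.min (Num.min d0 d1) (Num.min d2 d3).
have dpos : 0 < d by rewrite /d !lt_min d00 d10 d20 d30.
exists (d / 2); first by rewrite divr_gt0.
move=> [s t]; set k := (s +i* t) => kd.
have hs := Re_le_N k; have ht := Im_le_N k; rewrite /= in hs ht.
have inb (a b : R) : `|a| <= `|s| -> `|b| <= `|t| -> N ((Re z + a) +i* (Im z + b) - z) < d.
  move=> ha hb; apply: le_lt_trans (N_le_ReIm _) _; rewrite ReCB ImCB /=.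
  rewrite addrAC subrr add0r addrAC subrr add0r; rewrite [d]splitr.
  by apply: ltr_leD; [exact: le_lt_trans (le_trans ha hs) kd|exact: le_trans (le_trans hb ht) (ltW kd)].
have inW (a b : R) : `|a| <= `|s| -> `|b| <= `|t| -> W ((Re z + a) +i* (Im z + b)).
  by move=> ha hb; apply: W0; apply: lt_le_trans (inb _ _ ha hb) _; rewrite !ge_min lexx.
have n0 (c : R) : `|0 : R| <= `|c| by rewrite normr0.
have zk : z + k = (Re z + s) +i* (Im z + t) by rewrite /k; case: (z).
have zt : z = Re z +i* Im z by rewrite ReImK.
pose y := Im z + t.
have S1 : `|u ((Re z + s) +i* y) - u (Re z +i* y) - s * dx u (Re z +i* y) - uxx / 2 * s ^+ 2| <= e / 4 * s ^+ 2.
  apply: (@second_order_bound _ (fun x => u (x +i* y)) (fun x => dx u (x +i* y)) (fun x => dx (dx u) (x +i* y))) => a ha.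
  - exact: (C1_on_is_derive C1 (inW a t ha (lexx _))).1.
  - exact: (C1_on_is_derive C1x (inW a t ha (lexx _))).1.
  - apply: ltW; apply: X1; apply: lt_le_trans (inb a t ha (lexx _)) _.
    by rewrite !ge_min lexx !orbT.
have W0t b : `|b| <= `|t| -> W (Re z +i* (Im z + b)).
  by move=> hb; have := inW 0 b (n0 _) hb; rewrite addr0.
have b0t b : `|b| <= `|t| -> N (Re z +i* (Im z + b) - z) < d.
  by move=> hb; have := inb 0 b (n0 _) hb; rewrite addr0.
have S2 : `|dx u (Re z +i* y) - dx u (Re z +i* Im z) - uxy * t| <= e / 4 * `|t|.
  pose G y := dx u (Re z +i* y) - uxy * (y - Im z).
  have -> : dx u (Re z +i* y) - dx u (Re z +i* Im z) - uxy * t = G (Im z + t) - G (Im z).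
    by rewrite /G /y; ring.
  apply: (@mean_value_bound _ G (fun y => dy (dx u) (Re z +i* y) - uxy)) => b hb.
    have D := (C1_on_is_derive C1x (W0t b hb)).2.
    exact: is_deriveB D (is_derive_linear uxy (Im z) (Im z + b)).
  apply: ltW; apply: X2; apply: lt_le_trans (b0t b hb) _.
  by rewrite !ge_min lexx !orbT.
have S3 : `|u (Re z +i* y) - u (Re z +i* Im z) - t * dy u (Re z +i* Im z) - uyy / 2 * t ^+ 2| <= e / 4 * t ^+ 2.
  apply: (@second_order_bound _ (fun x => u (Re z +i* x)) (fun x => dy u (Re z +i* x)) (fun x => dy (dy u) (Re z +i* x))) => a ha.
  - exact: (C1_on_is_derive C1 (W0t a ha)).2.
  - exact: (C1_on_is_derive C1y (W0t a ha)).2.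
  - apply: ltW; apply: X3; apply: lt_le_trans (b0t a ha) _.
    by rewrite !ge_min lexx !orbT.
rewrite zk -/y; rewrite ReImK in S2 S3.
have Nk : N k ^+ 2 = s ^+ 2 + t ^+ 2 by rewrite N_sqr.
rewrite Nk /k.
set E1 := u _ - _ - _ - _ in S1; set E2 := dx u _ - _ - _ in S2; set E3 := u _ - _ - _ - _ in S3.
have -> : u ((Re z + s) +i* y) - u z -
   Re ((dx u z +i* - dy u z) * (s +i* t) + (((uxx - uyy) / 4) +i* (- uxy / 2)) * (s +i* t) ^+ 2) -
   laplacian u z / 4 * (s ^+ 2 + t ^+ 2) = E1 + s * E2 + E3.
  rewrite /E1 /E2 /E3 /laplacian -/uxx -/uyy expr2 !(ReCD, ReCM, ImCM) /=.
  by field.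
have S2' : `|s * E2| <= e / 4 * (`|s| * `|t|).
  by rewrite normrM mulrCA ler_wpM2l.
have st : `|s| * `|t| <= s ^+ 2 + t ^+ 2.
  rewrite -(real_normK (num_real s)) -(real_normK (num_real t)).
  by have := sqr_ge0 (`|s| - `|t|); have := sqr_ge0 `|s|; have := sqr_ge0 `|t|; clear; nra.
have st' := ler_wpM2l (ltW e4) st.
have := ler_normD (E1 + s * E2) E3; have := ler_normD E1 (s * E2).
have P0 : 0 <= e / 4 * (s ^+ 2 + t ^+ 2) by rewrite mulr_ge0 ?(ltW e4)// addr_ge0 ?sqr_ge0.
by move: S1 S2' S3 st' P0; clear; lra.
Qed.

End PlaneTaylor.

(** * The curvature bound as a comparison principle *)
Section Comparison.
Context {R : realType}.
Local Notation C := (R[i]).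
Local Notation Re := (@complex.Re R).
Local Notation Im := (@complex.Im R).

(** Room for the two small errors in [curvature_comparison]: in the Taylor expansion of
    the logarithm of the density and in the linear approximation of the map. *)
Lemma strict_gap (A a d : R) : 0 < A -> 0 < a -> d < A * a ^+ 2 ->
  exists e k : R, [/\ 0 < e, e < a, e < A, 0 < k & d + k <= (A - e) * (a - e) ^+ 2].
Proof.
move=> A0 a0 dA; pose g := A * a ^+ 2 - d; have g0 : 0 < g by rewrite subr_gt0.
pose B := a ^+ 2 + 2 * a * A.
have B0 : 0 < B by rewrite /B addr_gt0 ?exprn_gt0// !mulr_gt0.
pose e := Num.min (Num.min (a / 2) (A / 2)) (g / 2 / B).
have e0 : 0 < e by rewrite /e !lt_min !divr_gt0.
have ea : e <= a / 2 by rewrite /e !ge_min lexx.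
have eA : e <= A / 2 by rewrite /e !ge_min lexx orbT.
have eB : e * B <= g / 2 by rewrite -ler_pdivlMr// /e ge_min lexx orbT.
exists e, (g / 2); split=> //; first by lra.
- by lra.
- by rewrite divr_gt0.
have H : (A - e) * (a ^+ 2 - 2 * a * e) <= (A - e) * (a - e) ^+ 2.
  apply: ler_wpM2l; first by lra.
  by have := sqr_ge0 e; clear; nra.
apply: le_trans H; have := mulr_ge0 (ltW a0) (sqr_ge0 e).
by rewrite /B /g in eB *; clear -eB; nra.
Qed.

(** Curvature at most -4 at the point phi w0 forces every function
    exp(Re(b h + c h^2) + d |h|^2) which dominates the pulled back density near w0
    (normalised at w0) to have d at least the square of that density, although the
    pulled back density is not differentiated.  With k(h) = phi(w0 + h) - phi(w0),
    Taylor's formula bounds log f from below by its value, plus Re(B k + Q k^2),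
    plus (D - e) |k|^2, where D >= f^2 by the curvature bound.  If d were smaller
    than D |phi'|^2, the modulus of exp(B k + Q k^2 - b h - c h^2) phi'(w0 + h) would
    be smaller on a circle |h| = r than for h = 0. *)
Lemma curvature_comparison (W : set (Cplx R)) (f : Cplx R -> R) (phi phi' : C -> C)
    (w0 b c : C) (R0 d : R) :
  open W -> W (phi w0) -> (forall z, W z -> 0 < f z) ->
  (forall z, W z -> {for z, continuous f}) -> C2_on W f ->
  gauss_curvature f (phi w0) <= -4 ->
  0 < R0 -> (forall w, N (w - w0) < R0 -> cderiv phi w (phi' w)) -> phi' w0 != 0 ->
  (exists2 delta : R, 0 < delta & forall h, N h < delta ->
     f (phi (w0 + h)) * N (phi' (w0 + h)) <=
     f (phi w0) * N (phi' w0) * expR (Re (b * h + c * h ^+ 2) + d * N h ^+ 2)) ->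
  (f (phi w0) * N (phi' w0)) ^+ 2 <= d.
Proof.
move=> oW Wz f0 cf C2 curv R00 dphi phi'0 [d1 d10 up].
set z0 := phi w0 in Wz curv up *; set a := N (phi' w0) in up *.
pose u z := ln (f z).
have C2u : C2_on W u by exact: C2_on_ln.
pose D := laplacian u z0 / 4.
have fz0 : 0 < f z0 := f0 _ Wz.
have a0 : 0 < a by rewrite N_gt0.
have Df : f z0 ^+ 2 <= D.
  have f2 : 0 < f z0 ^+ 2 by rewrite exprn_gt0.
  move: curv; rewrite /gauss_curvature mulNr lerN2 ler_pdivlMr//.
  by rewrite /D -/u ler_pdivlMr// mulrC.
rewrite leNgt; apply/negP; rewrite exprMn => dlt.
have D0 : 0 < D by apply: lt_le_trans Df; rewrite exprn_gt0.
have dlt' : d < D * a ^+ 2 by apply: lt_le_trans dlt _; rewrite ler_wpM2r// sqr_ge0.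
have [e [k [e0 ea eD k0 gap]]] := strict_gap D0 a0 dlt'.
have [B [Q tay]] := C2_on_Taylor oW Wz C2u.
have [d2 d20 T] := tay e e0.
have dphi0 : cderiv phi w0 (phi' w0) by apply: dphi; rewrite subrr N0.
have [d3 d30 P3] := dphi0 e e0.
have [d4 d40 P4] := cderiv_continuous dphi0 d20.
have [d5 d50 W5] := open_ball oW Wz.
have [d6 d60 P6] := cderiv_continuous dphi0 d50.
pose kk h := phi (w0 + h) - z0.
pose H h := cexp (B * kk h + Q * kk h ^+ 2 - (b * h + c * h ^+ 2)).
have dphi' h : N h < R0 -> cderiv (fun h => phi (w0 + h)) h (phi' (w0 + h)).
  move=> hR; rewrite (_ : phi' (w0 + h) = phi' (w0 + h) * (0 + 1)); last by rewrite add0r mulr1.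
  apply: (@cderiv_comp _ phi (fun x => w0 + x)).
    exact: cderivD (cderiv_cst _ _) (cderiv_id _).
  by apply: dphi; rewrite addrC addKr.
have dH h : N h < R0 -> exists y, cderiv H h y.
  move=> hR; have Dk := cderivB (dphi' h hR) (cderiv_cst z0 h).
  have D1 := cderivM (cderiv_cst B h) Dk.
  have D2 := cderivM (cderiv_cst Q h) (cderivM Dk Dk).
  have D3 := cderivM (cderiv_cst b h) (cderiv_id h).
  have D4 := cderivM (cderiv_cst c h) (cderivM (cderiv_id h) (cderiv_id h)).
  by eexists; exact: (cderiv_comp (cderivB (cderivD D1 D2) (cderivD D3 D4)) (cderiv_cexp _)).
have [rho rho0 MP] := max_principle_derivative R00 dphi' dH.
(* A radius for which all of the local estimates are available. *)
pose r := Num.min (Num.min (rho / 2) (d1 / 2)) (Num.min (Num.min (d3 / 2) (d4 / 2)) (d6 / 2)).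
have r0 : 0 < r by rewrite /r !lt_min !divr_gt0.
have rr x : 0 < x -> r <= x / 2 -> r < x by move=> x0 rx; clear -x0 rx; lra.
have r1 : r < rho by apply: rr => //; rewrite /r !ge_min lexx.
have r2 : r < d1 by apply: rr => //; rewrite /r !ge_min lexx !orbT.
have r3 : r < d3 by apply: rr => //; rewrite /r !ge_min lexx !orbT.
have r4 : r < d4 by apply: rr => //; rewrite /r !ge_min lexx !orbT.
have r6 : r < d6 by apply: rr => //; rewrite /r !ge_min lexx !orbT.
have k0E : kk 0 = 0 by rewrite /kk addr0 subrr.
have := MP r (a * expR (- (k * r ^+ 2))) r0 r1.
rewrite {2}/H k0E !expr2 !mulr0 addr0 subrr cexp0 mul1r addr0 -/a => MP1.
suff : a <= a * expR (- (k * r ^+ 2)).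
  rewrite -{1}[a]mulr1 ler_pM2l// leNgt => /negP; apply.
  by rewrite expR_lt1 oppr_lt0 mulr_gt0// exprn_gt0.
rewrite {1}expr2; apply: MP1 => h hr.
have hk : N (kk h) < d2 by apply: P4; rewrite hr.
have Wk : W (phi (w0 + h)) by apply: W5; rewrite -/(kk h); apply: P6; rewrite hr.
have lowk : (a - e) * r <= N (kk h).
  have := P3 h; rewrite hr => /(_ r3) => X.
  have := NB_ge (phi' w0 * h) (- (kk h - phi' w0 * h)).
  rewrite opprK NN [phi' w0 * h + _]addrC subrK NM -/a hr /kk mulrBl; rewrite -/z0 in X.
  by move: X; clear; lra.
have Tk := T (kk h) hk; rewrite /kk subrKC -/(kk h) in Tk.
have {}up := up h; rewrite hr in up; have {}up := up r2.
rewrite NM N_cexp ReCB.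
have fk : f (phi (w0 + h)) = expR (u (phi (w0 + h))) by rewrite /u lnK// posrE f0.
have fz : f z0 = expR (u z0) by rewrite /u lnK// posrE.
set X := Re (B * kk h + _) in Tk *; set Y := Re (b * h + _) in up *.
(* Taylor's formula at the image point; on the circle its quadratic term is at
   least (D - e) (a - e)^2 r^2. *)
have low : u z0 + X + (D - e) * N (kk h) ^+ 2 <= u (phi (w0 + h)).
  move: Tk; rewrite ler_norml => /andP[+ _]; rewrite -/D; clear; lra.
have kk2 : (d + k) * r ^+ 2 <= (D - e) * N (kk h) ^+ 2.
  apply: (@le_trans _ _ ((D - e) * ((a - e) * r) ^+ 2)).
    by rewrite [leRHS](_ : _ = (D - e) * (a - e) ^+ 2 * r ^+ 2) ?ler_wpM2r ?sqr_ge0//; ring.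
  rewrite ler_wpM2l ?subr_ge0 ?(ltW eD)// ler_pXn2r ?nnegrE ?N_ge0//.
  by apply: mulr_ge0; [rewrite subr_ge0 ltW|exact: ltW].
rewrite -(ler_pM2l fz0).
apply: (@le_trans _ _ (expR (- Y - d * r ^+ 2 - k * r ^+ 2) * (f (phi (w0 + h)) * N (phi' (w0 + h))))).
  rewrite 2!mulrA ler_wpM2r ?N_ge0// fk fz -!expRD ler_expR.
  by move: low kk2; clear; lra.
apply: (le_trans (ler_wpM2l (expR_ge0 _) up)).
rewrite le_eqVlt; apply/orP; left; apply/eqP.
rewrite mulrC -!mulrA -!expRD; congr (_ * (_ * expR _)).
by ring.
Qed.

End Comparison.

(** * Charts of the sphere and pullbacks of pseudometrics *)
Section PlaneTopology.
Context {R : realType}.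
Local Notation C := (Cplx R).
Local Notation Re := (@complex.Re R).
Local Notation Im := (@complex.Im R).

Lemma N_continuous : continuous (fun w : C => N w : R).
Proof.
move=> w; apply/continuousC_R => e e0; exists e => // x xw.
exact: le_lt_trans (N_dist _ _) xw.
Qed.

Lemma compact_closed_disk (M : R) : compact [set w : C | N w <= M].
Proof.
pose g (v : 'rV[R]_2) : C := v ord0 ord0 +i* v ord0 ord_max.
have cg : continuous g.
  move=> v; apply/continuous_N => e e0.
  have e2 : 0 < e / 2 by rewrite divr_gt0.
  have c1 := @coord_continuous R 1 2 ord0 ord0 v.
  have c2 := @coord_continuous R 1 2 ord0 ord_max v.
  move: c1 c2 => /cvgrPdist_lt /(_ _ e2) c1 /cvgrPdist_lt /(_ _ e2) c2.
  apply: filterS2 c1 c2 => w h1 h2; apply: le_lt_trans (N_le_ReIm _) _.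
  by rewrite ReCB ImCB /= [e]splitr ltrD// distrC.
have cB : compact [set v : 'rV[R]_2 | forall i, `[- M, M]%classic (v ord0 i)].
  by apply: (@rV_compact R 2 (fun=> `[- M, M]%classic)) => i; exact: segment_compact.
have cI : compact (g @` [set v : 'rV[R]_2 | forall i, `[- M, M]%classic (v ord0 i)]).
  by apply: continuous_compact => //; exact: continuous_subspaceT.
apply: subclosed_compact cI _; last first.
  move=> w /= wM; exists (\row_(i < 2) (if i == ord0 then Re w else Im w)).
    move=> i /=; rewrite mxE in_itv/=.
    have h1 := le_trans (Re_le_N w) wM; have h2 := le_trans (Im_le_N w) wM.
    by case: ifP => _; rewrite -ler_norml.
  by rewrite /g !mxE /= ReImK.
rewrite -[X in closed X]setCK; apply: open_closedC.
rewrite openE => w /= /negP; rewrite -ltNge => Mw.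
apply/nbhs_N; exists (N w - M); first by rewrite subr_gt0.
move=> x xw /=; apply/negP; rewrite -ltNge.
have := NB_ge w (w - x); rewrite opprB subrKC NBC; lra.
Qed.

Lemma closed_closed_disk (M : R) : closed [set w : C | N w <= M].
Proof. by apply: compact_closed; [exact: norm_hausdorff|exact: compact_closed_disk]. Qed.

Lemma compact_N_bounded (K : set C) : compact K -> exists2 M : R, 0 < M & forall w, K w -> N w <= M.
Proof.
move=> cK; have : compact ((fun w : C => N w) @` K).
  apply: continuous_compact => //; apply: continuous_subspaceT; exact: N_continuous.
move=> /compact_bounded [M [_ HM]]; exists (`|M| + 1); first by rewrite ltr_wpDl.
move=> w Kw; have := HM (`|M| + 1) _ (N w) (ex_intro2 _ _ w Kw erefl).
rewrite /= (ger0_norm (N_ge0 w)); apply.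
by rewrite (le_lt_trans (ler_norm _))// ltrDl.
Qed.

(** With inner radius 0 this is a closed disk. *)
Lemma max_on_annulus (f : C -> R) (rho r : R) : 0 <= rho -> rho <= r ->
  (forall w, rho <= N w -> N w <= r -> {for w, continuous f}) ->
  exists w0, [/\ rho <= N w0, N w0 <= r & forall w, rho <= N w -> N w <= r -> f w <= f w0].
Proof.
move=> rho0 rr cf; pose A := [set w : C | rho <= N w /\ N w <= r].
have ne : A !=set0.
  exists (r%:C : C); have E : N (r%:C : R[i]) = r by rewrite NReal ger0_norm// (le_trans rho0 rr).
  by split; rewrite E.
have clA : closed A.
  have -> : A = ~` [set w : C | N w < rho] `&` [set w : C | N w <= r].
    by apply/seteqP; split=> w /= [h1 h2]; split=> //; [apply/negP; rewrite -leNgt|rewrite leNgt; apply/negP].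
  apply: closedI; last exact: closed_closed_disk.
  apply: open_closedC.
  rewrite openE => w /= wr; apply/nbhs_N; exists (rho - N w); first by rewrite subr_gt0.
  by move=> x xw /=; have := N_dist x w; rewrite ler_norml => /andP[_]; lra.
have cA : compact A by apply: (subclosed_compact clA (@compact_closed_disk r)) => w [].
have [|c] := @compact_EVT_max C R f A ne cA.
  by apply: continuous_in_subspaceT => w; rewrite inE => -[h1 h2]; exact: cf.
rewrite inE => -[c1 c2] H; exists c; split=> // w w1 w2; apply: H; by rewrite inE.
Qed.

End PlaneTopology.

Section Charts.
Context {R : realType}.
Local Notation C := (Cplx R).
Local Notation S := (Sphere R).
Local Notation Re := (@complex.Re R).
Local Notation Im := (@complex.Im R).

Lemma nbhs_Some (z : C) (e : R) : 0 < e ->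
  nbhs (Some z : S) [set q | exists2 x : C, q = Some x & N (x - z) < e].
Proof.
move=> e0; have : nbhs (z : C) [set x | N (x - z) < e] by apply/nbhs_N; exists e.
move=> /one_point_compactification_some_nbhs; apply: filterS => q [x /= xz <-].
by exists x.
Qed.

Lemma nbhs_None (M : R) :
  nbhs (None : S) [set q | q = None \/ exists2 x : C, q = Some x & M < N x].
Proof.
exists [set w : C | N w <= M]; first by split; [exact: compact_closed_disk|exact: closed_closed_disk].
move=> q [[x /= /negP xM <-]|->]; last by left.
by right; exists x => //; rewrite ltNge.
Qed.

Definition in_chart (c : chart) (q : S) : Prop := from_chart c (to_chart c q) = q.

Lemma from_chartK c (w : C) : to_chart c (from_chart c w) = w.
Proof.
case: c => //=; case: eqVneq => [->//|w0] /=; exact: invrK.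
Qed.

Lemma in_chart_from c (w : C) : in_chart c (from_chart c w).
Proof. by rewrite /in_chart from_chartK. Qed.

Lemma in_chart_at (q : S) : in_chart (chart_at q) q.
Proof. by case: q => [w|] //; rewrite /in_chart /= eqxx. Qed.

Lemma in_affine_chart (q : S) : in_chart Affine q -> exists w : C, q = Some w.
Proof. by case: q => // w _; exists w. Qed.

Lemma in_infinite_chart (q : S) : in_chart AtInfinity q ->
  q = None \/ exists2 w : C, w != 0 & q = Some w.
Proof.
case: q => [w|]; last by left.
rewrite /in_chart /= invr_eq0; case: eqVneq => // w0 _; right; by exists w.
Qed.

Lemma in_infinite_chartI (w : C) : w != 0 -> in_chart AtInfinity (Some w).
Proof. by move=> w0; rewrite /in_chart /= invr_eq0 (negbTE w0) invrK. Qed.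

Lemma in_chart_near c (q : S) : in_chart c q -> nbhs q (in_chart c).
Proof.
case: c.
  move=> /in_affine_chart [z ->].
  by have := nbhs_Some z ltr01; apply: filterS => _ [x -> _].
move=> /in_infinite_chart [->|[z z0 ->]].
  have := nbhs_None 0; apply: filterS => _ [->|[x -> x0]]; first by rewrite /in_chart /= eqxx.
  by apply: in_infinite_chartI; rewrite -N_gt0.
have := @nbhs_Some z (N z); rewrite N_gt0 => /(_ z0); apply: filterS => _ [x -> xz].
apply: in_infinite_chartI; rewrite -N_gt0.
by have := NB_ge z (z - x); rewrite opprB subrKC NBC; lra.
Qed.

Lemma from_chart_continuous c : continuous (from_chart c : C -> S).
Proof.
case: c => w; first exact: one_point_compactification_some_continuous.
have inv_cont (x : C) : x != 0 -> {for x, continuous (fun y : C => (y^-1 : C))}.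
  move=> x0; apply/continuous_N => e e0.
  have [d d0 dP] := cderiv_continuous (cderivV x0) e0.
  apply/nbhs_N; exists d => // y yx; rewrite -[y](subrKC x); exact: dP.
have [->|w0] := eqVneq w 0; last first.
  have cS : {for w, continuous (fun y : C => (Some (y^-1) : S))}.
    move=> P nP; exact: (inv_cont w w0 _ nP).
  move=> P; rewrite /= (negbTE w0) => /cS; rewrite /nbhs /=.
  move=> /nbhs_N [d d0 dP]; apply/nbhs_N; exists (Num.min d (N w)).
    by rewrite lt_min d0 N_gt0.
  move=> y; rewrite lt_min => /andP[yd yw].
  have y0 : y != 0.
    by rewrite -N_gt0; have := NB_ge w (w - y); rewrite opprB subrKC NBC; lra.
  by rewrite /= (negbTE y0); exact: dP.
move=> P; rewrite /= eqxx => -[K [cK _] KP].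
have [M M0 HM] := compact_N_bounded cK.
apply/nbhs_N; exists M^-1; first by rewrite invr_gt0.
move=> y; rewrite subr0 => yM /=; apply: KP; case: eqVneq => [_|y0]; first by right.
left; exists y^-1 => //= Ky; have := HM _ Ky; rewrite NV.
rewrite -[M in _ <= M]invrK lef_pV2 ?posrE ?invr_gt0 ?N_gt0// leNgt => /negP; exact.
Qed.

Lemma open_chart_preimage c (Omega : set S) : open Omega -> open (from_chart c @^-1` Omega).
Proof. move=> oO; apply: open_comp => // x _; exact: from_chart_continuous. Qed.

Lemma to_chart_continuous c (q : S) : in_chart c q -> {for q, continuous (to_chart c : S -> C)}.
Proof.
case: c.
  move=> /in_affine_chart [z ->]; apply/continuous_N => e e0.
  by have := nbhs_Some z e0; apply: filterS => _ [x -> xz].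
move=> /in_infinite_chart [->|[z z0 ->]]; apply/continuous_N => e e0.
  have := nbhs_None (e^-1); apply: filterS => _ [->|[x -> ex]].
    by rewrite subrr N0.
  have x0 : 0 < N x by apply: lt_trans ex; rewrite invr_gt0.
  by rewrite -[X in N X]/(x^-1 - 0) subr0 NV -[e]invrK ltf_pV2 ?posrE ?invr_gt0.
have [d d0 dP] := cderiv_continuous (cderivV z0) e0.
have := nbhs_Some z d0; apply: filterS => _ [x -> xz] /=.
by rewrite -[x](subrKC z); exact: dP.
Qed.

(** Unlike [local_expr], in a chart which does not depend on the point, so that the
    expressions at neighbouring points are the same function. *)
Definition chart_expr (T : Type) (c : chart) (F : T -> S) : T -> C := fun w => to_chart c (F w).

(** For a finite nonzero value in the chart at infinity the local expression is the
    inverse of the chart expression; the factor |z|^-2 by which the derivatives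
    differ is the one in the transformation rule for the density. *)
Lemma holomorphic_chart_derivative (D : set C) (F : C -> S) c (w : C) :
  holomorphic_on D F -> D w -> in_chart c (F w) ->
  exists2 a : R[i], cderiv (chart_expr c F) w a &
    forall lam : S -> R, pullback F lam w = density lam c (chart_expr c F w) * N a.
Proof.
move=> holF Dw cF; have [_ dF] := holF w Dw.
have E : cderiv (local_expr F w) w ('D_1 (local_expr F w : C -> C) w).
  by apply/cderiv_is_derive; exact: DeriveDef.
move: dF E; rewrite /pullback; set a := ('D_(1 : C) (local_expr F w : C -> C) w); move=> dF E.
have LE : local_expr F w = chart_expr (chart_at (F w)) F by [].
rewrite {}LE in E; case: c cF => [/in_affine_chart|/in_infinite_chart [|]].
- move=> [z Fz]; rewrite Fz /= in E; exists a => // lam.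
  by rewrite /chart_expr Fz.
- move=> Fz; rewrite Fz /= in E; exists a => // lam.
  by rewrite /chart_expr Fz /= eqxx.
move=> [z z0 Fz]; rewrite Fz /= in E.
have inv : chart_expr AtInfinity F = fun x => (chart_expr Affine F x)^-1.
  by apply/funext => x; rewrite /chart_expr; case: (F x) => //=; rewrite invr0.
have V : cderiv (chart_expr AtInfinity F) w (- z^-1 ^+ 2 * a).
  rewrite inv; apply: (cderiv_comp (f := fun x : R[i] => x^-1) E).
  by rewrite /chart_expr Fz; exact: cderivV.
exists (- z^-1 ^+ 2 * a) => // lam.
rewrite /chart_expr Fz /= invr_eq0 (negbTE z0) invrK NM NN NX.
by rewrite mulrA divfK// expf_neq0// NV invr_eq0 N_eq0.
Qed.

Definition chart_deriv c (F : C -> S) (w : C) : R[i] := 'D_1 (chart_expr c F : C -> C) w.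

Lemma holomorphic_chart (D : set C) (F : C -> S) c (z : C) :
  open D -> holomorphic_on D F -> D z -> in_chart c (F z) ->
  exists2 r : R, 0 < r & forall w, N (w - z) < r ->
    [/\ D w, in_chart c (F w), cderiv (chart_expr c F) w (chart_deriv c F w) &
     forall lam : S -> R, pullback F lam w = density lam c (chart_expr c F w) * N (chart_deriv c F w)].
Proof.
move=> oD holF Dz cz.
have [r1 r10 P1] := open_ball oD Dz.
have [cF _] := holF z Dz.
have /nbhs_N [r2 r20 P2] : nbhs z [set w | in_chart c (F w)].
  by apply: cF; exact: in_chart_near.
exists (Num.min r1 r2); first by rewrite lt_min r10.
move=> w; rewrite lt_min => /andP[/P1 Dw /P2 cw].
have [a da ha] := holomorphic_chart_derivative holF Dw cw.
suff -> : chart_deriv c F w = a by split.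
rewrite /chart_deriv; have /cderiv_is_derive da' := da.
exact: (@derive_val _ _ _ _ _ _ _ da').
Qed.

Lemma holomorphic_chart_deriv_continuous (D : set C) (F : C -> S) c (z : C) :
  open D -> holomorphic_on D F -> D z -> in_chart c (F z) ->
  {for z, continuous (fun w => N (chart_deriv c F w))}.
Proof.
move=> oD holF Dz cz; have [r r0 P] := holomorphic_chart oD holF Dz cz.
have [rho [K [rho0 _ K0 lip _]]] := @derivative_locally_Lipschitz R (chart_expr c F) (chart_deriv c F) z r r0
  ltac:(by move=> w /P []).
apply/continuousC_R => e e0.
have K1 : 0 < K + 1 by rewrite ltr_wpDl.
exists (Num.min rho (e / (K + 1))); first by rewrite lt_min rho0 divr_gt0.
move=> w; rewrite lt_min ltr_pdivlMr// => /andP[h1 h2].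
have := lip z w; rewrite subrr N0 => /(_ rho0 h1) L.
apply: (@le_lt_trans _ _ (K * N (w - z))); last first.
  by apply: le_lt_trans h2; rewrite mulrDr mulr1 mulrC lerDl N_ge0.
exact: le_trans (N_dist _ _) L.
Qed.

Lemma pullback_continuous (D : set C) (F : C -> S) Omega (lam : S -> R) (z : C) :
  open D -> holomorphic_on D F -> (forall w, D w -> Omega (F w)) ->
  conformal_pseudometric Omega lam -> D z ->
  {for z, continuous (pullback F lam)}.
Proof.
move=> oD holF FO psm Dz; pose c := chart_at (F z).
have cz : in_chart c (F z) := in_chart_at _.
have [r r0 P] := holomorphic_chart oD holF Dz cz.
apply: (@continuous_near _ (fun w => density lam c (chart_expr c F w) * N (chart_deriv c F w))).
  exists r; first exact: r0.
  move=> w wr; have [_ _ _ H] := P w wr; exact: esym (H lam).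
apply: continuous_mul; last exact: (holomorphic_chart_deriv_continuous oD holF Dz cz).
have [_ cd _] := psm c.
have Uz : (from_chart c @^-1` Omega) (chart_expr c F z) by rewrite /= cz; exact: FO.
have [cF _] := holF z Dz.
have c1 : {for z, continuous (chart_expr c F : C -> C)}.
  by apply: continuous_comp cF _; exact: to_chart_continuous.
by apply: continuous_comp c1 _; exact: cd.
Qed.

(** The comparison principle on the sphere, read in the chart adapted to the value
    F z, on the set where the density is positive. *)
Lemma pullback_curvature (D : set C) (F : C -> S) Omega (lam : S -> R) (z b c : C) (d : R) :
  open D -> open Omega -> holomorphic_on D F -> (forall w, D w -> Omega (F w)) ->
  conformal_pseudometric Omega lam -> curvature_le Omega lam (-4) -> D z ->
  0 < pullback F lam z ->
  (exists2 delta : R, 0 < delta & forall h : C, N h < delta ->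
     pullback F lam (z + h) <= pullback F lam z * expR (Re (b * h + c * h ^+ 2) + d * N h ^+ 2)) ->
  pullback F lam z ^+ 2 <= d.
Proof.
move=> oD oO holF FO psm curv Dz pz [delta delta0 up]; pose ch := chart_at (F z).
have cz : in_chart ch (F z) := in_chart_at _.
have [r r0 P] := holomorphic_chart oD holF Dz cz.
have [_ _ _ PE] := P z ltac:(rewrite subrr N0//).
rewrite (PE lam) in pz *.
set f := density lam ch in pz *; set phi := chart_expr ch F in pz *; set phi' := chart_deriv ch F in pz *.
pose U := from_chart ch @^-1` Omega.
have oU : open U by exact: open_chart_preimage.
have [f0 fc fC2] := psm ch.
pose W := U `&` [set w | 0 < f w].
have Uz : U (phi z) by rewrite /U /= [from_chart _ _]cz; exact: FO.
have fz : 0 < f (phi z).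
  rewrite lt_neqAle f0// andbT; apply/eqP => E.
  by move: pz; rewrite -E mul0r ltxx.
have oW : open W.
  rewrite openE => x [Ux fx]; have /continuousC_R /(_ _ fx) [e e0 eP] := fc x Ux.
  have [e1 e10 e1P] := open_ball oU Ux.
  apply/nbhs_N; exists (Num.min e e1); first by rewrite lt_min e0.
  move=> y; rewrite lt_min => /andP[/eP h1 /e1P h2]; split=> //=.
  by move: h1; rewrite -/f ltr_norml => /andP[+ _]; lra.
apply: (@curvature_comparison _ W f phi phi' z b c r) => //.
- by move=> x [].
- by move=> x [Ux _]; exact: fc.
- by apply: curv => //; exact: Uz.
- by move=> w /P [].
- by apply/eqP => E; move: pz; rewrite E N0 mulr0 ltxx.
exists (Num.min delta r); first by rewrite lt_min delta0.
move=> h; rewrite lt_min => /andP[/up h1 h2].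
by have [_ _ _ PEh] := P (z + h) ltac:(rewrite addrC addKr//); rewrite (PEh lam) (PE lam) in h1.
Qed.

End Charts.

(** * Ahlfors' lemma and its boundary version on the disk *)
Section RadialJet.
Context {R : realType}.
Local Notation C := (Cplx R).
Local Notation Re := (@complex.Re R).
Local Notation Im := (@complex.Im R).

Lemma second_jet (phi phi1 : R -> R) (s0 phi2 r : R) : 0 < r ->
  (forall s, `|s - s0| < r -> is_derive s 1 phi (phi1 s)) -> is_derive s0 1 phi1 phi2 ->
  forall e, 0 < e -> exists2 d, 0 < d & forall x, `|x| < d ->
    `|phi (s0 + x) - phi s0 - x * phi1 s0 - phi2 / 2 * x ^+ 2| <= e * x ^+ 2.
Proof.
move=> r0 dphi dphi1 e e0; have [d d0 dP] := (is_derive_eps _ _ _).1 dphi1 e e0.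
exists (Num.min d r); first by rewrite lt_min d0.
move=> x; rewrite lt_min => /andP[xd xr].
apply: integrate_linear_bound => t tx.
  by apply: dphi; rewrite addrC addKr; exact: le_lt_trans tx xr.
by apply: le_trans (dP t (le_lt_trans tx xd)) _; rewrite ler_wpM2l// ltW.
Qed.

Lemma N_sqrD (w h : R[i]) : N (w + h) ^+ 2 = N w ^+ 2 + (2 * Re (w^* * h) + N h ^+ 2).
Proof. case: w h => [a b] [c d]; rewrite !N_sqr /=; ring. Qed.

Lemma Re_sqr (a : R[i]) : Re a ^+ 2 = (N a ^+ 2 + Re (a ^+ 2)) / 2.
Proof. by case: a => a b; rewrite N_sqr expr2 /=; field. Qed.

(** The coefficient of |h|^2 is phi' + |w|^2 phi'', a quarter of the Laplacian of the
    function phi(|w|^2).  The other second order terms form the real part of a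
    complex polynomial because (Re a)^2 = (|a|^2 + Re a^2) / 2. *)
Lemma radial_jet (phi phi1 : R -> R) (phi2 r : R) (w : R[i]) : 0 < r ->
  (forall s, `|s - N w ^+ 2| < r -> is_derive s 1 phi (phi1 s)) ->
  is_derive (N w ^+ 2) 1 phi1 phi2 ->
  exists b c : R[i], forall e, 0 < e -> exists2 d, 0 < d & forall h, N h < d ->
    phi (N (w + h) ^+ 2) <= phi (N w ^+ 2) + (Re (b * h + c * h ^+ 2)
       + (phi1 (N w ^+ 2) + N w ^+ 2 * phi2 + e) * N h ^+ 2).
Proof.
move=> r0 dphi dphi1; set s0 := N w ^+ 2 in dphi dphi1 *.
exists ((2 * phi1 s0)%:C * w^*), (phi2%:C * (w^*) ^+ 2) => e e0.
pose K := 2 * N w + 1; have K0 : 0 < K by rewrite /K; have := N_ge0 w; lra.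
have e1 : 0 < e / 2 / K ^+ 2 by rewrite !divr_gt0// exprn_gt0.
have [d1 d10 P1] := second_jet r0 dphi dphi1 e1.
pose L := `|phi2| / 2 * (4 * N w + 1) + 1.
have L0 : 0 < L by rewrite /L ltr_wpDl// mulr_ge0 ?divr_ge0//; have := N_ge0 w; lra.
pose d := Num.min (Num.min 1 (d1 / K)) (e / 2 / L).
exists d; first by rewrite /d !lt_min ltr01 !divr_gt0.
move=> h; rewrite /d !lt_min !ltr_pdivlMr// => /andP[/andP[h1 h2] h3].
rewrite N_sqrD -/s0; set x := 2 * Re (w^* * h) + N h ^+ 2.
have Nw : N (w^*) = N w by case: (w) => a b /=; rewrite sqrrN.
have Reb : `|Re (w^* * h)| <= N w * N h by rewrite -Nw -NM Re_le_N.
have h0 := N_ge0 h; have w0 := N_ge0 w.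
have hh : N h ^+ 2 <= N h by rewrite expr2 ler_piMr// ltW.
have xK : `|x| <= K * N h.
  apply: le_trans (ler_normD _ _) _; rewrite normrM ger0_norm// [`|_ ^+ 2|]ger0_norm ?sqr_ge0//.
  by rewrite /K; move: Reb hh; clear; nra.
have xd : `|x| < d1 by apply: le_lt_trans xK _; rewrite mulrC.
have := P1 x xd; rewrite ler_norml => /andP[_ B].
have B2 : e / 2 / K ^+ 2 * x ^+ 2 <= e / 2 * N h ^+ 2.
  rewrite -mulrA ler_wpM2l ?divr_ge0 ?(ltW e0)// mulrC ler_pdivrMr ?exprn_gt0//.
  rewrite -exprMn [N h * K]mulrC -[x ^+ 2]real_normK ?num_real//.
  by rewrite ler_pXn2r ?nnegrE// mulr_ge0// ltW.
have X2 : phi2 / 2 * x ^+ 2 <= phi2 / 2 * (2 * Re (w^* * h)) ^+ 2 + e / 2 * N h ^+ 2.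
  set y := Re _ in Reb *.
  have -> : x ^+ 2 = (2 * y) ^+ 2 + N h ^+ 2 * (4 * y + N h ^+ 2) by rewrite /x -/y; ring.
  rewrite mulrDr lerD2l mulrCA mulrC ler_wpM2r ?sqr_ge0//.
  apply: le_trans (ler_norm _) _; rewrite normrM.
  have yb : `|4 * y + N h ^+ 2| <= (4 * N w + 1) * N h.
    apply: le_trans (ler_normD _ _) _; rewrite normrM ger0_norm// [`|_ ^+ 2|]ger0_norm ?sqr_ge0//.
    by move: Reb hh; clear; nra.
  apply: le_trans (ler_wpM2l (normr_ge0 _) yb) _.
  rewrite normrM [`|2^-1|]ger0_norm// mulrA.
  have h3' : N h * L <= e / 2 by move: h3; clear; lra.
  apply: le_trans h3'.
  by rewrite mulrC ler_wpM2l// /L lerDl.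
have -> : Re ((2 * phi1 s0)%:C * w^* * h + phi2%:C * (w^*) ^+ 2 * h ^+ 2) =
   phi1 s0 * (2 * Re (w^* * h)) + phi2 * Re ((w^* * h) ^+ 2).
  rewrite exprMn; case: (w) h {h1 h2 h3 x hh h0 Reb xK xd B B2 X2} => [a b] [c' d'].
  by rewrite !expr2 /=; ring.
have RS := Re_sqr (w^* * h); rewrite NM Nw exprMn -/s0 in RS.
have xE : x = 2 * Re (w^* * h) + N h ^+ 2 by [].
move: B B2 X2; rewrite exprMn RS.
have -> : x * phi1 s0 = 2 * Re (w^* * h) * phi1 s0 + N h ^+ 2 * phi1 s0 by rewrite /x mulrDl.
clear; lra.
Qed.

End RadialJet.

Section Disk.
Context {R : realType}.
Local Notation C := (Cplx R).
Local Notation Re := (@complex.Re R).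
Local Notation Im := (@complex.Im R).

(** The inequality (Laplacian of log l) >= 4 l^2 in the sense of viscosity
    solutions: it is imposed on the functions Re(b h + c h^2) + d |h|^2, whose
    Laplacian is 4 d, that touch log l from above up to an additive constant. *)
Definition conformal_subsolution (l : C -> R) : Prop :=
  [/\ forall z, N z < 1 -> 0 <= l z,
      forall z, N z < 1 -> {for z, continuous l} &
      forall (z b c : C) (d : R), N z < 1 -> 0 < l z ->
        (exists2 delta : R, 0 < delta & forall h : C, N h < delta ->
          l (z + h) <= l z * expR (Re (b * h + c * h ^+ 2) + d * N h ^+ 2)) ->
        l z ^+ 2 <= d].

(** A local maximum of log l - phi(|w|^2) means that phi(|w|^2) touches log l from
    above up to a constant, and [radial_jet] puts it into the admissible form. *)
Lemma local_max_bound (l : C -> R) (phi phi1 : R -> R) (phi2 r : R) (w : C) :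
  conformal_subsolution l -> N w < 1 -> 0 < l w -> 0 < r ->
  (forall s, `|s - N w ^+ 2| < r -> is_derive s 1 phi (phi1 s)) ->
  is_derive (N w ^+ 2) 1 phi1 phi2 ->
  (exists2 d : R, 0 < d & forall h : C, N h < d ->
    l (w + h) * expR (- phi (N (w + h) ^+ 2)) <= l w * expR (- phi (N w ^+ 2))) ->
  l w ^+ 2 <= phi1 (N w ^+ 2) + N w ^+ 2 * phi2.
Proof.
move=> [_ _ K] w1 lw r0 dphi dphi1 [d0 d00 maxw].
have [b [c J]] := radial_jet r0 dphi dphi1.
apply/ler_addgt0Pr => e e0; have [d d1 dP] := J e e0.
apply: (K w b c) => //; exists (Num.min d0 d); first by rewrite lt_min d00.
move=> h; rewrite lt_min => /andP[/maxw h1 /dP h2].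
rewrite -(ler_pM2r (expR_gt0 (- phi (N (w + h) ^+ 2)))).
apply: le_trans h1 _; rewrite -mulrA ler_pM2l// -expRD ler_expR.
move: h2; clear; lra.
Qed.

Lemma continuous_expR_comp (f : C -> R) (z : C) : {for z, continuous f} ->
  {for z, continuous (fun w => expR (f w))}.
Proof. by move=> cf; apply: continuous_comp cf _; exact: continuous_expR. Qed.

Lemma continuous_N_sqr (w : C) : {for w, continuous (fun w : C => N w ^+ 2)}.
Proof. have H := continuous_mul (@N_continuous R w) (@N_continuous R w); exact: H. Qed.

Arguments continuous_N_sqr w _ _ : clear implicits.
Lemma continuous_subN (t : R) (w : C) : {for w, continuous (fun w : C => t - N w ^+ 2)}.
Proof. have H := continuous_sub (continuous_const t w) (continuous_N_sqr w); exact: H. Qed.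

Arguments continuous_subN t w _ _ : clear implicits.

(** The function (t - |w|^2) l vanishes on the circle |w|^2 = t < 1 and so has an interior
    maximum on the disk, where [local_max_bound] yields l^2 <= t / (t - |w|^2)^2; then
    t tends to 1. *)
Lemma ahlfors (l : C -> R) (w : C) : conformal_subsolution l -> N w < 1 ->
  l w * (1 - N w ^+ 2) <= 1.
Proof.
move=> sub w1; have [l0 cl _] := sub.
have main t : N w ^+ 2 < t -> t < 1 -> l w * (t - N w ^+ 2) <= 1.
  move=> wt t1; have t0 : 0 < t by apply: le_lt_trans wt; rewrite sqr_ge0.
  pose r := Num.sqrt t.
  have r2 : r ^+ 2 = t by rewrite sqr_sqrtr// ltW.
  have r0 : 0 < r by rewrite sqrtr_gt0.
  have r1 : r < 1.
    by rewrite -(ltr_pXn2r (n := 2)) ?nnegrE ?(ltW r0)// r2 expr1n.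
  have wr : N w < r.
    by rewrite -(ltr_pXn2r (n := 2)) ?nnegrE ?(ltW r0) ?N_ge0// r2.
  pose g (w : C) := l w * (t - N w ^+ 2).
  have [|w0 [_ w0r H]] := @max_on_annulus _ g 0 r (lexx 0) (ltW r0).
    move=> x _ xr; have H := continuous_mul (cl x (le_lt_trans xr r1)) (continuous_subN t x); exact: H.
  apply: le_trans (H w (N_ge0 _) (ltW wr)) _; rewrite /g.
  have [gn|gp] := leP (g w0) 0; first exact: le_trans gn ler01.
  have w01 : N w0 < 1 by apply: le_lt_trans r1.
  have tw : 0 <= t - N w0 ^+ 2.
    by rewrite subr_ge0 -r2 ler_pXn2r ?nnegrE ?N_ge0// ltW.
  have lw0 : 0 < l w0.
    rewrite lt_neqAle l0// andbT; apply/eqP => E; move: gp; rewrite /g -E mul0r ltxx//.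
  have tw0 : 0 < t - N w0 ^+ 2 by move: gp; rewrite /g pmulr_rgt0.
  have w0r' : N w0 < r.
    by rewrite -(ltr_pXn2r (n := 2)) ?nnegrE ?(ltW r0) ?N_ge0// r2 -subr_gt0.
  pose phi (s : R) := - ln (t - s).
  have dts (s : R) : is_derive s 1 (fun s : R => t - s) (-1) by exact: is_derive_subl.
  have dphi s : `|s - N w0 ^+ 2| < t - N w0 ^+ 2 -> is_derive s 1 phi ((t - s)^-1).
    rewrite ltr_norml => /andP[_ hs]; have ts : 0 < t - s by lra.
    apply: is_derive_eq (is_deriveN (is_derive_ln (F := fun s => t - s) ts (dts s))) _.
    by rewrite mulN1r opprK.
  have dphi1 : is_derive (N w0 ^+ 2) 1 (fun s => (t - s)^-1) ((t - N w0 ^+ 2)^-1 ^+ 2).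
    have ts : t - N w0 ^+ 2 != 0 by rewrite gt_eqF.
    have D := @is_derive_quot _ (fun s => t - s) (fun=> 1) (N w0 ^+ 2) (-1) 0 ts (dts _) (is_derive_cst _ _ _).
    have -> : (fun s => (t - s)^-1) = (fun s => 1 / (t - s)) by apply/funext => s; rewrite div1r.
    apply: is_derive_eq D _; by field.
  have emphi s : 0 < t - s -> expR (- phi s) = t - s by move=> ?; rewrite opprK lnK.
  have LM : exists2 d : R, 0 < d & forall h : C, N h < d ->
      l (w0 + h) * expR (- phi (N (w0 + h) ^+ 2)) <= l w0 * expR (- phi (N w0 ^+ 2)).
    exists (r - N w0); first by rewrite subr_gt0.
    move=> h hr; have whr : N (w0 + h) < r by have := ND w0 h; lra.
    have tp : 0 < t - N (w0 + h) ^+ 2.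
      by rewrite subr_gt0 -r2 ltr_pXn2r ?nnegrE ?(ltW r0) ?N_ge0.
    rewrite !emphi//; apply: H; [exact: N_ge0|exact: ltW].
  have L := local_max_bound sub w01 lw0 tw0 dphi dphi1 LM.
  apply: (@le_trans _ _ r); last exact: ltW.
  rewrite -[leLHS]ger0_norm ?(ltW gp)// -(ler_pXn2r (n := 2)) ?nnegrE ?(ltW r0)//.
  rewrite real_normK ?num_real// exprMn -ler_pdivlMr ?exprn_gt0// r2.
  apply: le_trans L _; rewrite le_eqVlt; apply/orP; left; apply/eqP.
  by field; rewrite gt_eqF.
rewrite leNgt; apply/negP => L; set s := N w ^+ 2 in main L *.
have s1 : s < 1 by rewrite /s expr_lt1// N_ge0.
have lw : 0 < l w.
  rewrite lt_neqAle l0// andbT; apply/eqP => E; move: L; rewrite -E mul0r; lra.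
have ls : (l w)^-1 < 1 - s by rewrite invf_plt ?posrE ?subr_gt0// -[X in X < _]div1r ltr_pdivrMr ?subr_gt0.
have il : 0 < (l w)^-1 by rewrite invr_gt0.
(* If l (1 - s) > 1, then 1/l < 1 - s leaves room for some t < 1 with
   l (t - s) > 1: any t strictly between s + 1/l and 1. *)
have := main ((1 + (s + (l w)^-1)) / 2) ltac:(lra) ltac:(lra).
have -> : l w * ((1 + (s + (l w)^-1)) / 2 - s) = (l w * (1 - s) + 1) / 2.
  by field; rewrite gt_eqF.
lra.
Qed.

(** Let v = l (1 - |w|^2), s = |w|^2 and psi(s) = 1/s - 2 + s = (1 - s)^2 / s.  The
    heart is the claim v exp(c psi(s)) <= 1 on an annulus rho <= |w| < 1, from which
    1 - v >= 1 - exp(- c (1 - s)^2) follows.  It holds on the inner circle, where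
    v <= 1 - eta and c psi = eta, and near the outer one, where v <= 1 and psi tends
    to 0.  At an interior maximum with a value above 1, [local_max_bound] gives
    v^2 <= 1 - c (1 - s)^2 (1 + s^-2), whereas v^2 > exp(- 2 c psi) >= 1 - 2 c psi.
    Hence (1 - s)^2 (1 + s^-2) < 2 (1 - s)^2 / s, which is impossible since
    1 + s^-2 - 2 s^-1 is a square. *)
Lemma hopf (l : C -> R) : conformal_subsolution l -> l 0 < 1 ->
  exists2 k : R, 0 < k & forall w, N w < 1 ->
    k * (1 - N w ^+ 2) ^+ 2 <= 1 - l w * (1 - N w ^+ 2).
Proof.
move=> sub l01; have [l0 cl _] := sub.
pose v (w : C) := l w * (1 - N w ^+ 2).
have cv w : N w < 1 -> {for w, continuous v}.
  move=> w1; have H := continuous_mul (cl w w1) (continuous_subN 1 w); exact: H.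
pose eta := (1 - l 0) / 2; have eta0 : 0 < eta by rewrite /eta; lra.
have v0 : v 0 = l 0 by rewrite /v N0 expr0n subr0 mulr1.
have [d d0 dP] := (continuousC_R _ _).1 (cv 0 ltac:(rewrite N0//)) eta eta0.
pose rho := Num.min (d / 2) (2^-1).
have rho0 : 0 < rho by rewrite /rho lt_min; apply/andP; split; [rewrite divr_gt0|rewrite invr_gt0].
have rho1 : rho <= 2^-1 by rewrite /rho ge_min lexx orbT.
have rhod : rho < d by apply: (@le_lt_trans _ _ (d / 2)); rewrite ?ge_min ?lexx//; lra.
have veta w : N w <= rho -> v w <= 1 - eta.
  move=> wr; have := dP w; rewrite subr0 => /(_ (le_lt_trans wr rhod)).
  by rewrite v0 ltr_norml => /andP[_]; rewrite /eta; lra.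
pose psi (s : R) := s^-1 - 2 + s.
have psiE s : 0 < s -> psi s = (1 - s) ^+ 2 / s by move=> s0; rewrite /psi; field; rewrite gt_eqF.
have rho2 : 0 < rho ^+ 2 by rewrite exprn_gt0.
have rho21 : rho ^+ 2 < 1 by rewrite expr_lt1 ?ltW//; lra.
have psir : 0 < psi (rho ^+ 2) by rewrite psiE// divr_gt0// exprn_gt0// subr_gt0.
pose c := eta / psi (rho ^+ 2); have c0 : 0 < c by rewrite divr_gt0.
have barrier w : rho <= N w -> N w < 1 -> v w * expR (c * psi (N w ^+ 2)) <= 1.
  move=> rw w1; rewrite leNgt; apply/negP; set Q := v w * _ => Q1.
  (* The maximum is taken over rho <= |x| <= r1 only, with r1 < 1 so close to 1 that
     the values on the outer circle stay below the assumed value Q at w. *)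
  have [r1 [wr1 r11 r1Q]] : exists r1 : R, [/\ N w <= r1, r1 < 1 & expR (c * psi (r1 ^+ 2)) < Q].
    have cx : {for 1, continuous (fun x : R => expR (c * psi (x ^+ 2)))}.
      have cX : {for 1, continuous (fun x : R => x ^+ 2)} by exact: (@exprn_continuous _ 2).
      have c1 : {for (1 : R), continuous (fun x : R => (x ^+ 2)^-1)}.
        by apply: continuous_inv cX; rewrite expr1n oner_neq0.
      have c2 : {for (1 : R), continuous (fun x : R => c * psi (x ^+ 2))}.
        have H := continuous_mul (continuous_const c _) (continuous_add (continuous_sub c1 (continuous_const 2 _)) cX).
        exact: H.
      exact: (continuous_comp c2 (@continuous_expR _ _)).
    have [d1 d10 d1P] := (continuousR_eps _ _).1 cx (Q - 1) ltac:(rewrite subr_gt0//).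
    pose r1 := Num.max (N w) (1 - d1 / 2).
    have r11 : r1 < 1 by rewrite /r1 gt_max w1 /=; lra.
    exists r1; split=> //; first by rewrite /r1 le_max lexx.
    have := d1P r1; rewrite ltr0_norm ?subr_lt0//.
    have r1d : 1 - d1 / 2 <= r1 by rewrite /r1 le_max lexx orbT.
    move=> Wr; have {Wr} := Wr ltac:(lra).
    rewrite expr1n /psi invr1 (_ : 1 - 2 + 1 = 0) ?mulr0 ?expR0; last by ring.
    by rewrite ltr_norml => /andP[_]; lra.
  pose g (x : C) := v x * expR (c * psi (N x ^+ 2)).
  have rr1 : rho <= r1 by apply: le_trans wr1.
  have [|w0 [rw0 w0r H]] := @max_on_annulus _ g rho r1 (ltW rho0) rr1.
    move=> x rx xr.
    have x0 : N x ^+ 2 != 0 by rewrite expf_neq0// gt_eqF// (lt_le_trans rho0).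
    have c1 := continuous_inv (f := fun w : C => N w ^+ 2) x0 (continuous_N_sqr x).
    have c2 : {for x, continuous (fun x : C => c * psi (N x ^+ 2))}.
      have H := continuous_mul (continuous_const c _) (continuous_add (continuous_sub c1 (continuous_const 2 _)) (continuous_N_sqr x)).
      exact: H.
    have c3 : {for x, continuous (fun x : C => expR (c * psi (N x ^+ 2)))}.
      exact: (continuous_expR_comp c2).
    have H := continuous_mul (f := v) (z := x) (cv x (le_lt_trans xr r11)) c3; exact: H.
  have gQ : Q <= g w0 by apply: H.
  have g1 : 1 < g w0 by apply: lt_le_trans gQ.
  have w01 : N w0 < 1 by apply: le_lt_trans r11.
  have Nw0 : 0 < N w0 by apply: lt_le_trans rw0.
  set s := N w0 ^+ 2.
  have s0 : 0 < s by rewrite exprn_gt0.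
  have s1 : s < 1 by rewrite /s expr_lt1// N_ge0.
  have rw0' : rho < N w0.
    rewrite lt_neqAle rw0 andbT; apply/eqP => E.
    move: g1; rewrite /g -E ltNge => /negP; apply.
    have := veta w0; rewrite -E lexx => /(_ isT) V.
    apply: le_trans (ler_wpM2r (expR_ge0 _) V) _.
    rewrite /c divfK ?gt_eqF//.
    have := expR_ge1Dx (- eta); rewrite expRN -[1 + _]/(1 - eta) => X.
    by apply: le_trans (ler_wpM2r (expR_ge0 _) X) _; rewrite mulVf// gt_eqF// expR_gt0.
  have w0r' : N w0 < r1.
    rewrite lt_neqAle w0r andbT; apply/eqP => E.
    have : g w0 < Q; last by rewrite ltNge gQ.
    apply: le_lt_trans r1Q; rewrite /g E.
    by rewrite ler_piMl ?expR_ge0//; exact: ahlfors.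
  have lw0 : 0 < l w0.
    rewrite lt_neqAle l0// andbT; apply/eqP => E; move: g1; rewrite /g /v -E !mul0r; clear; lra.
  (* exp(- phi) = (1 - s) exp(c psi), so that the function above is l exp(- phi). *)
  pose phi (s : R) := - ln (1 - s) - c * psi s.
  pose phi1 (s : R) := (1 - s)^-1 - c * (1 - s^-1 ^+ 2).
  pose phi2 := (1 - s)^-1 ^+ 2 - c * (2 * s^-1 ^+ 3).
  pose r := Num.min s (1 - s).
  have r0 : 0 < r by rewrite /r lt_min s0 subr_gt0.
  have d1s (x : R) : is_derive x 1 (fun s : R => 1 - s) (-1) by exact: is_derive_subl.
  have dinv (x : R) : x != 0 -> is_derive x 1 (fun s : R => s^-1) (- x^-1 ^+ 2).
    move=> x0; have D := @is_derive_quot _ (fun s => s) (fun=> 1) x 1 0 x0 (is_derive_id _ _) (is_derive_cst _ _ _).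
    have -> : (fun s : R => s^-1) = (fun s => 1 / s) by apply/funext => y; rewrite div1r.
    apply: is_derive_eq D _; by field.
  have dpsi (x : R) : x != 0 -> is_derive x 1 psi (1 - x^-1 ^+ 2).
    move=> x0; have D := is_deriveD (is_deriveB (dinv x x0) (is_derive_cst (2 : R) x 1)) (is_derive_id x 1).
    by apply: is_derive_eq D _; ring.
  have dphi x : `|x - N w0 ^+ 2| < r -> is_derive x 1 phi (phi1 x).
    rewrite -/s ltr_norml /r lt_min ltrNl lt_min => /andP[/andP[h1 h2] /andP[h3 h4]].
    have x0 : x != 0 by rewrite gt_eqF//; clear -h1 h2 h3 h4; lra.
    have x1 : 0 < 1 - x by clear -h1 h2 h3 h4; lra.
    have D1 := is_deriveN (is_derive_ln (F := fun s => 1 - s) x1 (d1s x)).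
    have D2 := is_deriveZ c (dpsi x x0).
    apply: is_derive_eq (is_deriveB D1 D2) _.
    by rewrite /phi1 mulN1r opprK.
  have dphi1 : is_derive (N w0 ^+ 2) 1 phi1 phi2.
    rewrite -/s; have s0' : s != 0 by rewrite gt_eqF.
    have s1' : 1 - s != 0 by rewrite gt_eqF// subr_gt0.
    have D1 := @is_derive_quot _ (fun s => 1 - s) (fun=> 1) s (-1) 0 s1' (d1s _) (is_derive_cst _ _ _).
    have D2 := is_deriveM (dinv s s0') (dinv s s0').
    have D3 := is_deriveZ c (is_deriveB (is_derive_cst (1 : R) s 1) D2).
    have -> : phi1 = (fun x => 1 / (1 - x) - c *: (1 - x^-1 * x^-1)).
      by apply/funext => x; rewrite /phi1 div1r expr2.
    apply: is_derive_eq (is_deriveB D1 D3) _.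
    by rewrite /phi2 /GRing.scale /=; field; rewrite s0' s1'.
  have emphi x : 0 < 1 - x -> expR (- phi x) = (1 - x) * expR (c * psi x).
    by move=> x1; rewrite /phi opprB addrC opprK expRD lnK.
  have LM : exists2 d : R, 0 < d & forall h : C, N h < d ->
      l (w0 + h) * expR (- phi (N (w0 + h) ^+ 2)) <= l w0 * expR (- phi (N w0 ^+ 2)).
    exists (Num.min (r1 - N w0) (N w0 - rho)); first by rewrite lt_min !subr_gt0 w0r' rw0'.
    move=> h; rewrite lt_min => /andP[h1 h2].
    have whr : N (w0 + h) <= r1 by have := ND w0 h; clear -h1; lra.
    have whr' : rho <= N (w0 + h).
      by have := NB_ge w0 (- h); rewrite NN opprK; clear -h2; lra.
    have tp : 0 < 1 - N (w0 + h) ^+ 2.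
      by rewrite subr_gt0 expr_lt1 ?N_ge0//; exact: le_lt_trans r11.
    rewrite !emphi -/s ?subr_gt0//; last by rewrite -subr_gt0.
    by rewrite !mulrA; exact: H.
  have L := local_max_bound sub w01 lw0 r0 dphi dphi1 LM; rewrite -/s in L.
  have X : expR (- (2 * (c * psi s))) < (l w0 * (1 - s)) ^+ 2.
    have -> : - (2 * (c * psi s)) = - (c * psi s) + - (c * psi s) by ring.
    rewrite expRD -expr2 ltr_pXn2r ?nnegrE ?expR_ge0 ?mulr_ge0 ?subr_ge0 ?(ltW lw0) ?(ltW s1)//.
    by rewrite expRN -[X in X < _]div1r ltr_pdivrMr ?expR_gt0//; exact: g1.
  have Y : 1 - 2 * (c * psi s) < 1 - c * ((1 - s) ^+ 2 * (1 + s^-1 ^+ 2)).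
    apply: le_lt_trans (expR_ge1Dx _) _; apply: lt_le_trans X _.
    have s12 : 0 <= (1 - s) ^+ 2 by rewrite sqr_ge0.
    rewrite exprMn; apply: le_trans (ler_wpM2r s12 L) _.
    rewrite le_eqVlt; apply/orP; left; apply/eqP.
    by rewrite /phi1 /phi2; field; rewrite !gt_eqF// subr_gt0.
  have {}Y : (1 - s) ^+ 2 * (1 + s^-1 ^+ 2) < 2 * psi s.
    by rewrite -(ltr_pM2l c0); move: Y; clear; lra.
  have Z : 0 <= (1 - s) ^+ 2 * (s^-1 - 1) ^+ 2 by rewrite mulr_ge0 ?sqr_ge0.
  move: Y; rewrite psiE// ltNge => /negP; apply.
  rewrite -subr_ge0 (_ : _ - _ = (1 - s) ^+ 2 * (s^-1 - 1) ^+ 2)//.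
  by field; rewrite gt_eqF.
exists (Num.min eta (c / (1 + c))).
  by rewrite lt_min eta0 divr_gt0// addr_gt0.
move=> w w1; rewrite -/(v w); set s := N w ^+ 2.
have s1 : s < 1 by rewrite /s expr_lt1// N_ge0.
have s0 : 0 <= s by rewrite /s sqr_ge0.
have q1 : (1 - s) ^+ 2 <= 1.
  by rewrite expr_le1//; clear -s0 s1; lra.
have q0 : 0 <= (1 - s) ^+ 2 by rewrite sqr_ge0.
have [wr|rw] := leP (N w) rho.
  have := veta w wr; set m := Num.min _ _ => V.
  have m1 : m <= eta by rewrite /m ge_min lexx.
  have := ler_wpM2r q0 m1; have := ler_wpM2l (ltW eta0) q1.
  by move: V; clear; lra.
have B := barrier w (ltW rw) w1; rewrite -/s in B.
have sp : 0 < s by rewrite /s exprn_gt0// (lt_trans rho0).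
set m := Num.min _ _; have m1 : m <= c / (1 + c) by rewrite /m ge_min lexx orbT.
set y := c * (1 - s) ^+ 2.
have y0 : 0 <= y by rewrite /y mulr_ge0// ltW.
have yx : y <= c * psi s.
  by rewrite /y ler_wpM2l ?(ltW c0)// psiE// ler_pdivlMr// ler_piMr// ltW.
have vy : v w <= expR (- y).
  rewrite expRN -[leRHS]div1r ler_pdivlMr ?expR_gt0//; apply: le_trans B.
  by rewrite ler_wpM2l ?ler_expR// /v mulr_ge0 ?l0// subr_ge0 ltW.
have ey : expR (- y) <= (1 + y)^-1.
  by rewrite expRN lef_pV2 ?posrE ?expR_gt0 ?expR_ge1Dx//; clear -y0; lra.
have c1 : 0 < 1 + c by clear -c0; lra.
have y1 : 0 < 1 + y by clear -y0; lra.
have yc : y <= c by rewrite /y ler_piMr// ltW.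
apply: (@le_trans _ _ (y / (1 + c))).
  by rewrite /y mulrAC ler_wpM2r.
apply: (@le_trans _ _ (y / (1 + y))).
  by rewrite ler_wpM2l// lef_pV2 ?posrE// lerD2l.
have -> : y / (1 + y) = 1 - (1 + y)^-1 by field; rewrite gt_eqF.
by rewrite lerD2l lerN2 (le_trans vy).
Qed.

End Disk.

(** * Moebius transformations of the disk *)
Section Moebius.
Context {R : realType}.
Local Notation C := (Cplx R).
Local Notation S := (Sphere R).
Local Notation Re := (@complex.Re R).
Local Notation Im := (@complex.Im R).

Lemma NJ (z : R[i]) : N (z^*) = N z.
Proof. by case: z => a b /=; rewrite sqrrN. Qed.

Lemma mulJ_N (z : R[i]) : z^* * z = (N z ^+ 2)%:C.
Proof. by rewrite N_sqr; apply: complex_ext; case: z => a b /=; ring. Qed.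

Definition moebius (a w : R[i]) : R[i] := (w + a) / (1 + a^* * w).
Definition moebius_deriv (a w : R[i]) : R[i] := (1 - N a ^+ 2)%:C / (1 + a^* * w) ^+ 2.

Lemma moebius_den_gt0 (a w : R[i]) : N a < 1 -> N w < 1 -> 0 < N (1 + a^* * w).
Proof.
move=> a1 w1; have := NB_ge 1 (- (a^* * w)); rewrite opprK NN NM NJ N1.
have : N a * N w < 1 by rewrite -[1]mulr1 ltr_pM ?N_ge0.
by clear; lra.
Qed.

Lemma moebius_den_neq0 (a w : R[i]) : N a < 1 -> N w < 1 -> 1 + a^* * w != 0.
Proof. by move=> a1 w1; rewrite -N_gt0 moebius_den_gt0. Qed.

Lemma moebius_defect (a w : R[i]) : N a < 1 -> N w < 1 ->
  1 - N (moebius a w) ^+ 2 = (1 - N a ^+ 2) * (1 - N w ^+ 2) / N (1 + a^* * w) ^+ 2.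
Proof.
move=> a1 w1; have d0 := moebius_den_gt0 a1 w1.
rewrite /moebius NM NV exprMn exprVn.
have d2 : N (1 + a^* * w) ^+ 2 != 0 by rewrite expf_neq0// gt_eqF.
apply: (mulIf d2); rewrite mulrBl mul1r !divfK//.
rewrite !N_sqr; case: a w {a1 w1 d0 d2} => [a b] [c d] /=; ring.
Qed.

(** Moebius transformations are isometries of the hyperbolic metric of the disk. *)
Lemma moebius_N_deriv (a w : R[i]) : N a < 1 -> N w < 1 ->
  N (moebius_deriv a w) * (1 - N w ^+ 2) = 1 - N (moebius a w) ^+ 2.
Proof.
move=> a1 w1; rewrite moebius_defect// /moebius_deriv NM NV NX NReal ger0_norm.
  by rewrite mulrAC.
by rewrite subr_ge0 expr_le1 ?N_ge0// ltW.
Qed.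

Lemma moebius_lt1 (a w : R[i]) : N a < 1 -> N w < 1 -> N (moebius a w) < 1.
Proof.
move=> a1 w1; rewrite -(expr_lt1 (n := 2)) ?N_ge0// -subr_gt0 moebius_defect//.
by rewrite divr_gt0 ?mulr_gt0 ?subr_gt0 ?expr_lt1 ?N_ge0 ?exprn_gt0 ?moebius_den_gt0.
Qed.

Lemma moebiusK (a w : R[i]) : N a < 1 -> N w < 1 -> moebius a (moebius (- a) w) = w.
Proof.
move=> a1 w1; have a1' : N (- a) < 1 by rewrite NN.
have d1 := moebius_den_neq0 a1' w1.
have d2 := moebius_den_neq0 a1 (moebius_lt1 a1' w1).
have aa : 1 - a^* * a != 0.
  rewrite subr_eq0; apply/eqP => E.
  have H : N a * N a < 1 by rewrite -[1]mulr1 ltr_pM ?N_ge0.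
  by move: H; rewrite -{1}(NJ a) -NM -E N1 ltxx.
move: d1 d2; rewrite /moebius rmorphN /= => d1 d2.
have E : 1 + a^* * ((w - a) / (1 + - a^* * w)) = (1 - a^* * a) / (1 + - a^* * w) by field.
rewrite E; field; by rewrite aa d1.
Qed.

Lemma cderiv_moebius (a w : R[i]) : N a < 1 -> N w < 1 ->
  cderiv (moebius a) w (moebius_deriv a w).
Proof.
move=> a1 w1; have d0 := moebius_den_neq0 a1 w1.
have D1 := cderivD (cderiv_id w) (cderiv_cst a w).
have D2 := cderivD (cderiv_cst 1 w) (cderivM (cderiv_cst (a^*) w) (cderiv_id w)).
have D3 := cderiv_comp D2 (cderivV d0).
have D := cderivM D1 D3.
set d := (X in cderiv _ _ X) in D.
have -> : moebius_deriv a w = d.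
  by rewrite /moebius_deriv /d rmorphB rmorph1 /= -mulJ_N; field; exact: d0.
exact: D.
Qed.

Lemma open_unit_disk : open (@unit_disk R).
Proof.
rewrite openE => w /= w1; apply/nbhs_N; exists (1 - N w); first by rewrite subr_gt0.
by move=> x xw; rewrite /unit_disk /=; have := N_dist x w; rewrite ler_norml => /andP[_]; lra.
Qed.

Lemma cderiv_continuousC (f : R[i] -> R[i]) (z a : R[i]) : cderiv f z a ->
  {for (z : C), continuous (f : C -> C)}.
Proof.
move=> D; apply/continuous_N => e e0; have [d d0 dP] := cderiv_continuous D e0.
by apply/nbhs_N; exists d => // y yz; rewrite -[y](subrKC z); exact: dP.
Qed.

Lemma local_expr_cderiv (D : set C) (F : C -> S) (w : C) : holomorphic_on D F -> D w ->
  cderiv (local_expr F w) w ('D_1 (local_expr F w : C -> C) w).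
Proof. by move=> holF /holF [_ dF]; apply/cderiv_is_derive; exact: DeriveDef. Qed.

Lemma holomorphic_moebius (F : C -> S) (a : R[i]) : N a < 1 -> holomorphic_on unit_disk F ->
  holomorphic_on unit_disk (fun w => F (moebius a w)).
Proof.
move=> a1 holF w w1; have T1 : unit_disk (moebius a w : C) by exact: moebius_lt1.
have [cF _] := holF _ T1.
have DT := cderiv_moebius a1 w1.
have cT := cderiv_continuousC DT.
split; first exact: continuous_comp cT cF.
have D := cderiv_comp DT (local_expr_cderiv holF T1).
by have /cderiv_is_derive [] := D.
Qed.

Lemma pullback_moebius (F : C -> S) (lam : S -> R) (a w : R[i]) :
  N a < 1 -> N w < 1 -> holomorphic_on unit_disk F ->
  pullback (fun w => F (moebius a w)) lam w = pullback F lam (moebius a w) * N (moebius_deriv a w).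
Proof.
move=> a1 w1 holF; have T1 : unit_disk (moebius a w : C) by exact: moebius_lt1.
have D := cderiv_comp (cderiv_moebius a1 w1) (local_expr_cderiv holF T1).
move: D => /cderiv_is_derive D.
rewrite /pullback -mulrA -NM; congr (_ * N _).
exact: (@derive_val _ _ _ _ _ _ _ D).
Qed.

(** Ahlfors' lemma and its boundary version, which concern functions on the disk,
    thereby apply to pulled back pseudometrics. *)
Lemma pullback_subsolution (F : C -> S) Omega (lam : S -> R) :
  open Omega -> holomorphic_on unit_disk F -> (forall w, unit_disk w -> Omega (F w)) ->
  conformal_pseudometric Omega lam -> curvature_le Omega lam (-4) ->
  conformal_subsolution (pullback F lam).
Proof.
move=> oO holF FO psm curv; split.
- move=> z z1; have [r r0 P] := holomorphic_chart open_unit_disk holF z1 (in_chart_at (F z)).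
  have [_ cz _ PE] := P z ltac:(rewrite subrr N0//).
  rewrite (PE lam) mulr_ge0 ?N_ge0//; have [d0 _ _] := psm (chart_at (F z)).
  by apply: d0; rewrite /= [from_chart _ _]cz; exact: FO.
- by move=> z z1; apply: (pullback_continuous open_unit_disk holF FO psm).
- move=> z b c d z1 lz H.
  exact: (pullback_curvature open_unit_disk oO holF FO psm curv z1 lz H).
Qed.

(** A Moebius transformation carries the point where the inequality is strict to 0;
    it distorts 1 - |w|^2 by at most a constant factor. *)
Theorem boundary_schwarz (F : C -> S) Omega (lam : S -> R) (a : R[i]) :
  open Omega -> holomorphic_on unit_disk F -> (forall w, unit_disk w -> Omega (F w)) ->
  conformal_pseudometric Omega lam -> curvature_le Omega lam (-4) ->
  N a < 1 -> pullback F lam a * (1 - N a ^+ 2) < 1 ->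
  exists2 k : R, 0 < k & forall w : R[i], N w < 1 ->
    k * (1 - N w ^+ 2) ^+ 2 <= 1 - pullback F lam w * (1 - N w ^+ 2).
Proof.
move=> oO holF FO psm curv a1 va.
pose G w := F (moebius a w).
have holG : holomorphic_on unit_disk G by exact: holomorphic_moebius.
have GO w : unit_disk w -> Omega (G w) by move=> w1; apply: FO; exact: moebius_lt1.
have sub := pullback_subsolution oO holG GO psm curv.
have vG w : N w < 1 -> pullback G lam w * (1 - N w ^+ 2) =
    pullback F lam (moebius a w) * (1 - N (moebius a w) ^+ 2).
  by move=> w1; rewrite pullback_moebius// -mulrA moebius_N_deriv.
have m0 : moebius a 0 = a by rewrite /moebius add0r mulr0 addr0 divr1.
have G0 : pullback G lam 0 < 1.
  have z1 : N (0 : R[i]) < 1 by rewrite N0 ltr01.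
  have E0 : 1 - N (0 : R[i]) ^+ 2 = 1 by rewrite N0 expr0n subr0.
  have H1 := congr1 (fun x => pullback G lam 0 * x) E0.
  have H2 := congr1 (fun x => pullback F lam x * (1 - N x ^+ 2)) m0.
  have -> := eq_trans (esym (mulr1 _)) (eq_trans (esym H1) (eq_trans (vG 0 z1) H2)).
  exact: va.
have [k k0 kP] := hopf sub G0.
have a2 : 0 < 1 - N a ^+ 2 by rewrite subr_gt0 expr_lt1 ?N_ge0.
(* 1 - |T w|^2 is (1 - |a|^2) (1 - |w|^2) over a square of modulus at most 4. *)
exists (k * ((1 - N a ^+ 2) / 4) ^+ 2).
  by rewrite mulr_gt0// exprn_gt0// divr_gt0.
move=> w w1; have a1' : N (- a) < 1 by rewrite NN.
set x := moebius (- a) w; have x1 : N x < 1 by exact: moebius_lt1.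
have H2 := congr1 (fun y => pullback F lam y * (1 - N y ^+ 2)) (moebiusK a1 w1).
have E := eq_trans (vG x x1) H2.
rewrite -E; apply: le_trans (kP x x1).
clear E H2 vG m0 G0 kP sub GO holG va curv psm FO holF.
rewrite -mulrA ler_wpM2l ?(ltW k0)// -exprMn.
have w2 : 0 <= 1 - N w ^+ 2 by rewrite subr_ge0 expr_le1 ?N_ge0// ltW.
have x2 : 0 <= 1 - N x ^+ 2 by rewrite subr_ge0 expr_le1 ?N_ge0// ltW.
rewrite ler_pXn2r ?nnegrE ?mulr_ge0 ?divr_ge0 ?(ltW a2)//.
rewrite /x moebius_defect// NN [leLHS]mulrAC ler_wpM2l ?mulr_ge0 ?(ltW a2)//.
rewrite lef_pV2 ?posrE ?exprn_gt0 ?moebius_den_gt0//.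
have -> : 4 = 2 ^+ 2 :> R by rewrite -natrX.
rewrite ler_pXn2r ?nnegrE ?N_ge0//.
apply: le_trans (ND _ _) _; rewrite N1 NM NJ NN.
have : N a * N w <= 1 by rewrite mulr_ile1 ?N_ge0// ltW.
by clear; lra.
Qed.

End Moebius.

(** * Differentiable paths and the hyperbolic radius *)
Section Paths.
Context {R : realType}.
Local Notation C := (Cplx R).
Local Notation S := (Sphere R).
Local Notation Re := (@complex.Re R).
Local Notation Im := (@complex.Im R).

Definition path_deriv (g : R -> R[i]) (t : R) (v : R[i]) : Prop :=
  forall e, 0 < e -> exists2 d, 0 < d & forall h : R, `|h| < d ->
    N (g (t + h) - g t - h%:C * v) <= e * `|h|.

Lemma path_deriv_near (g k : R -> R[i]) (t : R) v :
  (exists2 d, 0 < d & forall h : R, `|h| < d -> g (t + h) = k (t + h)) ->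
  path_deriv g t v -> path_deriv k t v.
Proof.
move=> [d d0 gk] D e e0; have [d1 d10 P] := D e e0.
exists (Num.min d d1); first by rewrite lt_min d0.
move=> h; rewrite lt_min => /andP[h1 h2].
have := gk 0; rewrite normr0 addr0 => /(_ d0) <-; rewrite -gk//; exact: P.
Qed.

Lemma path_deriv_Lipschitz g (t : R) v : path_deriv g t v ->
  exists2 d, 0 < d & forall h : R, `|h| < d -> N (g (t + h) - g t) <= (N v + 1) * `|h|.
Proof.
move=> D; have [d d0 P] := D 1 ltr01; exists d => // h /P H.
rewrite -[g (t + h) - g t](subrK (h%:C * v)) (le_trans (ND _ _))// NM NReal.
by move: H; clear; lra.
Qed.

Lemma path_deriv_continuous g (t : R) v : path_deriv g t v ->
  {for t, continuous (g : R -> C)}.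
Proof.
move=> /path_deriv_Lipschitz [d d0 P]; apply/continuous_N => e e0.
have v0 : 0 < N v + 1 by have := N_ge0 v; lra.
apply/nbhs_ballP; exists (Num.min d (e / (N v + 1))) => /=; first by rewrite lt_min d0 divr_gt0.
move=> y; rewrite /ball/= distrC lt_min ltr_pdivlMr// => /andP[h1 h2].
have := P (y - t) h1; rewrite subrKC => H; apply: le_lt_trans H _.
by rewrite mulrC.
Qed.

Lemma path_deriv_Re g (t : R) v u : path_deriv g t v ->
  is_derive t 1 (fun t => Re (u * g t)) (Re (u * v)).
Proof.
move=> D; apply/is_derive_eps => e e0.
have u0 : 0 < N u + 1 by have := N_ge0 u; lra.
have [d d0 P] := D (e / (N u + 1)) (divr_gt0 e0 u0); exists d => // h /P H.
have -> : Re (u * g (t + h)) - Re (u * g t) - Re (u * v) * h =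
    Re (u * (g (t + h) - g t - h%:C * v)).
  by rewrite !(ReCM, ReCB, ImCB, ImCM) /=; ring.
apply: le_trans (Re_le_N _) _; rewrite NM.
apply: le_trans (ler_wpM2l (N_ge0 u) H) _.
rewrite mulrA ler_wpM2r// mulrA ler_pdivrMr// mulrC ler_wpM2l ?(ltW e0)//.
by rewrite lerDl.
Qed.

Lemma path_deriv_velocity g (t : R) v : path_deriv g t v -> velocity g t = v.
Proof.
move=> D; have D1 := path_deriv_Re 1 D; have D2 := path_deriv_Re (- 'i) D.
have E1 : (fun t => Re (1 * g t)) = (fun t => Re (g t)) by apply/funext => x; rewrite mul1r.
have E2 : (fun t => Re (- 'i * g t)) = (fun t => Im (g t)).
  by apply/funext => x; rewrite ReCM /=; ring.
rewrite E1 in D1; rewrite E2 in D2; rewrite /velocity; apply: complex_ext => /=.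
  by rewrite derive1E derive_val mul1r.
by rewrite derive1E derive_val ReCM /=; ring.
Qed.

Lemma derivable_path_deriv (g : R -> R[i]) (t : R) :
  derivable (fun s => Re (g s)) t 1 -> derivable (fun s => Im (g s)) t 1 ->
  path_deriv g t (velocity g t).
Proof.
move=> h1 h2 e e0.
have D1 : is_derive t 1 (fun s => Re (g s)) (Re (velocity g t)).
  by apply: (DeriveDef h1); rewrite /velocity /= derive1E.
have D2 : is_derive t 1 (fun s => Im (g s)) (Im (velocity g t)).
  by apply: (DeriveDef h2); rewrite /velocity /= derive1E.
have e2 : 0 < e / 2 by rewrite divr_gt0.
have [d1 d10 P1] := (is_derive_eps _ _ _).1 D1 _ e2.
have [d2 d20 P2] := (is_derive_eps _ _ _).1 D2 _ e2.
exists (Num.min d1 d2); first by rewrite lt_min d10.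
move=> h; rewrite lt_min => /andP[/P1 H1 /P2 H2].
apply: le_trans (N_le_ReIm _) _; rewrite [e]splitr mulrDl; apply: lerD.
  apply: le_trans H1; rewrite le_eqVlt; apply/orP; left; apply/eqP; congr `|_|.
  by rewrite !ReCB ReCM /=; ring.
apply: le_trans H2; rewrite le_eqVlt; apply/orP; left; apply/eqP; congr `|_|.
by rewrite !ImCB ImCM /=; ring.
Qed.

Lemma path_deriv_comp (phi : R[i] -> R[i]) (g : R -> R[i]) (t : R) a v :
  cderiv phi (g t) a -> path_deriv g t v -> path_deriv (fun t => phi (g t)) t (a * v).
Proof.
move=> Dphi D e e0.
have [d1 d10 P1] := path_deriv_Lipschitz D.
pose K := N v + 1; have K0 : 0 < K by rewrite /K; have := N_ge0 v; lra.
pose A := N a + 1; have A0 : 0 < A by rewrite /A; have := N_ge0 a; lra.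
have e2 : 0 < e / 2 by rewrite divr_gt0.
have [d2 d20 P2] := Dphi (e / 2 / K) (divr_gt0 e2 K0).
have [d3 d30 P3] := D (e / 2 / A) (divr_gt0 e2 A0).
exists (Num.min (Num.min d1 d3) (d2 / K)); first by rewrite !lt_min d10 d30 divr_gt0.
move=> h; rewrite !lt_min ltr_pdivlMr// => /andP[/andP[/P1 h1 /P3 h3] h2].
have k2 : N (g (t + h) - g t) < d2 by apply: le_lt_trans h1 _; rewrite mulrC.
have := P2 _ k2; rewrite subrKC => B2.
have -> : phi (g (t + h)) - phi (g t) - h%:C * (a * v) =
  (phi (g (t + h)) - phi (g t) - a * (g (t + h) - g t)) + a * (g (t + h) - g t - h%:C * v) by ring.
apply: le_trans (ND _ _) _; rewrite NM [e]splitr mulrDl; apply: lerD.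
  apply: le_trans B2 _; rewrite [leLHS]mulrAC ler_pdivrMr//.
  rewrite [leRHS](_ : _ = e / 2 * (K * `|h|)); last by ring.
  by rewrite ler_wpM2l ?(ltW e2).
apply: le_trans (ler_wpM2l (N_ge0 a) h3) _.
by rewrite mulrA ler_wpM2r// mulrA ler_pdivrMr// mulrC ler_wpM2l ?(ltW e2)// lerDl.
Qed.

(** A continuous lift of a differentiable path through a map with nonzero derivative
    is differentiable.  The inverse function is not needed: the increments of the
    lift are first bounded by those of the path, because phi(x) - phi(x0) is
    comparable with x - x0, and then the linear approximation is solved for them. *)
Lemma path_deriv_lift (phi : R[i] -> R[i]) (om g : R -> R[i]) (t : R) a v :
  cderiv phi (om t) a -> a != 0 -> {for t, continuous (om : R -> C)} ->
  (exists2 d, 0 < d & forall h : R, `|h| < d -> phi (om (t + h)) = g (t + h)) ->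
  path_deriv g t v -> path_deriv om t (v / a).
Proof.
move=> Dphi a0 com [d0 d00 E] D.
have Na : 0 < N a by rewrite N_gt0.
have [d1 d10 P1] := path_deriv_Lipschitz D.
pose K := N v + 1; have K0 : 0 < K by rewrite /K; have := N_ge0 v; lra.
have near_om (r : R) : 0 < r -> exists2 d, 0 < d & forall h : R, `|h| < d -> N (om (t + h) - om t) < r.
  move=> r0; have := (continuous_N _ _).1 com r r0 => /nbhs_ballP [d /= dpos dP].
  by exists d => // h hd; apply: dP; rewrite /ball/= opprD addNKr normrN.
have Et : phi (om t) = g t by have := E 0; rewrite normr0 addr0; apply.
have [d2 d20 P2] := Dphi (N a / 2) (divr_gt0 Na (ltr0Sn _ 1)).
have [d3 d30 P3] := near_om _ d20.
pose L := 2 * K / N a; have L0 : 0 < L by rewrite /L divr_gt0// mulr_gt0.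
have lip h : `|h| < Num.min d0 (Num.min d1 d3) -> N (om (t + h) - om t) <= L * `|h|.
  rewrite !lt_min => /andP[h0 /andP[h1 /P3 h3]].
  have := P2 _ h3; rewrite subrKC E// Et; set k := om (t + h) - om t => B.
  have B1 := P1 h h1.
  have : N (a * k) <= N (g (t + h) - g t) + N (g (t + h) - g t - a * k).
    have E0 : a * k = (g (t + h) - g t) - (g (t + h) - g t - a * k) by ring.
    by rewrite {1}E0 NB.
  rewrite NM => B3; rewrite /L mulrAC ler_pdivlMr//.
  move: B B1 B3; rewrite -/K; clear; lra.
move=> e e0; pose e1 := e * N a / 2.
have e10 : 0 < e1 by rewrite /e1 divr_gt0// mulr_gt0.
have [d4 d40 P4] := Dphi (e1 / L) (divr_gt0 e10 L0).
have [d5 d50 P5] := near_om _ d40.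
have [d6 d60 P6] := D e1 e10.
exists (Num.min (Num.min d0 (Num.min d1 d3)) (Num.min d5 d6)).
  by rewrite !lt_min d00 d10 d30 d50 d60.
move=> h; rewrite lt_min => /andP[hl]; rewrite lt_min => /andP[/P5 h5 /P6 h6].
have h0 : `|h| < d0 by move: hl; rewrite lt_min => /andP[].
have B1 := lip h hl.
have := P4 _ h5; rewrite subrKC E// Et; set k := om (t + h) - om t in B1 * => B.
have -> : k - h%:C * (v / a) = ((g (t + h) - g t - h%:C * v) - (g (t + h) - g t - a * k)) / a.
  by field.
rewrite NM NV ler_pdivrMr//; apply: le_trans (NB _ _) _.
have B2 : N (g (t + h) - g t - a * k) <= e1 * `|h|.
  apply: le_trans B _; rewrite -mulrA ler_wpM2l ?(ltW e10)// mulrC ler_pdivrMr//.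
  by rewrite mulrC.
by move: h6 B2; rewrite /e1; clear; lra.
Qed.

Definition atanh (x : R) : R := ln ((1 + x) / (1 - x)) / 2.

(** The hyperbolic distance of w from the origin of the disk. *)
Definition hyp_radius (w : R[i]) : R := atanh (N w).

Lemma is_derive_atanh (x : R) : -1 < x -> x < 1 -> is_derive x 1 atanh ((1 - x ^+ 2)^-1).
Proof.
move=> x1 x2.
have d1 (y : R) : is_derive y 1 (fun s : R => 1 - s) (-1) by exact: is_derive_subl.
have d2 (y : R) : is_derive y 1 (fun s : R => 1 + s) 1.
  by apply: is_derive_eq (is_deriveD (is_derive_cst (1 : R) y 1) (is_derive_id y 1)) _; rewrite add0r.
have n1 : 0 < 1 - x by lra.
have n2 : 0 < 1 + x by lra.
have D := @is_derive_quot _ (fun s => 1 - s) (fun s => 1 + s) x _ _ (lt0r_neq0 n1) (d1 x) (d2 x).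
have q0 : 0 < (1 + x) / (1 - x) by rewrite divr_gt0.
have D2 := is_derive_ln (F := fun s => (1 + s) / (1 - s)) q0 D.
have D3 := is_deriveZ (2^-1 : R) D2.
have -> : atanh = (fun s => 2^-1 *: ln ((1 + s) / (1 - s))).
  by apply/funext => s; rewrite /atanh mulrC.
apply: is_derive_eq D3 _; rewrite /GRing.scale /=.
have -> : 1 - x ^+ 2 = (1 - x) * (1 + x) by ring.
by field; rewrite !gt_eqF.
Qed.

Lemma atanh_le (x y : R) : -1 < x -> x <= y -> y < 1 -> atanh x <= atanh y.
Proof.
move=> x1 xy y1; rewrite /atanh ler_wpM2r// ler_ln ?posrE ?divr_gt0//; try lra.
rewrite ler_pdivrMr; last by lra.
rewrite mulrAC ler_pdivlMr; last by lra.
by lra.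
Qed.

(** The hyperbolic radius changes at most by the hyperbolic length.  It is not
    differentiable at 0, so the path is rotated to bring om t1 to the positive axis
    and |om t| is replaced by the real part, which agrees with it at t1 and is
    smaller elsewhere. *)
Lemma hyp_radius_growth (om v : R -> R[i]) (j Phi : R -> R) (t1 t2 : R) : t1 <= t2 ->
  (forall t, t1 <= t <= t2 -> path_deriv om t (v t) /\ N (om t) < 1) ->
  (forall t, t1 < t < t2 -> N (v t) <= j t * (1 - N (om t) ^+ 2)) ->
  (forall t, t1 < t < t2 -> is_derive t 1 Phi (j t)) ->
  {within `[t1, t2], continuous Phi} ->
  hyp_radius (om t1) <= hyp_radius (om t2) + (Phi t2 - Phi t1).
Proof.
move=> t12 dom vj dPhi cPhi.
have [u u1 uE] := exists_phase (om t1).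
pose h t := atanh (Re (u * om t)).
have Rb t : t1 <= t <= t2 -> `|Re (u * om t)| <= N (om t).
  by move=> _; apply: le_trans (Re_le_N _) _; rewrite NM u1 mul1r.
have Rb1 t : t1 <= t <= t2 -> -1 < Re (u * om t) /\ Re (u * om t) < 1.
  move=> tt; have := le_lt_trans (Rb t tt) (dom t tt).2; rewrite ltr_norml => /andP[h1 h2].
  by split.
have dh t : t1 <= t <= t2 -> is_derive t 1 h ((1 - Re (u * om t) ^+ 2)^-1 * Re (u * v t)).
  move=> tt; have [r1 r2] := Rb1 t tt; have [D _] := dom t tt.
  have DR := path_deriv_Re u D.
  have DA := is_derive_atanh r1 r2.
  apply: is_derive_eq (is_derive1_comp DA DR) _; by rewrite /GRing.scale /= mulrC.
pose G t := Phi t + h t.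
have dG t : t1 < t < t2 -> is_derive t 1 G (j t + (1 - Re (u * om t) ^+ 2)^-1 * Re (u * v t)).
  move=> tt; have tt' : t1 <= t <= t2 by case/andP: tt => h1 h2; rewrite !ltW.
  exact: is_deriveD (dPhi t tt) (dh t tt').
have cG : {within `[t1, t2], continuous G}.
  have ch : {within `[t1, t2], continuous h}.
    apply: derivable_within_continuous => t; rewrite in_itv /= => tt.
    exact: (@ex_derive _ _ _ _ _ _ _ (dh t tt)).
  move=> x; have H := continuous_add (cPhi x) (ch x); exact: H.
have : G t1 <= G t2.
  apply: (@ger0_derive1_ndecr _ G t1 t2 _ _ cG) => //.
  - move=> t; rewrite in_itv /= => tt; exact: (@ex_derive _ _ _ _ _ _ _ (dG t tt)).
  - move=> t; rewrite in_itv /= => tt; have D := dG t tt; rewrite derive1E derive_val.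
    have tt' : t1 <= t <= t2 by case/andP: tt => h1 h2; rewrite !ltW.
    have [r1 r2] := Rb1 t tt'; have V := vj t tt; have := Rb t tt'.
    set x := Re (u * om t) in r1 r2 * => xb.
    have x2 : 0 < 1 - x ^+ 2 by have : x ^+ 2 = x * x by []; clear -r1 r2; nra.
    have om1 := (dom t tt').2.
    have n2 : 0 < 1 - N (om t) ^+ 2 by rewrite subr_gt0 expr_lt1 ?N_ge0.
    have j0 : 0 <= j t by rewrite -(pmulr_lge0 _ n2) (le_trans (N_ge0 _) V).
    have xn : x ^+ 2 <= N (om t) ^+ 2.
      by rewrite -[x ^+ 2]real_normK ?num_real// ler_pXn2r ?nnegrE ?N_ge0.
    have Rv : - Re (u * v t) <= j t * (1 - x ^+ 2).
      apply: le_trans (ler_norm _) _; rewrite normrN; apply: le_trans (Re_le_N _) _.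
      rewrite NM u1 mul1r; apply: le_trans V _; rewrite ler_wpM2l//; lra.
    rewrite mulrC -lerBlDr sub0r -mulNr ler_pdivrMr//.
rewrite /G => H.
have h1 : h t1 = hyp_radius (om t1) by rewrite /h uE.
have h2 : h t2 <= hyp_radius (om t2).
  have tt : t1 <= t2 <= t2 by rewrite t12 lexx.
  apply: atanh_le; [exact: (Rb1 t2 tt).1| |exact: (dom t2 tt).2].
  by apply: le_trans (ler_norm _) (Rb t2 tt).
move: H; rewrite h1; clear -h2; lra.
Qed.

(** Bisection of the interval: a rectangle with one degenerate side. *)
Lemma backward_induction (P : R -> Prop) (a b : R) : a <= b ->
  (forall s, a <= s <= b -> exists2 d, 0 < d & forall t1 t2, a <= t1 -> t1 <= t2 -> t2 <= b ->
     `|t1 - s| < d -> `|t2 - s| < d -> P t2 -> P t1) ->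
  P b -> P a.
Proof.
move=> ab loc; apply: (@rectangle_induction R (fun a b _ _ => P b -> P a) a b 0 0) => //.
  by move=> a' b' c d _ _ H1 _ H2 _ /H2 /H1.
move=> x y /andP[ax xb] _; have [d d0 dP] := loc x ltac:(rewrite ax xb//).
exists d => // a' b' c' d' aa ax' xb' bb _ _ _ _ ba _.
apply: dP => //; first exact: le_trans xb'.
  by rewrite ler0_norm; lra.
by rewrite ger0_norm; lra.
Qed.

End Paths.

(** * Lifts of arcs through the covering *)
Section Lifts.
Context {R : realType}.
Local Notation C := (Cplx R).
Local Notation S := (Sphere R).
Local Notation Re := (@complex.Re R).
Local Notation Im := (@complex.Im R).

Lemma hyperbolic_density_gt0 (w : C) : N w < 1 -> 0 < hyperbolic_density_disk w.
Proof. by move=> w1; rewrite /hyperbolic_density_disk div1r invr_gt0 subr_gt0 expr_lt1 ?N_ge0. Qed.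

Lemma hyperbolic_metric_gt0 (f : C -> S) (lamO : S -> R) (w : C) : N w < 1 ->
  pullback f lamO w = hyperbolic_density_disk w -> 0 < lamO (f w).
Proof.
move=> w1 E; have := hyperbolic_density_gt0 w1; rewrite -E /pullback.
set n := N _; have n0 : 0 <= n := N_ge0 _.
move: n0; rewrite le_eqVlt => /predU1P [<-|n0]; first by rewrite mulr0 ltxx.
by rewrite pmulr_lgt0.
Qed.

Section Covering.
Context (f : C -> S) (Omega : set S) (lamO : S -> R).
Context (cov : holomorphic_universal_covering Omega f).
Context (met : forall z, unit_disk z -> pullback f lamO z = hyperbolic_density_disk z).

Let holf : holomorphic_on unit_disk f := cov.1.

(** The hyperbolic speed of a lift is the speed of the path in the metric lamO:
    the defining property of the hyperbolic metric. *)
Lemma lift_derivative (om g : R -> C) (c : chart) (t : R) v : N (om t) < 1 ->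
  {for t, continuous om} ->
  (exists2 d, 0 < d & forall h : R, `|h| < d -> f (om (t + h)) = from_chart c (g (t + h))) ->
  path_deriv g t v ->
  path_deriv om t (v / chart_deriv c f (om t)) /\
  N (v / chart_deriv c f (om t)) = density lamO c (g t) * N v * (1 - N (om t) ^+ 2).
Proof.
move=> om1 com [d d0 fom] D.
have E0 : f (om t) = from_chart c (g t) by have := fom 0; rewrite normr0 addr0; apply.
have ct : in_chart c (f (om t)) by rewrite E0; exact: in_chart_from.
have [r r0 P] := holomorphic_chart open_unit_disk holf om1 ct.
have [_ _ Df PE] := P (om t) ltac:(rewrite subrr N0//).
have Eg : chart_expr c f (om t) = g t by rewrite /chart_expr E0 from_chartK.
have M := met om1; rewrite (PE lamO) Eg in M.
have M0 := hyperbolic_density_gt0 om1; rewrite -M in M0.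
have a0 : chart_deriv c f (om t) != 0.
  by apply/eqP => E; move: M0; rewrite E N0 mulr0 ltxx.
split.
  apply: (path_deriv_lift Df a0 com _ D); exists d => // h hd.
  by rewrite /chart_expr fom// from_chartK.
have Na : N (chart_deriv c f (om t)) != 0 by rewrite N_eq0.
have n2 : 1 - N (om t) ^+ 2 != 0 by rewrite gt_eqF// subr_gt0 expr_lt1 ?N_ge0.
have -> : density lamO c (g t) = hyperbolic_density_disk (om t) / N (chart_deriv c f (om t)).
  by rewrite -M mulfK.
by rewrite /hyperbolic_density_disk NM NV; field; rewrite Na n2.
Qed.

(** The set V does not depend on the chosen preimage w; this uniformity lets lifts
    be continued. *)
Lemma covering_section (q : S) : Omega q ->
  exists2 V : set S, open V /\ V q &
    forall w, N w < 1 -> V (f w) -> exists h : S -> C,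
      [/\ forall p, V p -> {for p, continuous h},
          forall p, V p -> N (h p) < 1 /\ f (h p) = p & h (f w) = w].
Proof.
move=> Oq; have [_ [_ _ even]] := cov.
have [V [sheets [[oV Vq] VO bigU triv HU]]] := even q Oq.
exists V => // w w1 Vw.
have : (unit_disk `&` f @^-1` V) w by split.
rewrite -bigU => -[U sU Uw]; have [oU [h [ch hU hf]]] := HU U sU.
exists h; split.
- move=> p Vp; move: ch; rewrite continuous_open_subspace// => ch.
  by apply: ch; rewrite inE.
- move=> p Vp; have [Uh fh] := hU p Vp; split=> //.
  have : (\bigcup_(U in sheets) U) (h p) by exists U.
  by rewrite bigU => -[].
- exact: hf.
Qed.

(** Near the given point the density is the hyperbolic density of the disk carried
    over by a local section of the covering. *)
Lemma density_continuous (c : chart) (z : C) : Omega (from_chart c z) ->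
  {for z, continuous (density lamO c)}.
Proof.
move=> Oz; have [fD [_ _ _]] := cov; have [imf _ _] := cov.2.
have [w w1 fw] : exists2 w, N w < 1 & f w = from_chart c z.
  by move: Oz; rewrite -imf => -[w w1 fw]; exists w.
have [V [oV Vq] sec] := covering_section Oz.
have [h [ch hV hw]] := sec w w1 ltac:(rewrite fw//).
pose om x := h (from_chart c x).
have com : {for z, continuous om}.
  by apply: continuous_comp; [exact: from_chart_continuous|exact: ch].
have omz : om z = w by rewrite /om -fw hw.
have cw : in_chart c (f w) by rewrite fw; exact: in_chart_from.
have [r r0 P] := holomorphic_chart open_unit_disk holf w1 cw.
have /nbhs_N [d1 d10 P1] : nbhs z [set x | V (from_chart c x)].
  by apply: (@from_chart_continuous R c z); apply: open_nbhs_nbhs.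
have [|d2 d20 P2] := (nbhs_N _ _).1 (com [set x | N (x - w) < r] _).
  by rewrite omz; apply/nbhs_N; exists r.
have key x : N (x - z) < Num.min d1 d2 ->
    (1 - N (om x) ^+ 2)^-1 * (N (chart_deriv c f (om x)))^-1 = density lamO c x.
  rewrite lt_min => /andP[/P1 Vx /P2 xr].
  have [Dx cx _ PE] := P (om x) xr.
  have [om1 fom] := hV _ Vx; rewrite -/(om x) in om1 fom.
  have M := met om1; rewrite (PE lamO) /chart_expr fom from_chartK in M.
  have M0 := hyperbolic_density_gt0 om1; rewrite -M in M0.
  have Na : N (chart_deriv c f (om x)) != 0.
    by apply/eqP => E; move: M0; rewrite E mulr0 ltxx.
  by rewrite -[_^-1 in LHS]div1r -/(hyperbolic_density_disk (om x)) -M mulfK.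
apply: (continuous_near (u := fun x => (1 - N (om x) ^+ 2)^-1 * (N (chart_deriv c f (om x)))^-1)).
  by exists (Num.min d1 d2); [rewrite lt_min d10|exact: key].
have w0 : 1 - N w ^+ 2 != 0 by rewrite gt_eqF// subr_gt0 expr_lt1 ?N_ge0.
have Na : N (chart_deriv c f w) != 0.
  have [_ _ _ PE] := P w ltac:(rewrite subrr N0//).
  have M0 := hyperbolic_density_gt0 w1; rewrite -(met w1) (PE lamO) in M0.
  by apply/eqP => E; move: M0; rewrite E mulr0 ltxx.
have c1 : {for w, continuous (fun x : C => (1 - N x ^+ 2)^-1)}.
  have H := continuous_inv (f := fun x : C => 1 - N x ^+ 2) w0 (@continuous_subN R 1 w); exact: H.
have c2 : {for w, continuous (fun x : C => (N (chart_deriv c f x))^-1)}.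
  have H := continuous_inv (f := fun x : C => N (chart_deriv c f x)) Na
    (holomorphic_chart_deriv_continuous open_unit_disk holf w1 cw); exact: H.
have c3 := continuous_mul (f := fun x : C => (1 - N x ^+ 2)^-1) c1 c2.
rewrite -omz in c3; exact: continuous_comp com c3.
Qed.

Definition lift_within (r : R) (q : S) : Prop :=
  exists2 w, N w < 1 /\ f w = q & hyp_radius w <= r.

(** Instead of one continuous lift of the whole arc, only its endpoints are followed,
    with a bound for the hyperbolic radius: inside an evenly covered set the local
    section through the current preimage gives the preimage at an earlier time, and
    the steps are put together by [backward_induction].  The arc is run backwards
    since the preimage is prescribed at its end. *)
Lemma arc_lift (c : chart) (g : R -> C) (Phi : R -> R) (a b r : R) : a < b ->
  (forall t, a <= t <= b -> path_deriv g t (velocity g t)) ->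
  (forall t, a <= t <= b -> Omega (from_chart c (g t))) ->
  (forall t, a < t < b -> is_derive t 1 Phi (density lamO c (g t) * N (velocity g t))) ->
  {within `[a, b], continuous Phi} ->
  lift_within r (from_chart c (g b)) -> lift_within (r + (Phi b - Phi a)) (from_chart c (g a)).
Proof.
move=> ab dg Og dPhi cPhi lb.
pose P t := lift_within (r + (Phi b - Phi t)) (from_chart c (g t)).
apply: (backward_induction (P := P) (ltW ab)); last by rewrite /P subrr addr0.
move=> s sab; have [V [oV Vq] sec] := covering_section (Og s sab).
have cgs : {for s, continuous (fun t => from_chart c (g t) : S)}.
  apply: continuous_comp; first exact: path_deriv_continuous (dg s sab).
  exact: from_chart_continuous.
have /nbhs_ballP [d /= d0 dP] : nbhs s [set t | V (from_chart c (g t))].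
  by apply: cgs; apply: open_nbhs_nbhs.
exists d => // t1 t2 at1 t12 t2b t1s t2s [w [w1 fw] wr].
have inV t : t1 <= t <= t2 -> exists2 d', 0 < d' & forall h, `|h| < d' -> V (from_chart c (g (t + h))).
  move=> /andP[h1 h2].
  have ts : `|t - s| < d.
    by move: t1s t2s; rewrite !ltr_norml => /andP[? ?] /andP[? ?]; apply/andP; split; lra.
  exists (d - `|t - s|); first by rewrite subr_gt0.
  move=> h hd; apply: dP; rewrite /ball/= distrC addrAC.
  by apply: le_lt_trans (ler_normD _ _) _; lra.
have inV0 t : t1 <= t <= t2 -> V (from_chart c (g t)).
  by move=> /inV [d' d'0 H]; have := H 0; rewrite normr0 addr0; apply.
have t22 : t1 <= t2 <= t2 by rewrite t12 lexx.
have t11 : t1 <= t1 <= t2 by rewrite t12 lexx.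
have Vw : V (f w) by rewrite fw; exact: inV0.
have [h [ch hV hw]] := sec w w1 Vw.
pose om t := h (from_chart c (g t)).
have om2 : om t2 = w by rewrite /om -fw hw.
have inab t : t1 <= t <= t2 -> a <= t <= b.
  by move=> /andP[h1 h2]; rewrite (le_trans at1 h1) (le_trans h2 t2b).
pose v t := velocity g t / chart_deriv c f (om t).
have dom t : t1 <= t <= t2 -> path_deriv om t (v t) /\
    N (v t) = density lamO c (g t) * N (velocity g t) * (1 - N (om t) ^+ 2).
  move=> tt; have [om1 fom] := hV _ (inV0 t tt); rewrite -/(om t) in om1 fom.
  apply: lift_derivative => //.
  - apply: (@continuous_comp _ _ _ (fun t => from_chart c (g t) : S) h); last exact: ch (inV0 t tt).
    apply: continuous_comp; first exact: path_deriv_continuous (dg t (inab t tt)).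
    exact: from_chart_continuous.
  - by have [d' d'0 H] := inV t tt; exists d' => // x /H /hV [].
  - exact: dg (inab t tt).
have om1 t : t1 <= t <= t2 -> N (om t) < 1 by move=> tt; have [] := hV _ (inV0 t tt).
have G : hyp_radius (om t1) <= hyp_radius (om t2) + (Phi t2 - Phi t1).
  apply: (hyp_radius_growth (v := v) (j := fun t => density lamO c (g t) * N (velocity g t)) t12).
  - by move=> t tt; split; [exact: (dom t tt).1|exact: om1].
  - move=> t /andP[h1 h2]; have tt : t1 <= t <= t2 by rewrite !ltW.
    by rewrite (dom t tt).2.
  - by move=> t /andP[h1 h2]; apply: dPhi; rewrite (le_lt_trans at1 h1) (lt_le_trans h2 t2b).
  - apply: continuous_subspaceW cPhi => t /=; rewrite !in_itv/= => tt; exact: inab.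
exists (om t1); first by have [] := hV _ (inV0 t1 t11).
by move: G; rewrite om2; clear -wr; lra.
Qed.

End Covering.
End Lifts.

(** * Lengths of curves *)
Section CurveLength.
Context {R : realType}.
Local Notation C := (Cplx R).
Local Notation S := (Sphere R).
Local Notation mu := (@lebesgue_measure R).

Lemma continuous_primitive (j : R -> R) (a b : R) : a < b ->
  {within `[a, b], continuous j} ->
  exists Phi : R -> R,
    [/\ Phi a = 0, (\int[mu]_(t in `[a, b]) (j t)%:E = (Phi b)%:E)%E,
        {within `[a, b], continuous Phi} &
        forall t, a < t < b -> is_derive t 1 Phi (j t)].
Proof.
move=> ab cj.
have ij : mu.-integrable `[a, b] (EFin \o j).
  by apply: continuous_compact_integrable => //; exact: segment_compact.
exists (fun x => parameterized_integral mu a x j); split.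
- by rewrite /parameterized_integral set_itv1 Rintegral_set1.
- by rewrite /parameterized_integral /Rintegral fineK//; exact: integrable_fin_num.
- exact: parameterized_integral_continuous (ltW ab) ij.
- move=> t /andP[at1 tb].
  have [cjo _ _] := (continuous_within_itvP j ab).1 cj.
  have ct : {for t, continuous j} by apply: cjo; rewrite in_itv/= at1.
  have [h1 h2] := continuous_FTC1_closed tb ij at1 ct.
  by apply: DeriveDef; [exact: h1|rewrite -derive1E; exact: h2].
Qed.

Definition speed (lam : S -> R) (gamma : R -> S) (t : R) : R :=
  lam (gamma t) * N (velocity (local_expr gamma t) t : R[i]).

(** The speed does not depend on the chart.  Only a point in the chart at infinity
    with finite nonzero value needs an argument, where the change of coordinate
    1/w enters. *)
Lemma speed_chart (lam : S -> R) (gamma : R -> S) (c : chart) (g : R -> C) (t : R) :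
  (exists2 d, 0 < d & forall h : R, `|h| < d -> gamma (t + h) = from_chart c (g (t + h))) ->
  path_deriv g t (velocity g t) ->
  speed lam gamma t = density lam c (g t) * N (velocity g t).
Proof.
move=> near D; have [d d0 E] := near.
have E0 : gamma t = from_chart c (g t) by have := E 0; rewrite normr0 addr0; apply.
have same : chart_at (gamma t) = c ->
    path_deriv (local_expr gamma t) t (velocity g t).
  move=> cc; apply: path_deriv_near D; exists d => // h hd.
  by rewrite /local_expr cc E// from_chartK.
rewrite /speed; case: c E0 same E near => E0 same E near.
  by rewrite (path_deriv_velocity (same _)) E0.
have [g0|g0] := eqVneq (g t) 0.
  have G : gamma t = None by rewrite E0 /= g0 eqxx.
  by rewrite (path_deriv_velocity (same _)) G //= g0 eqxx.
have G : gamma t = Some (g t)^-1 by rewrite E0 /= (negbTE g0).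
have DV := path_deriv_comp (cderivV g0) D.
have DL : path_deriv (local_expr gamma t) t (- (g t)^-1 ^+ 2 * velocity g t).
  apply: path_deriv_near DV; exists d => // h hd.
  rewrite /local_expr G /= E//=; case: eqVneq => [->|//].
  by rewrite invr0.
rewrite (path_deriv_velocity DL) G /= (negbTE g0) NM NN NX NV exprVn.
by rewrite mulrA.
Qed.

Section Covering.
Context (f : C -> S) (Omega : set S) (lamO : S -> R).
Context (cov : holomorphic_universal_covering Omega f).
Context (met : forall z, unit_disk z -> pullback f lamO z = hyperbolic_density_disk z).

(** What is needed from a piece of a curve, in a form which is preserved when pieces
    are joined: measurability of the speed for the additivity of the integral, and
    a lifting property with a constant which equals the length. *)
Definition liftable_piece (gamma : R -> S) (a b : R) : Prop :=
  measurable_fun `[a, b] (speed lamO gamma) /\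
  exists L : R, (\int[mu]_(t in `[a, b]) (speed lamO gamma t)%:E = L%:E)%E /\
    forall r, lift_within f r (gamma b) -> lift_within f (r + L) (gamma a).

(** At the ends of the piece the curve need not have the velocity of the arc, hence
    its speed is compared with that of the arc on the open interval only. *)
Lemma arc_liftable (gamma : R -> S) (c : chart) (g : R -> C) (a b : R) : a < b ->
  C1_arc a b g -> (forall t, a <= t <= b -> gamma t = from_chart c (g t)) ->
  (forall t, a <= t <= b -> Omega (gamma t)) ->
  liftable_piece gamma a b.
Proof.
move=> ab [dg cv] gE Og.
have D t : a <= t <= b -> path_deriv g t (velocity g t).
  by move=> /dg [h1 h2]; exact: derivable_path_deriv.
have Og' t : a <= t <= b -> Omega (from_chart c (g t)).
  by move=> tt; rewrite -gE//; exact: Og.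
pose j t := density lamO c (g t) * N (velocity g t).
have cj : {within `[a, b], continuous j}.
  have c1 : {within `[a, b], continuous (fun t => density lamO c (g t))}.
    apply: continuous_in_subspaceT => t; rewrite inE/= in_itv/= => tt.
    apply: (@continuous_comp _ _ _ g (density lamO c)).
      exact: path_deriv_continuous (D t tt).
    exact: (density_continuous cov met (Og' t tt)).
  have c2 : {within `[a, b], continuous (fun t => N (velocity g t) : R)}.
    move=> x; apply: continuous_comp (cv x) _; exact: N_continuous.
  move=> x; have H := continuous_mul (c1 x) (c2 x); exact: H.
have [Phi [Pa Pb cPhi dPhi]] := continuous_primitive ab cj.
have sj t : a < t < b -> speed lamO gamma t = j t.
  move=> /andP[at1 tb]; apply: speed_chart; last by apply: D; rewrite !ltW.
  exists (Num.min (t - a) (b - t)); first by rewrite lt_min !subr_gt0 at1.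
  move=> h; rewrite lt_min !ltr_norml => /andP[/andP[h1 _] /andP[_ h2]].
  by apply: gE; apply/andP; split; lra.
have mo : measurable_fun `]a, b[ (speed lamO gamma).
  apply: (@eq_measurable_fun _ _ _ _ _ j).
    by move=> t; rewrite inE/= in_itv/= => tt; rewrite sj.
  apply: open_continuous_measurable_fun; first exact: interval_open.
  move=> t; rewrite inE/= => tt.
  have [cjo _ _] := (continuous_within_itvP j ab).1 cj.
  exact: cjo.
split; first exact: measurable_fun_itv_cc mo.
exists (Phi b); split.
  rewrite integral_itv_bndoo; last exact/measurable_EFinP.
  rewrite -Pb [RHS]integral_itv_bndoo.
    by apply: eq_integral => t; rewrite inE/= in_itv/= => tt; rewrite sj.
  apply/measurable_EFinP; apply: (@eq_measurable_fun _ _ _ _ _ (speed lamO gamma)) => //.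
  by move=> t; rewrite inE/= in_itv/= => tt; rewrite sj.
move=> r lr; rewrite -[Phi b]subr0 -Pa.
rewrite (gE a) ?lexx ?ltW//; apply: (arc_lift cov met ab D Og' dPhi cPhi).
by rewrite -gE// lexx ltW.
Qed.

Lemma path_lt_last (s : seq R) (a : R) : path <%R a s -> a <= last a s.
Proof.
by elim: s a => [|b s IH] a //= /andP[ab /IH]; apply: le_trans; exact: ltW.
Qed.

Lemma partition_nth (s : seq R) (a a0 x : R) (i : nat) : path <%R a s -> a0 <= a -> (i < size s)%N ->
  a0 <= nth x (a :: s) i /\ nth x (a :: s) i < nth x s i /\ nth x s i <= last a s.
Proof.
elim: s i a => [|b s IH] [|i] a //= /andP[ab pb] a0a si.
  by split=> //; split=> //; exact: path_lt_last.
by apply: IH => //; exact: le_trans a0a (ltW ab).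
Qed.

Lemma partition_liftable (gamma : R -> S) (s : seq R) (a : R) : path <%R a s ->
  (forall t, a <= t <= last a s -> 0 <= speed lamO gamma t) ->
  (forall i, (i < size s)%N -> liftable_piece gamma (nth 1 (a :: s) i) (nth 1 s i)) ->
  a <= last a s /\ liftable_piece gamma a (last a s).
Proof.
elim: s a => [|b s IH] a /=.
  move=> _ _ _; split=> //; split.
    by rewrite set_itv1; exact: measurable_fun_set1.
  exists 0; split; first by rewrite set_itv1 integral_set1.
  by move=> r; rewrite addr0.
move=> /andP[ab pb] pos pieces.
have [mab [L1 [I1 lift1]]] := pieces 0%N isT; rewrite /= in mab I1 lift1.
have [bl [mbl [L2 [I2 lift2]]]] := IH b pb
  (fun t tt => pos t (introT andP (conj (le_trans (ltW ab) (andP tt).1) (andP tt).2)))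
  (fun i si => pieces i.+1 si).
split; first exact: le_trans (ltW ab) bl.
have U : `[a, last b s]%classic = `[a, b]%classic `|` `]b, last b s]%classic.
  by apply: itv_bndbnd_setU; rewrite bnd_simp// ltW.
have mo : measurable_fun `]b, last b s] (speed lamO gamma).
  by apply: measurable_funS mbl => //; apply: subset_itvr; rewrite bnd_simp.
have mU : measurable_fun (`[a, b]%classic `|` `]b, last b s]%classic) (speed lamO gamma).
  by apply/measurable_funU => //.
split; first by rewrite U.
exists (L2 + L1); split; last by move=> r /lift2 /lift1; rewrite addrA.
rewrite U ge0_integral_setU//=.
- by rewrite I1 integral_itv_obnd_cbnd ?I2 -?EFinD 1?addrC//; exact/measurable_EFinP.
- exact/measurable_EFinP.
- move=> t tt; have : `[a, last b s]%classic t by rewrite U; case: tt => tt; [left|right].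
  by rewrite /= in_itv/= lee_fin; exact: pos.
- rewrite disj_set2E; apply/eqP/seteqP; split=> // t [/=]; rewrite !in_itv/=.
  by move=> /andP[_ tb] /andP[/lt_le_trans/(_ tb)]; rewrite ltxx.
Qed.

Theorem curve_lift (gamma : R -> S) (p q : S) : joining_curve Omega p q gamma ->
  exists L : R, curve_length lamO gamma = L%:E /\
    forall r, lift_within f r q -> lift_within f (r + L) p.
Proof.
move=> [[s [ps /eqP ls] pieces] g0 g1 Og].
have ord (i : nat) : (i < size s)%N -> 0 <= nth 1 (0 :: s) i /\
    nth 1 (0 :: s) i < nth 1 s i /\ nth 1 s i <= 1.
  by move=> si; have := partition_nth 1 ps (lexx 0) si; rewrite ls.
have pos t : 0 <= t <= 1 -> 0 <= speed lamO gamma t.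
  move=> tt; rewrite /speed mulr_ge0 ?N_ge0//; apply: ltW.
  have [imf _ _] := cov.2; have := Og t tt; rewrite -imf => -[w w1 <-].
  exact: hyperbolic_metric_gt0 w1 (met w1).
have [_ [_ [L [I lift]]]] := @partition_liftable gamma s 0 ps
  ltac:(by rewrite ls) ltac:(by move=> i si; have [h1 [h2 h3]] := ord i si;
    have [c [g [arc gE]]] := pieces i si;
    apply: (arc_liftable h2 arc gE) => t /andP[t1 t2]; apply: Og;
    rewrite (le_trans h1 t1) (le_trans t2 h3)).
by exists L; split; [rewrite -I ls|rewrite ls g0 g1 in lift; exact: lift].
Qed.

End Covering.
End CurveLength.

(** * Contact at the boundary *)
Section Final.
Context {R : realType}.
Local Notation C := (Cplx R).
Local Notation S := (Sphere R).

Lemma expR_hyp_radius (w : R[i]) : N w < 1 ->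
  expR (- 4 * hyp_radius w) <= (1 - N w ^+ 2) ^+ 2.
Proof.
move=> w1; have w0 := N_ge0 w; rewrite /hyp_radius /atanh.
set x := N w in w1 w0 *.
have p1 : 0 < 1 - x by lra.
have p2 : 0 < 1 + x by lra.
have q0 : 0 < (1 + x) / (1 - x) by rewrite divr_gt0.
have -> : -4 * (ln ((1 + x) / (1 - x)) / 2) = - (ln ((1 + x) / (1 - x)) + ln ((1 + x) / (1 - x))) by field.
rewrite expRN expRD lnK// -expr2 -exprVn invf_div.
have -> : 1 - x ^+ 2 = (1 - x) * (1 + x) by ring.
rewrite ler_pXn2r ?nnegrE ?divr_ge0 ?mulr_ge0 ?(ltW p1) ?(ltW p2)//.
rewrite ler_wpM2l ?(ltW p1)//; apply: (@le_trans _ _ 1); last by lra.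
by rewrite invf_le1//; lra.
Qed.

(** The ratio of the metrics is the pulled back density relative to the hyperbolic
    density of the disk. *)
Lemma ratio_pullback (f : C -> S) (lam lamO : S -> R) (w : R[i]) : N w < 1 ->
  pullback f lamO w = hyperbolic_density_disk w ->
  pullback f lam w * (1 - N w ^+ 2) = lam (f w) / lamO (f w).
Proof.
move=> w1 E; have l0 := hyperbolic_metric_gt0 w1 E.
have w2 : 0 < 1 - N w ^+ 2 by rewrite subr_gt0 expr_lt1 ?N_ge0.
move: E; rewrite /pullback /hyperbolic_density_disk; set n := N _ => E.
have -> : n = (1 / (1 - N w ^+ 2)) / lamO (f w) by rewrite -E mulrAC mulfV ?mul1r// gt_eqF.
by field; rewrite !gt_eqF.
Qed.

(** The boundary version of Ahlfors' lemma, expressed on the domain itself, since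
    exp(-4 d) <= (1 - |w|^2)^2 at the hyperbolic radius d of w. *)
Lemma ratio_gap (f : C -> S) (Omega : set S) (lam lamO : S -> R) (p : S) :
  open Omega -> holomorphic_universal_covering Omega f ->
  (forall z, unit_disk z -> pullback f lamO z = hyperbolic_density_disk z) ->
  conformal_pseudometric Omega lam -> curvature_le Omega lam (-4) ->
  Omega p -> lam p <> lamO p ->
  exists2 k : R, 0 < k & forall r q, lift_within f r q ->
    k * expR (- 4 * r) <= 1 - lam q / lamO q.
Proof.
move=> oO cov met psm curv Op ne.
have [holf [imf _ _]] := cov.
have fO w : unit_disk w -> Omega (f w) by move=> w1; rewrite -imf; exists w.
have [a a1 fa] : exists2 a, N a < 1 & f a = p.
  by move: Op; rewrite -imf => -[a a1 fa]; exists a.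
have sub := pullback_subsolution oO holf fO psm curv.
have va : pullback f lam a * (1 - N a ^+ 2) < 1.
  rewrite lt_neqAle ahlfors// andbT; apply/eqP => E; apply: ne.
  move: E; rewrite (ratio_pullback lam a1 (met a a1)) fa => E.
  have l0 := hyperbolic_metric_gt0 a1 (met a a1); rewrite fa in l0.
  have l0' : lamO p != 0 by rewrite gt_eqF.
  by rewrite -[lam p](divfK l0') E mul1r.
have [k k0 kP] := boundary_schwarz oO holf fO psm curv a1 va.
exists k => // r q [w [w1 <-] wr].
rewrite -(ratio_pullback lam w1 (met w w1)).
apply: le_trans (kP w w1); rewrite ler_wpM2l ?(ltW k0)//.
apply: le_trans (expR_hyp_radius w1); rewrite ler_expR !mulNr lerN2.
by rewrite ler_wpM2l.
Qed.

End Final.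
Unset Implicit Arguments.
Set Strict Implicit.
Set Printing Implicit Defensive.

Theorem theorem2p1 (R : realType) (Omega : set (Sphere R))
    (lamO lam : Sphere R -> R) (z : nat -> Sphere R) (p : Sphere R)
    (Omega_hyp : hyperbolic_domain Omega)
    (lamO_hyp : hyperbolic_metric Omega lamO)
    (lam_pseudo : conformal_pseudometric Omega lam)
    (lam_curv : curvature_le Omega lam (-4))
    (z_in : forall n, Omega (z n))
    (p_bd : boundary Omega p)
    (z_to_p : z @ \oo --> p)
    (contact : exists2 q, Omega q & boundary_contact Omega lam lamO z q) :
  (forall q, Omega q -> boundary_contact Omega lam lamO z q) /\
  (forall w, Omega w -> lam w = lamO w).
Proof.
have [_ oO _ _] := Omega_hyp; have [f cov met] := lamO_hyp.
have [holf [imf _ _]] := cov.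
have lift q : Omega q -> exists2 w, N w < 1 & f w = q.
  by rewrite -imf => -[w w1 fw]; exists w.
have lamO_gt0 q : Omega q -> 0 < lamO q.
  by move=> /lift [w w1 <-]; exact: hyperbolic_metric_gt0 w1 (met w w1).
have eq_lam w : Omega w -> lam w = lamO w.
  move=> Ow; apply: contrapT => ne.
  have [k k0 gap] := ratio_gap oO cov met lam_pseudo lam_curv Ow ne.
  have [q Oq con] := contact.
  have [wq wq1 fwq] := lift q Oq.
  pose rq := hyp_radius wq.
  have lq : lift_within f rq q by exists wq.
  (* The gap is compared with the error term for a curve whose length exceeds the
     distance by at most 1, whence the constant k'. *)
  pose E n := fine (expeR (- 4%:E * hyperbolic_dist Omega lamO (z n) q)%E).
  pose k' := k * expR (- 4 * (rq + 1)).
  have k'0 : 0 < k' by rewrite mulr_gt0// expR_gt0.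
  have pos n : 0 < 1 - lam (z n) / lamO (z n).
    have [wn wn1 fwn] := lift _ (z_in n).
    apply: lt_le_trans (gap (hyp_radius wn) (z n) _); last by exists wn.
    by rewrite mulr_gt0// expR_gt0.
  have E0 n : 0 <= E n.
    by rewrite /E fine_ge0// expeR_ge0.
  have lower n : k' * E n <= 1 - lam (z n) / lamO (z n).
    rewrite /E; case dE: (hyperbolic_dist _ _ _ _) => [x||].
    - have : (hyperbolic_dist Omega lamO (z n) q < (x + 1)%:E)%E.
        by rewrite dE lte_fin ltrDl.
      move=> /ereal_inf_lt [_ [gamma join <-]].
      have [L [-> lft]] := curve_lift cov met join.
      rewrite lte_fin => Lx; apply: le_trans (gap _ _ (lft _ lq)).
      rewrite -EFinN -EFinM /= /k' -mulrA -expRD ler_wpM2l ?(ltW k0)// ler_expR.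
      by clear -Lx; lra.
    (* For an infinite distance the exponential is 0 or infinite, and its finite part
       is 0. *)
    - by rewrite lt0_muley ?lte_fin ?oppr_lt0//= mulr0 ltW.
    - by rewrite lt0_muleNy ?lte_fin ?oppr_lt0//= mulr0 ltW.
  have := con; rewrite /boundary_contact => /eqaddoP /(_ (k' / 2)).
  rewrite divr_gt0// => /(_ isT) [n _ /(_ n (leqnn n))] /=.
  rewrite -/(E n) [`|E n|]ger0_norm// => H.
  have P := pos n; have L := lower n.
  have : 1 - lam (z n) / lamO (z n) <= k' / 2 * E n.
    apply: le_trans H; rewrite distrC; exact: ler_norm.
  by move: P L (E0 n) k'0; clear; nra.
split=> // q Oq; apply/eqaddoP => e e0; near=> n.
have -> : ((fun n => lam (z n) / lamO (z n)) - (fun=> 1)) n =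
    lam (z n) / lamO (z n) - 1 by [].
rewrite eq_lam// divff ?gt_eqF ?lamO_gt0// subrr normr0 mulr_ge0//.
exact: ltW.
Unshelve. all: by end_near.
Qed.
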